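(* Let $\mathrm{P}\subset\mathbb{R}^3$ be Schwarz's primitive surface, normalized so that its translation lattice is the body-centered cubic lattice $\mathcal{L}$ generated by $2\mathbb{Z}^3$ and $(1,1,1)$, and so that the origin is a center of one of the two labyrinths. Let $\mathcal{C}(t)=\operatorname{cn}\bigl(2K[\tfrac34]\,t,\ \tfrac34\bigr)$ and put $$\mathcal{P}(x,y,z):=\mathcal{C}(x)+\mathcal{C}(y)+\mathcal{C}(z)-3\,\mathcal{C}(x)\,\mathcal{C}(y)\,\mathcal{C}(z),\qquad (x,y,z)\in\mathbb{R}^3.$$ Then $$\{(x,y,z)\in\mathbb{R}^3:\mathcal{P}(x,y,z)=0\}=\mathrm{P}\ \sqcup\ \mathcal{L}\quad\text{(disjoint union)},$$ where the exceptional set is the lattice itself, $\mathcal{L}=\{n\in\mathbb{Z}^3: n_1\equiv n_2\equiv n_3 \pmod 2\}$, a discrete set disjoint from the topological closure $\overline{\mathrm{P}}$ of $\mathrm{P}$. (Thus the equation $\mathcal{P}=0$ determines $\mathrm{P}$.)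
   Context: Elliptic functions use the parameter convention $m=k^2$: $K[m]=\int_0^{\pi/2}(1-m\sin^2\theta)^{-1/2}\,d\theta$ is the complete elliptic integral of the first kind and $\operatorname{cn}(u,m)$ is the Jacobi elliptic function with parameter $m$. Schwarz's primitive surface $\mathrm{P}$ is the classical complete embedded triply periodic minimal surface with space group $Im\bar3m$. Up to homothety and rigid motion it is the surface generated by the Weierstrass data with Gauss map $G=\zeta$ and height differential $2\zeta\,d\zeta/\sqrt{1+14\zeta^4+\zeta^8}$; that is, the complete surface obtained by analytic continuation from the patch $\operatorname{Re}\int (1-\zeta^2,\ i(1+\zeta^2),\ 2\zeta)\,\frac{d\zeta}{\sqrt{1+14\zeta^4+\zeta^8}}$ near $\zeta=0$ (in these coordinates the cubic axes are the coordinate axes). Its translation lattice is the group of all translations of $\mathbb{R}^3$ mapping $\mathrm{P}$ to itself. The two labyrinths are the two connected components of $\mathbb{R}^3\setminus\mathrm{P}$; a center of a labyrinth is a point of it fixed by a full octahedral point group (order 48) of symmetries of $\mathrm{P}$. *)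

(* Defs.v *)
From Stdlib Require Import Reals ZArith ClassicalEpsilon.
From Coquelicot Require Import Coquelicot.

Open Scope R_scope.

(** Coquelicot's [norm] on [R * R * R] is the Euclidean norm ([prod_norm] is
    [sqrt (norm x ^ 2 + norm y ^ 2)]); its balls are those of the max distance,
    which induces the same topology. *)
Notation E3 := (R * R * R)%type.

(** * Elliptic functions, with parameter [m = k^2] *)

Definition ellF (phi m : R) : R :=
  RInt (fun theta => / sqrt (1 - m * sin theta ^ 2)) 0 phi.

Definition ellK (m : R) : R := ellF (PI / 2) m.

(** Jacobi amplitude: for [0 <= m < 1], [ellF _ m] is a bijection of [R], so
    [am u m] is the only [phi] with [ellF phi m = u]. *)
Definition am (u m : R) : R :=
  epsilon (inhabits 0) (fun phi => ellF phi m = u).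

Definition cn (u m : R) : R := cos (am u m).

Definition calC (t : R) : R := cn (2 * ellK (3 / 4) * t) (3 / 4).

Definition calP (p : E3) : R :=
  let '(x, y, z) := p in
  calC x + calC y + calC z - 3 * (calC x * calC y * calC z).

(** * Subsets of space *)

Definition closure (A : E3 -> Prop) (p : E3) : Prop :=
  forall eps : posreal, exists q, A q /\ ball p eps q.

Definition discrete_set (A : E3 -> Prop) : Prop :=
  forall p, A p -> exists eps : posreal, forall q, A q -> ball p eps q -> q = p.

Definition connected (A : E3 -> Prop) : Prop :=
  forall U V : E3 -> Prop, open U -> open V ->
    (forall p, A p -> U p \/ V p) ->
    (exists p, A p /\ U p) -> (exists p, A p /\ V p) ->
    exists p, A p /\ U p /\ V p.

Definition connected_component (D U : E3 -> Prop) : Prop :=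
  exists p, D p /\
    forall q, U q <->
      exists A : E3 -> Prop,
        connected A /\ (forall r, A r -> D r) /\ A p /\ A q.

Definition isometry (g : E3 -> E3) : Prop :=
  forall p q, norm (minus (g p) (g q)) = norm (minus p q).

Definition symmetry (S : E3 -> Prop) (h : E3 -> E3) : Prop :=
  isometry h /\ forall p, S (h p) <-> S p.

Definition translation_lattice (S : E3 -> Prop) (v : E3) : Prop :=
  symmetry S (fun p => plus p v).

(** * The Schwarz P surface *)

(** Velocity of the curve
    [Re int (1 - zeta^2, i (1 + zeta^2), 2 zeta) dzeta / w] at a parameter
    where the path has position [zeta] and velocity [dzeta]. *)
Definition velocity1 (zeta w dzeta : C) : R :=
  Re ((1 - zeta ^ 2) * (dzeta / w))%C.
Definition velocity2 (zeta w dzeta : C) : R :=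
  Re (Ci * (1 + zeta ^ 2) * (dzeta / w))%C.
Definition velocity3 (zeta w dzeta : C) : R :=
  Re (2 * zeta * (dzeta / w))%C.
Definition velocity (zeta w dzeta : C) : E3 :=
  (velocity1 zeta w dzeta, velocity2 zeta w dzeta, velocity3 zeta w dzeta).

(** A C^1 path [zeta] on [0, 1) starting at [0] and avoiding the branch points,
    with the branch [w] of [sqrt (1 + 14 zeta^4 + zeta^8)] continued along it
    from the value [1]. *)
Definition continuation_path (zeta dzeta w : R -> C) : Prop :=
  zeta 0 = RtoC 0 /\ w 0 = RtoC 1 /\
  forall t, 0 <= t < 1 ->
    is_derive zeta t (dzeta t) /\ continuous dzeta t /\ continuous w t /\
    (w t ^ 2)%C = (1 + 14 * zeta t ^ 4 + zeta t ^ 8)%C /\ w t <> RtoC 0.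

Definition lift (zeta dzeta w : R -> C) (t : R) : E3 :=
  (RInt (fun s => velocity1 (zeta s) (w s) (dzeta s)) 0 t,
   RInt (fun s => velocity2 (zeta s) (w s) (dzeta s)) 0 t,
   RInt (fun s => velocity3 (zeta s) (w s) (dzeta s)) 0 t).

Definition finite_length (zeta dzeta w : R -> C) : Prop :=
  exists M : R, forall t, 0 <= t < 1 ->
    RInt (fun s => norm (velocity (zeta s) (w s) (dzeta s))) 0 t <= M.

(** Analytic continuation in the variable [zeta] reaches every point of the
    complete surface except those lying over [zeta = infinity] and over the
    zeros of [1 + 14 zeta^4 + zeta^8] (the flat points), where the surface is
    regular but [zeta] or [sqrt (1 + 14 zeta^4 + zeta^8)] is not.  The complete
    surface is the completion for the intrinsic metric, that is, the set of
    endpoints of the lifted paths of finite length on [0, 1).  An endpoint may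
    be an ordinary point, so the continued patch itself is included. *)
Definition weierstrass_surface (p : E3) : Prop :=
  exists zeta dzeta w : R -> C,
    continuation_path zeta dzeta w /\ finite_length zeta dzeta w /\
    filterlim (lift zeta dzeta w) (at_left 1) (locally p).

Definition schwarz_P_surface (S : E3 -> Prop) : Prop :=
  exists (lambda : R) (g : E3 -> E3), 0 < lambda /\ isometry g /\
    forall p, S p <-> exists q, weierstrass_surface q /\ p = g (scal lambda q).

Definition labyrinth (S U : E3 -> Prop) : Prop :=
  connected_component (fun p => ~ S p) U.

Definition octahedron_vertex (v : E3) : Prop :=
  v = (1, 0, 0) \/ v = (-1, 0, 0) \/ v = (0, 1, 0) \/ v = (0, -1, 0) \/
  v = (0, 0, 1) \/ v = (0, 0, -1).

(** The full octahedral group, of order 48, as the isometry group of the regular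
    octahedron centred at the origin. *)
Definition octahedral (s : E3 -> E3) : Prop :=
  isometry s /\ forall v, octahedron_vertex (s v) <-> octahedron_vertex v.

(** [g] places the standard octahedron at [c] in an arbitrary orientation; the
    conjugate [g s g^-1] of every octahedral [s] must be a symmetry of [S]. *)
Definition octahedral_center (S : E3 -> Prop) (c : E3) : Prop :=
  exists g : E3 -> E3, isometry g /\ g (0, 0, 0) = c /\
    forall s, octahedral s ->
      exists h, symmetry S h /\ forall p, h (g p) = g (s p).

Definition labyrinth_center (S : E3 -> Prop) (c : E3) : Prop :=
  exists U, labyrinth S U /\ U c /\ octahedral_center S c.

(** The body-centred cubic lattice generated by [2 Z^3] and [(1, 1, 1)]. *)
Definition bcc_lattice (v : E3) : Prop :=
  exists a b c d : Z,
    v = plus (2 * IZR a, 2 * IZR b, 2 * IZR c) (scal (IZR d) (1, 1, 1)).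

(* Main.v *)
(** Put [alpha(t) = arctan (sqrt 3 C(t))]. Since
    [tan a + tan b + tan c - tan a tan b tan c = sin (a + b + c) / (cos a cos b cos c)],
    the equation [P(x, y, z) = 0] says [sin (alpha(x) + alpha(y) + alpha(z)) = 0]; as
    [|alpha| <= pi/3], the sum is [0] or [+-pi], and the latter happens exactly on the lattice.
    So the theorem says that the P surface is the level set
    [alpha(x) + alpha(y) + alpha(z) = 0].

    With [T = tan alpha] and [n = alpha' / K] one has [(1 + T^2) (1 + n^2) = 4],
    [T' = K (1 + T^2) n], [n' = - K (1 + n^2) T]. Along a path [(zeta, w)] with
    [w^2 = 1 + 14 zeta^4 + zeta^8], explicit algebraic functions of [zeta], [w] and their
    conjugates solve this system with the Weierstrass integrals as time, so by uniqueness they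
    are [T] and [n] at the coordinates of the lift, and [n] is parallel to the normal vector:
    the lift stays in the level set. Conversely [(zeta, w)] is an explicit function of [T] and
    [n] on the level set, so a regular path in the level set is the lift of its own Gauss map.
    Such paths reach every point: within a unit cube one moves along coordinate slices, and the
    cubes are permuted by the reflections in the integer coordinate planes.

    Finally the translations of the level set are exactly the lattice. So a similarity taking the
    level set to a surface with the same translation lattice has a signed permutation as linear
    part, and the octahedral symmetry about the origin puts its translation part in the lattice;
    such a similarity preserves the level set. *)

Require Import Defs.
From Stdlib Require Import Reals ZArith Lra Lia Psatz ClassicalEpsilon.
From Coquelicot Require Import Coquelicot.
Open Scope R_scope.

(** * Calculus *)

(** The algebraic functions come from 1 + 14 zeta^4 + zeta^8 = (1/2) sum_k phi_k^4, where phi = (1 -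
    zeta^2, i (1 + zeta^2), 2 zeta). Because of it, w satisfies sum_k phi_k^2 Re (phi_k^2 conj w) =
    [weight] w on the curve. The T_k are rescaled values of Re (phi_k^2 conj w), and reading this
    relation from right to left recovers w from T and n. Everything is then polynomial algebra
    modulo the equation of the curve, and no elliptic integral is transformed or evaluated. Two
    obstacles shape the rest. T and n determine a coordinate only modulo 2, so equality of
    coordinates needs an argument by continuity. And a continuation path must keep zeta finite and w
    nonzero, while the level set contains points over zeta = infinity and flat points. These are
    reached only as endpoints: a path in space is C^1 up to its end but regular only before it, and
    its bounded speed gives finite length even where zeta blows up. *)

Lemma is_derive_eq (f : R -> R) (x l l' : R) : is_derive f x l -> l = l' -> is_derive f x l'.
Proof. now intros H <-. Qed.

Lemma continuous_is_derive (f : R -> R) x l : is_derive f x l -> continuous f x.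
Proof. intros H; apply (ex_derive_continuous f); eexists; exact H. Qed.

Lemma is_derive_zero_const (f : R -> R) :
  (forall x, is_derive f x 0) -> forall x y, f x = f y.
Proof.
  intros Hf x y.
  destruct (MVT_gen f x y (fun _ => 0)) as [c [_ Hc]].
  - intros z _; apply Hf.
  - intros z _; apply continuity_pt_filterlim, (ex_derive_continuous f).
    eexists; apply Hf.
  - lra.
Qed.

Lemma continuous_Rplus (f g : R -> R) t :
  continuous f t -> continuous g t -> continuous (fun t => f t + g t) t.
Proof. exact (continuous_plus f g t). Qed.

Lemma continuous_Rminus (f g : R -> R) t :
  continuous f t -> continuous g t -> continuous (fun t => f t - g t) t.
Proof. exact (continuous_minus f g t). Qed.

Lemma continuous_Rmult (f g : R -> R) t :
  continuous f t -> continuous g t -> continuous (fun t => f t * g t) t.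
Proof. exact (continuous_mult (K := R_AbsRing) f g t). Qed.

Lemma continuous_Ropp (f : R -> R) t : continuous f t -> continuous (fun t => - f t) t.
Proof. exact (continuous_opp f t). Qed.

Lemma continuous_Rpow (f : R -> R) k t : continuous f t -> continuous (fun t => f t ^ k) t.
Proof.
  intros Hf; induction k as [|k IH]; simpl; [apply continuous_const|].
  now apply continuous_Rmult.
Qed.

Lemma continuous_Rconst (c t : R) : continuous (fun _ : R => c) t.
Proof. apply continuous_const. Qed.

Lemma continuous_inv_pos (f : R -> R) t :
  continuous f t -> 0 < f t -> continuous (fun t => / f t) t.
Proof.
  intros Hf Hp; apply (continuous_comp f Rinv); [exact Hf|apply continuous_Rinv; lra].
Qed.

Ltac cont := repeat lazymatch goal with
  | |- continuous (fun _ => ?c) _ => apply (continuous_Rconst c)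
  | |- continuous (fun t => @?f t + @?g t) _ => apply (continuous_Rplus f g)
  | |- continuous (fun t => @?f t - @?g t) _ => apply (continuous_Rminus f g)
  | |- continuous (fun t => @?f t * @?g t) _ => apply (continuous_Rmult f g)
  | |- continuous (fun t => - @?f t) _ => apply (continuous_Ropp f)
  | |- continuous (fun t => @?f t ^ ?k) _ => apply (continuous_Rpow f k)
  | |- continuous _ _ => assumption
  end.

(** Carathéodory's form of differentiability. Together with its converse below it differentiates
    functions that are known only to be continuous and to satisfy an equation: the amplitude and the
    branch of the square root. *)
Lemma slope_exists (f : R -> R) t l : is_derive f t l ->
  exists k : R -> R, continuous k t /\ k t = l /\ forall y, f y - f t = k y * (y - t).
Proof.
  intros Hf; apply is_derive_Reals in Hf.
  exists (fun y => if Req_EM_T y t then l else (f y - f t) / (y - t)).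
  destruct (Req_EM_T t t) as [_|]; [|congruence].
  split; [|split; [reflexivity|]].
  - apply continuity_pt_filterlim; intros e He; destruct (Hf e He) as [d Hd].
    exists d; split; [apply cond_pos|]; intros y [[_ Hy] Hyd]; simpl in *; unfold Rdist in *.
    destruct (Req_EM_T t t) as [_|]; [|congruence].
    destruct (Req_EM_T y t) as [ -> |n]; [now contradiction Hy|].
    specialize (Hd (y - t)); replace (t + (y - t)) with y in Hd by ring.
    apply Hd; [lra|exact Hyd].
  - intros y; destruct (Req_EM_T y t) as [ -> |n]; [ring|field; lra].
Qed.

Lemma slope_derive (f k : R -> R) t : continuous k t ->
  locally t (fun y => f y - f t = k y * (y - t)) -> is_derive f t (k t).
Proof.
  intros Hk [d Hd]; apply continuity_pt_filterlim in Hk; apply is_derive_Reals.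
  intros e He; destruct (Hk e He) as [d' [Hd'0 Hd']].
  assert (Hm : 0 < Rmin d d') by (apply Rmin_glb_lt; [apply cond_pos|exact Hd'0]).
  exists (mkposreal _ Hm); intros h Hh Hhd; simpl in Hhd.
  pose proof (Rmin_l d d'); pose proof (Rmin_r d d').
  rewrite Hd.
  - replace (k (t + h) * (t + h - t) / h) with (k (t + h)) by (field; exact Hh).
    specialize (Hd' (t + h)); simpl in Hd'; unfold Rdist in Hd'; apply Hd'.
    split; [split; [exact I|lra]|replace (t + h - t) with h by ring; lra].
  - unfold ball; simpl; unfold AbsRing_ball, abs, minus, plus, opp; simpl.
    replace (t + h + - t) with h by ring; lra.
Qed.

(** * The functions cn and arctan (sqrt 3 cn) *)

(** The square of Jacobi's dn as a function of the amplitude. *)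
Definition dn2 (th : R) : R := 1 - 3 / 4 * sin th ^ 2.

Lemma dn2_bounds th : 1 / 4 <= dn2 th <= 1.
Proof. unfold dn2; pose proof (SIN_bound th); nra. Qed.

Lemma sqrt_dn2_pos th : 0 < sqrt (dn2 th).
Proof. apply sqrt_lt_R0; pose proof (dn2_bounds th); lra. Qed.

Lemma sqrt_dn2_sqr th : sqrt (dn2 th) * sqrt (dn2 th) = dn2 th.
Proof. apply sqrt_sqrt; pose proof (dn2_bounds th); lra. Qed.

Lemma inv_dn_ge1 th : 1 <= / sqrt (dn2 th).
Proof.
  rewrite <- Rinv_1 at 1; apply Rinv_le_contravar; [apply sqrt_dn2_pos|].
  rewrite <- sqrt_1; apply sqrt_le_1_alt, dn2_bounds.
Qed.

Lemma is_derive_ellF phi :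
  is_derive (fun p => ellF p (3 / 4)) phi (/ sqrt (dn2 phi)).
Proof.
  assert (Hc : forall x, continuous (fun th => / sqrt (1 - 3 / 4 * sin th ^ 2)) x).
  { intros x; apply (ex_derive_continuous (V := R_NormedModule)).
    auto_derive; pose proof (dn2_bounds x); unfold dn2 in *.
    repeat split; try lra.
    apply Rgt_not_eq, sqrt_lt_R0; lra. }
  apply (is_derive_RInt (fun th => / sqrt (1 - 3 / 4 * sin th ^ 2))
           (fun p => ellF p (3 / 4)) 0 phi); [|apply Hc].
  apply filter_forall; intros x; apply (@RInt_correct R_CompleteNormedModule).
  apply (@ex_RInt_continuous R_CompleteNormedModule); intros; apply Hc.
Qed.

Lemma ellF_0 : ellF 0 (3 / 4) = 0.
Proof. unfold ellF; rewrite RInt_point; reflexivity. Qed.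

Lemma ellF_incr a b : a <= b -> b - a <= ellF b (3 / 4) - ellF a (3 / 4).
Proof.
  intros Hab.
  destruct (MVT_gen (fun p => ellF p (3 / 4)) a b (fun p => / sqrt (dn2 p)))
    as [c [_ Hc]].
  - intros z _; apply is_derive_ellF.
  - intros z _; apply continuity_pt_filterlim, (ex_derive_continuous (fun p => ellF p (3/4))).
    eexists; apply is_derive_ellF.
  - rewrite Hc; pose proof (inv_dn_ge1 c); nra.
Qed.

Lemma ellF_inj a b : ellF a (3 / 4) = ellF b (3 / 4) -> a = b.
Proof.
  intros H; destruct (Rle_lt_dec a b) as [L|L].
  - pose proof (ellF_incr a b L); lra.
  - pose proof (ellF_incr b a); lra.
Qed.

Lemma ellF_opp a : ellF (- a) (3 / 4) = - ellF a (3 / 4).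
Proof.
  enough (ellF (- a) (3 / 4) + ellF a (3 / 4) = 0) by lra.
  rewrite (is_derive_zero_const (fun a => ellF (- a) (3 / 4) + ellF a (3 / 4))) with (y := 0).
  - rewrite Ropp_0, ellF_0; lra.
  - intros x.
    replace 0 with (plus (scal (-1) (/ sqrt (dn2 (- x)))) (/ sqrt (dn2 x))).
    + apply (is_derive_plus (V := R_NormedModule)); [|apply is_derive_ellF].
      apply (is_derive_comp (fun p => ellF p (3 / 4)) (fun a => - a));
        [apply is_derive_ellF | auto_derive; lra].
    + unfold plus, scal; simpl; unfold mult; simpl.
      unfold dn2; rewrite sin_neg.
      replace ((- sin x) ^ 2) with (sin x ^ 2) by ring; lra.
Qed.

Lemma ellF_plus_PI a : ellF (a + PI) (3 / 4) = ellF a (3 / 4) + ellF PI (3 / 4).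
Proof.
  enough (ellF (a + PI) (3 / 4) - ellF a (3 / 4) = ellF PI (3 / 4)) by lra.
  rewrite (is_derive_zero_const (fun a => ellF (a + PI) (3 / 4) - ellF a (3 / 4))) with (y := 0).
  - rewrite Rplus_0_l, ellF_0; lra.
  - intros x.
    replace 0 with (minus (scal 1 (/ sqrt (dn2 (x + PI)))) (/ sqrt (dn2 x))).
    + apply (is_derive_minus (V := R_NormedModule)); [|apply is_derive_ellF].
      apply (is_derive_comp (fun p => ellF p (3 / 4)) (fun a => a + PI));
        [apply is_derive_ellF | auto_derive; lra].
    + unfold minus, plus, opp, scal; simpl; unfold mult; simpl.
      unfold dn2; rewrite neg_sin.
      replace ((- sin x) ^ 2) with (sin x ^ 2) by ring; lra.
Qed.

Notation K34 := (ellK (3 / 4)).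

Lemma ellF_PI : ellF PI (3 / 4) = 2 * K34.
Proof.
  unfold ellK; pose proof (ellF_plus_PI (- (PI / 2))) as H.
  replace (- (PI / 2) + PI) with (PI / 2) in H by lra.
  rewrite ellF_opp in H; lra.
Qed.

Lemma K34_pos : 0 < K34.
Proof.
  unfold ellK; pose proof (ellF_incr 0 (PI / 2)); rewrite ellF_0 in H.
  pose proof PI_RGT_0; lra.
Qed.

(** The integrand is at least 1, so the values at -|u| and |u| enclose u. This is what makes the
    [epsilon] in [am] return a solution. *)
Lemma ellF_surj u : exists phi, ellF phi (3 / 4) = u.
Proof.
  pose proof (ellF_incr 0 (Rabs u) (Rabs_pos u)) as H1.
  pose proof (ellF_opp (Rabs u)) as H2; rewrite ellF_0 in H1.
  destruct (IVT_gen (fun p => ellF p (3 / 4)) (- Rabs u) (Rabs u) u) as [x [_ Hx]].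
  - intros z; apply continuity_pt_filterlim, (ex_derive_continuous (fun p => ellF p (3/4))).
    eexists; apply is_derive_ellF.
  - rewrite H2; pose proof (Rle_abs u); pose proof (Rle_abs (- u)).
    rewrite Rabs_Ropp in H0.
    rewrite Rmin_left, Rmax_right; lra.
  - now exists x.
Qed.

Definition amp (t : R) : R := am (2 * K34 * t) (3 / 4).

Lemma ellF_amp t : ellF (amp t) (3 / 4) = 2 * K34 * t.
Proof.
  exact (epsilon_spec (inhabits 0) (fun phi => ellF phi (3 / 4) = 2 * K34 * t) (ellF_surj _)).
Qed.

Lemma amp_eq t phi : ellF phi (3 / 4) = 2 * K34 * t -> amp t = phi.
Proof. intros H; apply ellF_inj; rewrite ellF_amp; auto. Qed.

Lemma amp_0 : amp 0 = 0.
Proof. apply amp_eq; rewrite ellF_0; lra. Qed.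

Lemma amp_half : amp (1 / 2) = PI / 2.
Proof. apply amp_eq; change (ellF (PI / 2) (3 / 4)) with K34; lra. Qed.

Lemma amp_opp t : amp (- t) = - amp t.
Proof. apply amp_eq; rewrite ellF_opp, ellF_amp; lra. Qed.

Lemma amp_plus1 t : amp (t + 1) = amp t + PI.
Proof. apply amp_eq; rewrite ellF_plus_PI, ellF_amp, ellF_PI; lra. Qed.

Lemma amp_lt s t : s < t -> amp s < amp t.
Proof.
  intros H; destruct (Rlt_le_dec (amp s) (amp t)) as [L|L]; [exact L|].
  apply ellF_incr in L; rewrite !ellF_amp in L; pose proof K34_pos; nra.
Qed.

Lemma amp_lipschitz s t : Rabs (amp s - amp t) <= 2 * K34 * Rabs (s - t).
Proof.
  pose proof K34_pos as HK.
  assert (H : forall s t, s <= t -> Rabs (amp s - amp t) <= 2 * K34 * Rabs (s - t)).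
  { clear s t; intros s t [L| ->].
    - pose proof (amp_lt _ _ L); pose proof (ellF_incr (amp s) (amp t)).
      rewrite !ellF_amp in H0.
      rewrite !Rabs_left by lra; lra.
    - unfold Rminus; rewrite !Rplus_opp_r, Rabs_R0; lra. }
  destruct (Rle_dec s t); [auto|].
  rewrite Rabs_minus_sym, (Rabs_minus_sym s t); apply H; lra.
Qed.

Lemma continuous_amp t : continuous amp t.
Proof.
  pose proof K34_pos as HK.
  apply continuity_pt_filterlim; intros e He.
  exists (e / (2 * K34)); split; [apply Rdiv_lt_0_compat; lra|].
  intros x [_ Hx]; simpl in *; unfold Rdist in *.
  eapply Rle_lt_trans; [apply amp_lipschitz|].
  apply Rmult_lt_compat_l with (r := 2 * K34) in Hx; [|lra].
  replace (2 * K34 * (e / (2 * K34))) with e in Hx by (field; lra); exact Hx.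
Qed.

Lemma is_derive_amp t : is_derive amp t (2 * K34 * sqrt (dn2 (amp t))).
Proof.
  pose proof K34_pos as HK; pose proof (sqrt_dn2_pos (amp t)) as Hd.
  destruct (slope_exists _ _ _ (is_derive_ellF (amp t))) as (k & Ck & Ek & Sk).
  assert (Hk : 0 < k (amp t)) by (rewrite Ek; now apply Rinv_0_lt_compat).
  assert (Cka : continuous (fun y => k (amp y)) t)
    by (apply (continuous_comp amp k); [apply continuous_amp|exact Ck]).
  apply (is_derive_eq _ _ (2 * K34 * / k (amp t))).
  - apply (slope_derive amp (fun y => 2 * K34 * / k (amp y))).
    + apply continuous_Rmult; [apply continuous_Rconst|now apply continuous_inv_pos].
    + assert (Hloc : locally t (fun y => 0 < k (amp y))).
      { apply Cka; exact (open_gt 0 _ Hk). }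
      revert Hloc; apply filter_imp; intros y Hy; specialize (Sk (amp y)).
      rewrite !ellF_amp in Sk.
      apply (Rmult_eq_reg_l (k (amp y))); [|lra].
      rewrite <- Sk; field; lra.
  - rewrite Ek, Rinv_inv; reflexivity.
Qed.

Definition tc (t : R) : R := sqrt 3 * calC t.
(** In Jacobi's notation -(sqrt 3 / 2) sn / dn. As the complementary modulus is 1/2, this equals
    [tc (t + 1 / 2)]: [tc] and [nc] are one function shifted by a quarter period, hence the
    symmetric relation (1 + T^2) (1 + n^2) = 4. *)
Definition nc (t : R) : R := - (sqrt 3 / 2) * sin (amp t) / sqrt (dn2 (amp t)).
Definition lv (t : R) : R := atan (tc t).

Lemma sqrt3_sqr : sqrt 3 * sqrt 3 = 3.
Proof. apply sqrt_sqrt; lra. Qed.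

Lemma sqrt3_pos : 0 < sqrt 3.
Proof. apply sqrt_lt_R0; lra. Qed.

Lemma calC_amp t : calC t = cos (amp t).
Proof. reflexivity. Qed.

Lemma one_plus_tc2 t : 1 + tc t ^ 2 = 4 * dn2 (amp t).
Proof.
  unfold tc, dn2; rewrite calC_amp.
  pose proof (sin2_cos2 (amp t)) as H; unfold Rsqr in H.
  pose proof sqrt3_sqr; nra.
Qed.

Lemma one_plus_nc2 t : 1 + nc t ^ 2 = / dn2 (amp t).
Proof.
  unfold nc; pose proof (sqrt_dn2_pos (amp t)); pose proof (sqrt_dn2_sqr (amp t)).
  pose proof sqrt3_sqr; pose proof (dn2_bounds (amp t)).
  replace ((- (sqrt 3 / 2) * sin (amp t) / sqrt (dn2 (amp t))) ^ 2)
    with ((sqrt 3 * sqrt 3) * sin (amp t) ^ 2 / (4 * (sqrt (dn2 (amp t)) * sqrt (dn2 (amp t)))))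
    by (field; lra).
  rewrite H0, H1; unfold dn2 in *; field; lra.
Qed.

Lemma tc_nc_curve t : (1 + tc t ^ 2) * (1 + nc t ^ 2) = 4.
Proof.
  rewrite one_plus_tc2, one_plus_nc2; pose proof (dn2_bounds (amp t)); field; lra.
Qed.

Lemma is_derive_tc t : is_derive tc t (K34 * (1 + tc t ^ 2) * nc t).
Proof.
  pose proof (sqrt_dn2_pos (amp t)); pose proof (sqrt_dn2_sqr (amp t)) as Hd.
  eapply is_derive_eq.
  - apply (is_derive_comp (fun p => sqrt 3 * cos p) amp); [|apply is_derive_amp].
    auto_derive; [exact I|reflexivity].
  - rewrite one_plus_tc2; unfold nc, scal; simpl; unfold mult; simpl.
    rewrite <- Hd at 2; field; lra.
Qed.

Lemma is_derive_nc t : is_derive nc t (- K34 * (1 + nc t ^ 2) * tc t).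
Proof.
  pose proof (sqrt_dn2_pos (amp t)); pose proof (sqrt_dn2_sqr (amp t)) as Hd.
  pose proof (dn2_bounds (amp t)) as Hb.
  eapply is_derive_eq.
  - apply (is_derive_comp (fun p => - (sqrt 3 / 2) * sin p / sqrt (dn2 p)) amp);
      [|apply is_derive_amp].
    unfold dn2 in *; auto_derive; [|reflexivity].
    replace (1 + - (3 / 4 * (sin (amp t) * (sin (amp t) * 1))))
      with (1 - 3 / 4 * sin (amp t) ^ 2) by ring.
    repeat split; lra.
  - rewrite one_plus_nc2; unfold tc; rewrite calC_amp; unfold scal; simpl; unfold mult; simpl.
    pose proof (sin2_cos2 (amp t)) as Hsc; unfold Rsqr in Hsc.
    replace (1 + - (3 / 4 * (sin (amp t) * (sin (amp t) * 1)))) with (dn2 (amp t))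
      by (unfold dn2; ring).
    assert (Hd2 : dn2 (amp t) = 1 - 3 / 4 * (sin (amp t) * sin (amp t))) by (unfold dn2; ring).
    set (d := sqrt (dn2 (amp t))) in *.
    set (s := sin (amp t)) in *; set (c := cos (amp t)) in *.
    rewrite <- Hd in Hd2 |- *.
    apply Rminus_diag_uniq.
    match goal with |- ?l = 0 =>
      replace l with (- (K34 * sqrt 3 * c / (d * d)) * (d * d + 3 / 4 * (s * s) - 1))
        by (field; lra) end.
    rewrite Hd2; ring.
Qed.

Lemma is_derive_lv t : is_derive lv t (K34 * nc t).
Proof.
  eapply is_derive_eq.
  - apply (is_derive_comp atan tc); [|apply is_derive_tc].
    apply is_derive_Reals, derivable_pt_lim_atan.
  - unfold scal; simpl; unfold mult; simpl; unfold Rsqr.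
    pose proof (one_plus_tc2 t); pose proof (dn2_bounds (amp t)).
    field; simpl in *; lra.
Qed.

Lemma tc_lv t : tc t = tan (lv t).
Proof. symmetry; apply tan_atan. Qed.

Lemma tc_bound t : - sqrt 3 <= tc t <= sqrt 3.
Proof.
  unfold tc; rewrite calC_amp; pose proof (COS_bound (amp t)); pose proof sqrt3_pos; nra.
Qed.

Lemma tc_plus1 t : tc (t + 1) = - tc t.
Proof. unfold tc; rewrite !calC_amp, amp_plus1, neg_cos; ring. Qed.

Lemma tc_opp t : tc (- t) = tc t.
Proof. unfold tc; rewrite !calC_amp, amp_opp, cos_neg; ring. Qed.

Lemma nc_plus1 t : nc (t + 1) = - nc t.
Proof.
  unfold nc; rewrite amp_plus1; unfold dn2; rewrite !neg_sin.
  replace ((- sin (amp t)) ^ 2) with (sin (amp t) ^ 2) by ring; unfold Rdiv; ring.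
Qed.

Lemma nc_opp t : nc (- t) = - nc t.
Proof.
  unfold nc; rewrite amp_opp; unfold dn2; rewrite !sin_neg.
  replace ((- sin (amp t)) ^ 2) with (sin (amp t) ^ 2) by ring; unfold Rdiv; ring.
Qed.

Lemma lv_plus1 t : lv (t + 1) = - lv t.
Proof. unfold lv; rewrite tc_plus1; apply atan_opp. Qed.

Lemma lv_opp t : lv (- t) = lv t.
Proof. unfold lv; now rewrite tc_opp. Qed.

Lemma periodic_2Z (f : R -> R) :
  (forall t, f (t + 2) = f t) -> forall (k : Z) t, f (t + 2 * IZR k) = f t.
Proof.
  intros Hf.
  assert (Hn : forall (n : nat) t, f (t + 2 * INR n) = f t).
  { intros n; induction n as [|n IH]; intros t.
    - f_equal; simpl; ring.
    - rewrite <- (IH t), <- (Hf (t + 2 * INR n)), S_INR; f_equal; ring. }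
  intros k t; destruct (Z_le_gt_dec 0 k).
  - rewrite <- (Z2Nat.id k) at 1 by lia; rewrite <- INR_IZR_INZ; apply Hn.
  - rewrite <- (Hn (Z.to_nat (- k)) (t + 2 * IZR k)), INR_IZR_INZ, Z2Nat.id by lia.
    rewrite opp_IZR; f_equal; ring.
Qed.

Lemma lv_period (k : Z) t : lv (t + 2 * IZR k) = lv t.
Proof.
  apply periodic_2Z; clear; intros t.
  replace (t + 2) with (t + 1 + 1) by ring; rewrite !lv_plus1; ring.
Qed.

Lemma nc_period (k : Z) t : nc (t + 2 * IZR k) = nc t.
Proof.
  apply periodic_2Z; clear; intros t.
  replace (t + 2) with (t + 1 + 1) by ring; rewrite !nc_plus1; ring.
Qed.

Lemma lv_0 : lv 0 = PI / 3.
Proof.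
  unfold lv, tc; rewrite calC_amp, amp_0, cos_0, Rmult_1_r, <- tan_PI3.
  apply atan_tan; pose proof PI_RGT_0; lra.
Qed.

Lemma lv_1 : lv 1 = - (PI / 3).
Proof. rewrite <- (Rplus_0_l 1), lv_plus1, lv_0; ring. Qed.

Lemma lv_half : lv (1 / 2) = 0.
Proof.
  pose proof (lv_plus1 (- (1 / 2))) as H; rewrite lv_opp in H.
  replace (- (1 / 2) + 1) with (1 / 2) in H by lra; lra.
Qed.

Lemma lv_1_minus t : lv (1 - t) = - lv t.
Proof. rewrite <- (lv_opp t), <- lv_plus1; f_equal; ring. Qed.

Lemma lv_decr s t : 0 <= s -> s < t -> t <= 1 -> lv t < lv s.
Proof.
  intros H0 Hst H1; unfold lv, tc; apply atan_increasing.
  apply Rmult_lt_compat_l; [apply sqrt3_pos|]; rewrite !calC_amp.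
  assert (amp 1 = PI) by (rewrite <- (Rplus_0_l 1), amp_plus1, amp_0; ring).
  assert (0 <= amp s).
  { destruct H0 as [H0| <- ]; [|rewrite amp_0; lra].
    pose proof (amp_lt 0 s H0); rewrite amp_0 in *; lra. }
  assert (amp t <= PI).
  { destruct H1 as [H1| -> ]; [|lra]. pose proof (amp_lt t 1 H1); lra. }
  pose proof (amp_lt s t Hst); apply cos_decreasing_1; lra.
Qed.

Lemma lv_inj s t : 0 <= s <= 1 -> 0 <= t <= 1 -> lv s = lv t -> s = t.
Proof.
  intros Hs Ht H; destruct (Rtotal_order s t) as [L|[L|L]]; [|exact L|].
  - pose proof (lv_decr s t); lra.
  - pose proof (lv_decr t s); lra.
Qed.

Lemma lv_bound t : - (PI / 3) <= lv t <= PI / 3.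
Proof.
  rewrite <- lv_1, <- lv_0.
  assert (H : forall s t, tc s <= tc t -> lv s <= lv t).
  { intros s r [L|E]; unfold lv; [left; now apply atan_increasing|rewrite E; lra]. }
  pose proof (tc_bound t).
  assert (tc 0 = sqrt 3) by (unfold tc; rewrite calC_amp, amp_0, cos_0; ring).
  assert (tc 1 = - sqrt 3) by (rewrite <- (Rplus_0_l 1), tc_plus1; lra).
  split; apply H; lra.
Qed.

(** [0, 1] is a fundamental domain of the group generated by t |-> -t and t |-> t + 2, which
    preserves [lv]; on it [lv] is injective. *)
Lemma fold_unit t : exists (k : Z) s, 0 <= s <= 1 /\ (t = s + 2 * IZR k \/ t = - s + 2 * IZR k).
Proof.
  destruct (archimed (t / 2)) as [H1 H2]; set (m := up (t / 2)) in *.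
  destruct (Rle_lt_dec (t - 2 * IZR (m - 1)) 1) as [L|L]; rewrite minus_IZR in L.
  - exists (m - 1)%Z, (t - 2 * IZR (m - 1)); rewrite minus_IZR; split; [lra|left; ring].
  - exists m, (2 * IZR m - t); split; [lra|right; ring].
Qed.

Lemma lv_fold (k : Z) s t : t = s + 2 * IZR k \/ t = - s + 2 * IZR k -> lv t = lv s.
Proof. intros [-> | ->]; rewrite lv_period; [|rewrite lv_opp]; reflexivity. Qed.

Lemma lv_max t : lv t = PI / 3 <-> exists k : Z, t = 2 * IZR k.
Proof.
  split.
  - intros H; destruct (fold_unit t) as (k & s & Hs & E).
    pose proof (lv_fold k s t E) as Hl; rewrite H, <- lv_0 in Hl.
    apply lv_inj in Hl; [|lra|lra]; exists k; destruct E; lra.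
  - intros [k ->]; rewrite <- (Rplus_0_l (2 * IZR k)), lv_period; apply lv_0.
Qed.

Lemma lv_min t : lv t = - (PI / 3) <-> exists k : Z, t = 2 * IZR k + 1.
Proof.
  pose proof (lv_plus1 (t - 1)) as E; replace (t - 1 + 1) with t in E by ring.
  split.
  - intros H; destruct (proj1 (lv_max (t - 1))) as [k Hk]; [lra|exists k; lra].
  - intros [k Hk]; rewrite E, (proj2 (lv_max (t - 1))); [ring|exists k; lra].
Qed.

Lemma lv_zero t : lv t = 0 -> exists k : Z, t = IZR k + 1 / 2.
Proof.
  intros H; destruct (fold_unit t) as (k & s & Hs & E).
  pose proof (lv_fold k s t E) as Hl; rewrite H, <- lv_half in Hl.
  apply lv_inj in Hl; [|lra|lra]; subst s.
  destruct E as [-> | ->]; [exists (2 * k)%Z|exists (2 * k - 1)%Z];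
    rewrite ?minus_IZR, mult_IZR; lra.
Qed.

Lemma nc_neg t : 0 < t < 1 -> nc t < 0.
Proof.
  intros Ht; unfold nc; pose proof (sqrt_dn2_pos (amp t)); pose proof sqrt3_pos.
  assert (amp 1 = PI) by (rewrite <- (Rplus_0_l 1), amp_plus1, amp_0; ring).
  assert (0 < amp t) by (rewrite <- amp_0; apply amp_lt; lra).
  assert (amp t < PI) by (rewrite <- H1; apply amp_lt; lra).
  assert (0 < sin (amp t)) by (apply sin_gt_0; lra).
  apply Ropp_lt_cancel; rewrite Ropp_0.
  replace (- (- (sqrt 3 / 2) * sin (amp t) / sqrt (dn2 (amp t))))
    with (sqrt 3 / 2 * sin (amp t) / sqrt (dn2 (amp t))) by (field; lra).
  apply Rdiv_lt_0_compat; nra.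
Qed.

Lemma tc_zero t : tc t = 0 <-> lv t = 0.
Proof.
  split; [intros H; unfold lv; rewrite H; apply atan_0|].
  intros H; rewrite tc_lv, H; apply tan_0.
Qed.

Lemma nc_zero_lv t : nc t = 0 -> lv t = PI / 3 \/ lv t = - (PI / 3).
Proof.
  intros H; destruct (fold_unit t) as (k & s & Hs & E).
  rewrite (lv_fold k s t E).
  assert (Hn : nc s = 0).
  { destruct E as [E|E]; rewrite E, nc_period, ?nc_opp in H; lra. }
  destruct (Req_dec s 0) as [-> |]; [left; apply lv_0|].
  destruct (Req_dec s 1) as [-> |]; [right; apply lv_1|].
  pose proof (nc_neg s); lra.
Qed.

(** [tc] fixes a coordinate up to reflection and period. The sign of [nc] excludes the reflection,
    except where [nc] vanishes, and there the reflection is itself a translation by a period. *)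
Lemma tc_nc_inj s t : tc s = tc t -> nc s = nc t -> exists k : Z, s - t = 2 * IZR k.
Proof.
  intros Ht Hn; destruct (fold_unit s) as (k & x & Hx & Es).
  destruct (fold_unit t) as (l & y & Hy & Et).
  assert (x = y).
  { apply lv_inj; auto; rewrite <- (lv_fold k x s Es), <- (lv_fold l y t Et).
    unfold lv; now rewrite Ht. }
  subst y.
  assert (Hz : nc x = 0 -> x = 0 \/ x = 1).
  { intros H; destruct (Req_dec x 0); [auto|]; destruct (Req_dec x 1); [auto|].
    pose proof (nc_neg x); lra. }
  destruct Es as [-> | ->], Et as [-> | ->];
    rewrite !nc_period, ?nc_opp in Hn.
  - exists (k - l)%Z; rewrite minus_IZR; ring.
  - destruct Hz as [-> | ->]; [lra|exists (k - l)%Z|exists (k - l + 1)%Z];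
      rewrite ?plus_IZR, minus_IZR; ring.
  - destruct Hz as [-> | ->]; [lra|exists (k - l)%Z|exists (k - l - 1)%Z];
      rewrite ?minus_IZR; ring.
  - exists (k - l)%Z; rewrite minus_IZR; ring.
Qed.

(** Inverse of [lv] on the open half period (0, 1). The ends are left out because [nc] vanishes
    there and the inverse is not differentiable. *)
Definition linv (th : R) : R := ellF (acos (tan th / sqrt 3)) (3 / 4) / (2 * K34).

Lemma lv_linv th : - (PI / 3) < th < PI / 3 -> lv (linv th) = th.
Proof.
  intros Hth; unfold lv, tc; rewrite calC_amp; pose proof K34_pos.
  pose proof sqrt3_pos; pose proof PI_RGT_0.
  rewrite (amp_eq (linv th) (acos (tan th / sqrt 3))) by (unfold linv; field; lra).
  assert (Hb : - sqrt 3 < tan th < sqrt 3).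
  { rewrite <- tan_PI3; split; [rewrite <- tan_neg|]; apply tan_increasing; lra. }
  rewrite cos_acos.
  - rewrite <- (atan_tan th) at 2 by lra; f_equal; field; lra.
  - split.
    + apply Rmult_le_reg_r with (sqrt 3); [lra|]; unfold Rdiv; rewrite Rmult_assoc, Rinv_l; lra.
    + apply Rmult_le_reg_r with (sqrt 3); [lra|]; unfold Rdiv; rewrite Rmult_assoc, Rinv_l; lra.
Qed.

Lemma linv_range th : - (PI / 3) < th < PI / 3 -> 0 < linv th < 1.
Proof.
  intros Hth; pose proof (lv_linv th Hth) as Hl; pose proof K34_pos as HK.
  assert (H : 0 <= linv th <= 1).
  { destruct (acos_bound (tan th / sqrt 3)) as [H1 H2].
    apply ellF_incr in H1; apply ellF_incr in H2; rewrite ?ellF_0, ?ellF_PI in *.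
    unfold linv; split.
    - apply Rdiv_le_0_compat; pose proof (acos_bound (tan th / sqrt 3)); lra.
    - apply Rmult_le_reg_r with (2 * K34); [lra|].
      unfold Rdiv; rewrite Rmult_assoc, Rinv_l; pose proof (acos_bound (tan th / sqrt 3)); lra. }
  split.
  - destruct (proj1 H) as [L|E]; [exact L|]; rewrite <- E, lv_0 in Hl; lra.
  - destruct (proj2 H) as [L|E]; [exact L|]; rewrite E, lv_1 in Hl; lra.
Qed.

Lemma linv_lv s : 0 < s < 1 -> linv (lv s) = s.
Proof.
  intros Hs.
  assert (Hl : - (PI / 3) < lv s < PI / 3).
  { rewrite <- lv_1, <- lv_0; split; apply lv_decr; lra. }
  pose proof (linv_range _ Hl); apply lv_inj; [lra|lra|now apply lv_linv].
Qed.

Lemma is_derive_linv th :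
  - (PI / 3) < th < PI / 3 -> is_derive linv th (/ (K34 * nc (linv th))).
Proof.
  intros Hth; pose proof K34_pos; pose proof sqrt3_pos; pose proof PI_RGT_0.
  pose proof (nc_neg _ (linv_range _ Hth)) as Hn.
  (* Only differentiability is taken from the formula; the value of the derivative follows from
     [lv (linv th) = th]. *)
  assert (Hd : ex_derive linv th).
  { assert (Hb : - sqrt 3 < tan th < sqrt 3).
    { rewrite <- tan_PI3; split; [rewrite <- tan_neg|]; apply tan_increasing; lra. }
    unfold linv, Rdiv.
    apply (ex_derive_comp (fun y => y * / (2 * K34)) (fun th => ellF (acos (tan th * / sqrt 3)) (3 * / 4)));
      [auto_derive; exact I|].
    apply (ex_derive_comp (fun p => ellF p (3 / 4)) (fun th => acos (tan th * / sqrt 3)));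
      [eexists; apply is_derive_ellF|].
    apply (ex_derive_comp acos (fun th => tan th * / sqrt 3)).
    - apply ex_derive_Reals_1, derivable_pt_acos.
      split; apply Rmult_lt_reg_r with (sqrt 3); try lra; rewrite Rmult_assoc, Rinv_l; lra.
    - apply (ex_derive_ext (fun th => sin th / cos th * / sqrt 3)); [reflexivity|].
      auto_derive; repeat split; apply Rgt_not_eq, cos_gt_0; lra. }
  destruct Hd as [l Hl].
  enough (E : l * (K34 * nc (linv th)) = 1).
  { apply (is_derive_eq _ _ l); [exact Hl|].
    apply (Rmult_eq_reg_r (K34 * nc (linv th))); [rewrite E; field; split; lra|nra]. }
  assert (Hc : is_derive (fun th => lv (linv th)) th (l * (K34 * nc (linv th)))).
  { apply (is_derive_comp lv linv); [apply is_derive_lv|exact Hl]. }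
  rewrite <- (is_derive_unique _ _ _ Hc).
  apply is_derive_unique, (is_derive_ext_loc (fun th => th)).
  - assert (Hloc : locally th (fun y => - (PI / 3) < y < PI / 3)).
    { apply (open_and (fun y => - (PI / 3) < y) (fun y => y < PI / 3));
        [apply open_gt|apply open_lt|exact Hth]. }
    revert Hloc; apply filter_imp; intros y Hy; symmetry; now apply lv_linv.
  - apply (is_derive_id (K := R_AbsRing)).
Qed.

(** These are the coordinates of the base point (1, 0, 1/2), over which zeta = 0 and w = 1. *)
Lemma start_values : tc 1 = - sqrt 3 /\ nc 1 = 0 /\ tc 0 = sqrt 3 /\ nc 0 = 0 /\
  tc (1 / 2) = 0 /\ nc (1 / 2) = - sqrt 3.
Proof.
  assert (T0 : tc 0 = sqrt 3) by (unfold tc; rewrite calC_amp, amp_0, cos_0; ring).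
  assert (N0 : nc 0 = 0) by (unfold nc; rewrite amp_0, sin_0; unfold Rdiv; ring).
  assert (T1 : tc 1 = - sqrt 3) by (rewrite <- (Rplus_0_l 1), tc_plus1, T0; reflexivity).
  assert (N1 : nc 1 = 0) by (rewrite <- (Rplus_0_l 1), nc_plus1, N0; ring).
  repeat split; auto; [exact (proj2 (tc_zero _) lv_half)|].
  unfold nc, dn2; rewrite amp_half, sin_PI2.
  replace (1 - 3 / 4 * 1 ^ 2) with (1 / 2 * (1 / 2)) by field.
  rewrite sqrt_square by lra; field.
Qed.

(** * The level set and the lattice *)

Definition levelset (p : E3) : Prop := let '(x, y, z) := p in lv x + lv y + lv z = 0.

Lemma bcc_coords (x y z : R) :
  bcc_lattice (x, y, z) <->
  exists a b c d : Z,
    x = 2 * IZR a + IZR d /\ y = 2 * IZR b + IZR d /\ z = 2 * IZR c + IZR d.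
Proof.
  unfold bcc_lattice, plus, scal; simpl; unfold prod_plus, prod_scal, plus, scal; simpl.
  unfold prod_plus, prod_scal, plus, scal, mult; simpl; unfold mult; simpl.
  split; intros (a & b & c & d & H); exists a, b, c, d.
  - injection H as -> -> ->; repeat split; ring.
  - destruct H as (-> & -> & ->); repeat f_equal; ring.
Qed.

Lemma bcc_parity (p : E3) :
  bcc_lattice p <->
  exists n1 n2 n3 : Z,
    p = (IZR n1, IZR n2, IZR n3) /\
    (n1 mod 2 = n2 mod 2)%Z /\ (n2 mod 2 = n3 mod 2)%Z.
Proof.
  destruct p as [[x y] z]; rewrite bcc_coords; split.
  - intros (a & b & c & d & -> & -> & ->).
    exists (2 * a + d)%Z, (2 * b + d)%Z, (2 * c + d)%Z.
    rewrite !plus_IZR, !mult_IZR; split; [reflexivity|].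
    split; Z.div_mod_to_equations; lia.
  - intros (n1 & n2 & n3 & E & H12 & H23); injection E as -> -> ->.
    exists (n1 / 2)%Z, (n2 / 2)%Z, (n3 / 2)%Z, (n1 mod 2)%Z.
    rewrite (Z_div_mod_eq_full n1 2) at 1; rewrite (Z_div_mod_eq_full n2 2) at 1.
    rewrite (Z_div_mod_eq_full n3 2) at 1; rewrite <- H23, <- H12.
    rewrite !plus_IZR, !mult_IZR; auto.
Qed.

Lemma bcc_lv (x y z : R) :
  bcc_lattice (x, y, z) <->
  (lv x = PI / 3 /\ lv y = PI / 3 /\ lv z = PI / 3) \/
  (lv x = - (PI / 3) /\ lv y = - (PI / 3) /\ lv z = - (PI / 3)).
Proof.
  rewrite !lv_max, !lv_min, bcc_coords; split.
  - intros (a & b & c & d & -> & -> & ->).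
    destruct (Z.Even_or_Odd d) as [[k ->] | [k ->]]; [left|right];
      (split; [exists (a + k)%Z|split; [exists (b + k)%Z|exists (c + k)%Z]]);
      rewrite ?plus_IZR, ?mult_IZR; ring.
  - intros [([a ->] & [b ->] & [c ->]) | ([a ->] & [b ->] & [c ->])];
      [exists a, b, c, 0%Z|exists a, b, c, 1%Z]; repeat split; ring.
Qed.

Lemma levelset_not_bcc p : levelset p -> ~ bcc_lattice p.
Proof.
  destruct p as [[x y] z]; rewrite bcc_lv; simpl; pose proof PI_RGT_0; lra.
Qed.

(* [tan a + tan b + tan c - tan a tan b tan c = sin (a + b + c) / (cos a cos b cos c)] *)
Lemma calP_sin x y z :
  cos (lv x) * cos (lv y) * cos (lv z) * (sqrt 3 * calP (x, y, z)) = sin (lv x + lv y + lv z).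
Proof.
  assert (Hc : forall t, cos (lv t) <> 0).
  { intros t; apply Rgt_not_eq; pose proof (lv_bound t); pose proof PI_RGT_0.
    apply cos_gt_0; lra. }
  replace (sqrt 3 * calP (x, y, z)) with (tc x + tc y + tc z - tc x * tc y * tc z).
  - rewrite !tc_lv; unfold tan; rewrite !sin_plus, !cos_plus; field; auto.
  - unfold tc; simpl.
    replace (sqrt 3 * calC x * (sqrt 3 * calC y) * (sqrt 3 * calC z))
      with (sqrt 3 * sqrt 3 * sqrt 3 * (calC x * calC y * calC z)) by ring.
    rewrite sqrt3_sqr; ring.
Qed.

Lemma calP_zero p : calP p = 0 <-> levelset p \/ bcc_lattice p.
Proof.
  destruct p as [[x y] z]; pose proof (calP_sin x y z) as H; rewrite bcc_lv.
  pose proof (lv_bound x); pose proof (lv_bound y); pose proof (lv_bound z).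
  pose proof PI_RGT_0; pose proof sqrt3_pos.
  assert (Hs : calP (x, y, z) = 0 <-> sin (lv x + lv y + lv z) = 0).
  { rewrite <- H; split; [intros ->; ring|].
    assert (Hc : forall t, 0 < cos (lv t)).
    { intros t; pose proof (lv_bound t); apply cos_gt_0; lra. }
    intros E; pose proof (Hc x); pose proof (Hc y); pose proof (Hc z).
    repeat (apply Rmult_integral in E; destruct E as [E|E]); lra. }
  rewrite Hs; unfold levelset; split.
  - intros E; apply sin_eq_0_0 in E; destruct E as [k Hk].
    assert (-2 < k < 2)%Z.
    { split; apply lt_IZR; nra. }
    assert (k = -1 \/ k = 0 \/ k = 1)%Z as [-> | [-> | ->]] by lia;
      [right; right; lra | left; lra | right; left; lra].
  - intros [-> | [(-> & -> & ->) | (-> & -> & ->)]].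
    + apply sin_0.
    + replace (PI / 3 + PI / 3 + PI / 3) with PI by field; apply sin_PI.
    + replace (- (PI / 3) + - (PI / 3) + - (PI / 3)) with (- PI) by field.
      rewrite sin_neg, sin_PI; ring.
Qed.

Lemma ball_E3 (x y z x' y' z' : R) (e : R) :
  ball (x, y, z) e (x', y', z') <->
  Rabs (x' - x) < e /\ Rabs (y' - y) < e /\ Rabs (z' - z) < e.
Proof.
  unfold ball; simpl; unfold prod_ball; simpl; unfold ball; simpl; unfold prod_ball; simpl.
  unfold ball; simpl; unfold AbsRing_ball, abs, minus, plus, opp; simpl; tauto.
Qed.

Lemma bcc_discrete : discrete_set bcc_lattice.
Proof.
  intros p Hp; exists (mkposreal (1 / 2) ltac:(lra)); intros q Hq Hb; simpl in Hb.
  apply bcc_parity in Hp; destruct Hp as (n1 & n2 & n3 & -> & _).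
  apply bcc_parity in Hq; destruct Hq as (m1 & m2 & m3 & -> & _).
  apply ball_E3 in Hb; destruct Hb as (H1 & H2 & H3).
  assert (H : forall n m : Z, Rabs (IZR m - IZR n) < 1 / 2 -> m = n).
  { intros n m Hnm; rewrite <- minus_IZR in Hnm; apply Rabs_def2 in Hnm.
    assert (-1 < m - n)%Z by (apply lt_IZR; lra).
    assert (m - n < 1)%Z by (apply lt_IZR; lra). lia. }
  now rewrite (H n1 m1), (H n2 m2), (H n3 m3).
Qed.

Lemma lv_near t : exists e : posreal, forall s, Rabs (s - t) < e -> Rabs (lv s - lv t) < PI / 3.
Proof.
  pose proof PI_RGT_0.
  pose proof (proj1 (filterlim_locally _ _) (continuous_is_derive _ _ _ (is_derive_lv t))
                (mkposreal (PI / 3) ltac:(lra))) as [e He].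
  exists e; intros s Hs; exact (He s Hs).
Qed.

(** At a lattice point the three values of [lv] add up to PI or -PI. In a small ball each of them
    changes by less than PI / 3, so the sum cannot reach 0. *)
Lemma bcc_not_closure p : bcc_lattice p -> ~ closure levelset p.
Proof.
  destruct p as [[x y] z]; rewrite bcc_lv; intros Hp Hcl.
  destruct (lv_near x) as [e1 H1], (lv_near y) as [e2 H2], (lv_near z) as [e3 H3].
  assert (He : 0 < Rmin e1 (Rmin e2 e3)).
  { repeat apply Rmin_glb_lt; apply cond_pos. }
  destruct (Hcl (mkposreal _ He)) as [[[x' y'] z'] [Hq Hb]].
  apply ball_E3 in Hb; simpl in Hb, Hq.
  pose proof (Rmin_l e1 (Rmin e2 e3)); pose proof (Rmin_r e1 (Rmin e2 e3)).
  pose proof (Rmin_l e2 e3); pose proof (Rmin_r e2 e3).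
  specialize (H1 x' ltac:(lra)); specialize (H2 y' ltac:(lra)); specialize (H3 z' ltac:(lra)).
  apply Rabs_def2 in H1, H2, H3; lra.
Qed.

(** * Rigidity of the placement *)

Definition dot (p q : E3) : R :=
  let '(a, b, c) := p in let '(x, y, z) := q in a * x + b * y + c * z.
Definition vadd (p q : E3) : E3 :=
  let '(a, b, c) := p in let '(x, y, z) := q in (a + x, b + y, c + z).
Definition vsub (p q : E3) : E3 :=
  let '(a, b, c) := p in let '(x, y, z) := q in (a - x, b - y, c - z).
Definition smul (l : R) (p : E3) : E3 := let '(a, b, c) := p in (l * a, l * b, l * c).
(** The linear map with columns [u1], [u2], [u3]; [tr] below is its transpose. *)
Definition lin (u1 u2 u3 p : E3) : E3 :=
  let '(x, y, z) := p in vadd (vadd (smul x u1) (smul y u2)) (smul z u3).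
Definition tr (u1 u2 u3 p : E3) : E3 := (dot u1 p, dot u2 p, dot u3 p).
Definition orthonormal (u1 u2 u3 : E3) : Prop :=
  dot u1 u1 = 1 /\ dot u2 u2 = 1 /\ dot u3 u3 = 1 /\
  dot u1 u2 = 0 /\ dot u1 u3 = 0 /\ dot u2 u3 = 0.

Ltac vec := repeat match goal with p : E3 |- _ => destruct p as [[? ?] ?] end.
Ltac veq := apply f_equal2; [apply f_equal2|]; try ring.

Lemma plus_vadd (p q : E3) : plus p q = vadd p q.
Proof. vec; reflexivity. Qed.

Lemma minus_vsub (p q : E3) : minus p q = vsub p q.
Proof. vec; reflexivity. Qed.

Lemma scal_smul (l : R) (p : E3) : scal l p = smul l p.
Proof. vec; reflexivity. Qed.

Lemma norm_E3 (x y z : R) : norm (x, y, z) = sqrt (x ^ 2 + y ^ 2 + z ^ 2).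
Proof.
  unfold norm at 1; simpl; unfold prod_norm, norm; simpl; unfold abs; simpl.
  unfold prod_norm, norm; simpl; unfold abs; simpl.
  rewrite !Rmult_1_r, sqrt_sqrt.
  - assert (Ha : forall t : R, Rabs t * Rabs t = t * t).
    { intros t; rewrite <- Rabs_mult; apply Rabs_pos_eq, Rle_0_sqr. }
    f_equal; rewrite !Ha; reflexivity.
  - apply Rplus_le_le_0_compat; apply Rle_0_sqr.
Qed.

Lemma norm_dot (p : E3) : norm p = sqrt (dot p p).
Proof. vec; rewrite norm_E3; f_equal; simpl; ring. Qed.

Lemma dot_ge0 p : 0 <= dot p p.
Proof. vec; simpl; nra. Qed.

Lemma dot_eq0 p : dot p p = 0 -> p = (0, 0, 0).
Proof.
  vec; simpl; intros H; assert (r = 0) by nra; assert (r1 = 0) by nra.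
  assert (r0 = 0) by nra; subst; reflexivity.
Qed.

Lemma isometry_dot g : isometry g <-> forall p q,
  dot (vsub (g p) (g q)) (vsub (g p) (g q)) = dot (vsub p q) (vsub p q).
Proof.
  split; intros H p q; specialize (H p q).
  - rewrite !minus_vsub, !norm_dot in H; apply sqrt_inj; auto using dot_ge0.
  - now rewrite !minus_vsub, !norm_dot, H.
Qed.

(** After the image of the origin is subtracted, the map preserves dot products by polarization. The
    squared distance between [h p] and the combination of the images of the basis vectors expands
    into dot products alone, and these give 0. *)
Lemma isometry_affine g : isometry g ->
  exists u1 u2 u3, orthonormal u1 u2 u3 /\ forall p, g p = vadd (g (0, 0, 0)) (lin u1 u2 u3 p).
Proof.
  rewrite isometry_dot; intros Hg.
  set (h := fun p => vsub (g p) (g (0, 0, 0))).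
  assert (Hn : forall p, dot (h p) (h p) = dot p p).
  { intros p; unfold h; rewrite Hg; vec; simpl; ring. }
  assert (Hh : forall p q, dot (h p) (h q) = dot p q).
  { intros p q.
    assert (E : dot (vsub (h p) (h q)) (vsub (h p) (h q)) = dot (vsub p q) (vsub p q)).
    { rewrite <- (Hg p q); unfold h; destruct (g p) as [[? ?] ?], (g q) as [[? ?] ?].
      destruct (g (0, 0, 0)) as [[? ?] ?]; simpl; ring. }
    pose proof (Hn p) as Hp; pose proof (Hn q) as Hq.
    destruct (h p) as [[? ?] ?], (h q) as [[? ?] ?]; vec; simpl in *; nra. }
  exists (h (1, 0, 0)), (h (0, 1, 0)), (h (0, 0, 1)); split.
  { unfold orthonormal; rewrite !Hh; simpl; repeat split; ring. }
  intros p.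
  assert (E : vsub (h p) (lin (h (1, 0, 0)) (h (0, 1, 0)) (h (0, 0, 1)) p) = (0, 0, 0)).
  { apply dot_eq0.
    destruct p as [[x y] z].
    pose proof (Hh (x, y, z) (x, y, z)) as H0.
    pose proof (Hh (x, y, z) (1, 0, 0)) as H1; pose proof (Hh (x, y, z) (0, 1, 0)) as H2.
    pose proof (Hh (x, y, z) (0, 0, 1)) as H3.
    pose proof (Hh (1, 0, 0) (1, 0, 0)) as H11; pose proof (Hh (1, 0, 0) (0, 1, 0)) as H12.
    pose proof (Hh (1, 0, 0) (0, 0, 1)) as H13; pose proof (Hh (0, 1, 0) (0, 1, 0)) as H22.
    pose proof (Hh (0, 1, 0) (0, 0, 1)) as H23; pose proof (Hh (0, 0, 1) (0, 0, 1)) as H33.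
    destruct (h (x, y, z)) as [[p1 p2] p3], (h (1, 0, 0)) as [[a1 a2] a3].
    destruct (h (0, 1, 0)) as [[b1 b2] b3], (h (0, 0, 1)) as [[c1 c2] c3].
    simpl in *.
    match goal with |- ?l = 0 => replace l with
      ((p1 * p1 + p2 * p2 + p3 * p3) - 2 * x * (p1 * a1 + p2 * a2 + p3 * a3)
       - 2 * y * (p1 * b1 + p2 * b2 + p3 * b3) - 2 * z * (p1 * c1 + p2 * c2 + p3 * c3)
       + x * x * (a1 * a1 + a2 * a2 + a3 * a3) + y * y * (b1 * b1 + b2 * b2 + b3 * b3)
       + z * z * (c1 * c1 + c2 * c2 + c3 * c3) + 2 * x * y * (a1 * b1 + a2 * b2 + a3 * b3)
       + 2 * x * z * (a1 * c1 + a2 * c2 + a3 * c3) + 2 * y * z * (b1 * c1 + b2 * c2 + b3 * c3))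
      by ring end.
    rewrite H0, H1, H2, H3, H11, H12, H13, H22, H23, H33; ring. }
  revert E; unfold h at 1; generalize (lin (h (1, 0, 0)) (h (0, 1, 0)) (h (0, 0, 1)) p).
  generalize (g p); generalize (g (0, 0, 0)); intros; vec; simpl in *.
  injection E as E1 E2 E3; veq; lra.
Qed.

Lemma dot_lin u1 u2 u3 p q : orthonormal u1 u2 u3 ->
  dot (lin u1 u2 u3 p) (lin u1 u2 u3 q) = dot p q.
Proof.
  intros (H11 & H22 & H33 & H12 & H13 & H23).
  destruct p as [[x y] z], q as [[x' y'] z'].
  replace (dot (lin u1 u2 u3 (x, y, z)) (lin u1 u2 u3 (x', y', z'))) with
    (x * x' * dot u1 u1 + y * y' * dot u2 u2 + z * z' * dot u3 u3
     + (x * y' + y * x') * dot u1 u2 + (x * z' + z * x') * dot u1 u3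
     + (y * z' + z * y') * dot u2 u3) by (vec; simpl; ring).
  rewrite H11, H22, H33, H12, H13, H23; simpl; ring.
Qed.

Lemma tr_lin u1 u2 u3 p : orthonormal u1 u2 u3 -> tr u1 u2 u3 (lin u1 u2 u3 p) = p.
Proof.
  intros (H11 & H22 & H33 & H12 & H13 & H23); destruct p as [[x y] z]; unfold tr.
  replace (dot u1 (lin u1 u2 u3 (x, y, z))) with (x * dot u1 u1 + y * dot u1 u2 + z * dot u1 u3)
    by (vec; simpl; ring).
  replace (dot u2 (lin u1 u2 u3 (x, y, z))) with (x * dot u1 u2 + y * dot u2 u2 + z * dot u2 u3)
    by (vec; simpl; ring).
  replace (dot u3 (lin u1 u2 u3 (x, y, z))) with (x * dot u1 u3 + y * dot u2 u3 + z * dot u3 u3)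
    by (vec; simpl; ring).
  rewrite H11, H22, H33, H12, H13, H23; veq.
Qed.

(** The determinant [d] has d^2 equal to the Gram determinant, which is 1, so Cramer's rule
    applies. *)
Lemma orthonormal_complete u1 u2 u3 p : orthonormal u1 u2 u3 ->
  dot u1 p = 0 -> dot u2 p = 0 -> dot u3 p = 0 -> p = (0, 0, 0).
Proof.
  intros (H11 & H22 & H33 & H12 & H13 & H23) H1 H2 H3.
  destruct u1 as [[a1 a2] a3], u2 as [[b1 b2] b3], u3 as [[c1 c2] c3], p as [[x y] z].
  simpl in *.
  set (d := a1 * (b2 * c3 - b3 * c2) - a2 * (b1 * c3 - b3 * c1) + a3 * (b1 * c2 - b2 * c1)).
  assert (Hd : d * d = 1).
  { replace (d * d) with
      ((a1 * a1 + a2 * a2 + a3 * a3) * ((b1 * b1 + b2 * b2 + b3 * b3) * (c1 * c1 + c2 * c2 + c3 * c3)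
        - (b1 * c1 + b2 * c2 + b3 * c3) * (b1 * c1 + b2 * c2 + b3 * c3))
       - (a1 * b1 + a2 * b2 + a3 * b3) * ((a1 * b1 + a2 * b2 + a3 * b3) * (c1 * c1 + c2 * c2 + c3 * c3)
        - (b1 * c1 + b2 * c2 + b3 * c3) * (a1 * c1 + a2 * c2 + a3 * c3))
       + (a1 * c1 + a2 * c2 + a3 * c3) * ((a1 * b1 + a2 * b2 + a3 * b3) * (b1 * c1 + b2 * c2 + b3 * c3)
        - (b1 * b1 + b2 * b2 + b3 * b3) * (a1 * c1 + a2 * c2 + a3 * c3))) by (unfold d; ring).
    rewrite H11, H22, H33, H12, H13, H23; ring. }
  assert (Hx : d * x = (a1 * x + a2 * y + a3 * z) * (b2 * c3 - b3 * c2)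
    + (b1 * x + b2 * y + b3 * z) * (c2 * a3 - c3 * a2)
    + (c1 * x + c2 * y + c3 * z) * (a2 * b3 - a3 * b2)) by (unfold d; ring).
  assert (Hy : d * y = (a1 * x + a2 * y + a3 * z) * (b3 * c1 - b1 * c3)
    + (b1 * x + b2 * y + b3 * z) * (c3 * a1 - c1 * a3)
    + (c1 * x + c2 * y + c3 * z) * (a3 * b1 - a1 * b3)) by (unfold d; ring).
  assert (Hz : d * z = (a1 * x + a2 * y + a3 * z) * (b1 * c2 - b2 * c1)
    + (b1 * x + b2 * y + b3 * z) * (c1 * a2 - c2 * a1)
    + (c1 * x + c2 * y + c3 * z) * (a1 * b2 - a2 * b1)) by (unfold d; ring).
  rewrite H1, H2, H3 in Hx, Hy, Hz.
  assert (forall t, d * t = 0 * 0 -> t = 0).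
  { intros t Ht; replace t with (d * d * t) by (rewrite Hd; ring).
    rewrite Rmult_assoc, Ht; ring. }
  repeat f_equal; apply H; lra.
Qed.

Lemma dot_vsub u p q : dot u (vsub p q) = dot u p - dot u q.
Proof. vec; simpl; ring. Qed.

Lemma lin_tr u1 u2 u3 p : orthonormal u1 u2 u3 -> lin u1 u2 u3 (tr u1 u2 u3 p) = p.
Proof.
  intros Hu; pose proof (tr_lin u1 u2 u3 (tr u1 u2 u3 p) Hu) as E.
  set (q := lin u1 u2 u3 (tr u1 u2 u3 p)) in *.
  assert (H : vsub q p = (0, 0, 0)).
  { injection E as E1 E2 E3.
    apply (orthonormal_complete u1 u2 u3); [exact Hu| | |]; rewrite dot_vsub; lra. }
  clearbody q; vec; simpl in H; injection H as ? ? ?; repeat f_equal; lra.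
Qed.

Lemma dot_tr u1 u2 u3 p q : orthonormal u1 u2 u3 ->
  dot (tr u1 u2 u3 p) (tr u1 u2 u3 q) = dot p q.
Proof.
  intros Hu; rewrite <- (dot_lin u1 u2 u3) by exact Hu; now rewrite !lin_tr.
Qed.

Lemma lin_vadd u1 u2 u3 p q : lin u1 u2 u3 (vadd p q) = vadd (lin u1 u2 u3 p) (lin u1 u2 u3 q).
Proof. vec; simpl; veq. Qed.

Lemma isometry_vadd (v : E3) : isometry (fun p => plus p v).
Proof.
  apply isometry_dot; intros p q; rewrite (plus_vadd p v), (plus_vadd q v).
  vec; simpl; ring.
Qed.

Lemma translation_lattice_iff (S : E3 -> Prop) (v : E3) :
  translation_lattice S v <-> forall p, S (vadd p v) <-> S p.
Proof.
  split.
  - intros [_ H] p; rewrite <- plus_vadd; apply H.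
  - intros H; split; [apply isometry_vadd|intros p; rewrite plus_vadd; apply H].
Qed.

(** * Translations of the level set and short lattice vectors *)

Lemma lv_quarter : 0 < lv (1 / 4) < PI / 3.
Proof. rewrite <- lv_half, <- lv_0; split; apply lv_decr; lra. Qed.

Lemma lv_34 : lv (3 / 4) = - lv (1 / 4).
Proof. rewrite <- lv_1_minus; f_equal; field. Qed.

Lemma lv_plus_IZR (k : Z) t :
  lv (t + IZR k) = if Z.even k then lv t else - lv t.
Proof.
  destruct (Z.Even_or_Odd k) as [[m ->] | [m ->]].
  - rewrite Z.even_mul, mult_IZR; simpl; apply lv_period.
  - rewrite Z.even_add, Z.even_mul, plus_IZR, mult_IZR; simpl.
    replace (t + (2 * IZR m + 1)) with (t + 1 + 2 * IZR m) by ring.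
    now rewrite lv_period, lv_plus1.
Qed.

(** The zeros of [lv] are the half-odd numbers, so the first condition makes 2 v an integer. If it
    were odd, [lv] would change sign under the translation, against the second condition. *)
Lemma integer_of_lv v : lv (1 / 2 + 2 * v) = 0 -> lv (1 / 4 + 2 * v) = lv (1 / 4) ->
  exists m : Z, v = IZR m.
Proof.
  intros H1 H2; destruct (lv_zero _ H1) as [k Hk].
  assert (Hv : 2 * v = IZR k) by lra.
  rewrite Hv, lv_plus_IZR in H2; pose proof lv_quarter.
  destruct (Z.Even_or_Odd k) as [[m ->] | [m ->]].
  - exists m; rewrite mult_IZR in Hv; lra.
  - rewrite Z.even_add, Z.even_mul in H2; simpl in H2; lra.
Qed.

Lemma levelset_translation v :
  (forall p, levelset (vadd p v) <-> levelset p) <-> bcc_lattice v.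
Proof.
  destruct v as [[v1 v2] v3]; pose proof lv_quarter as Hq; pose proof lv_34 as H34.
  pose proof lv_half as Hh; pose proof lv_0 as H0; pose proof lv_1 as H1.
  split.
  - intros H.
    (* With [s] the reflection in [x = 0], [v - s v = (2 v1, 0, 0)] is a translation too. *)
    assert (Hx : forall x y z, lv x + lv y + lv z = 0 -> lv (x + 2 * v1) + lv y + lv z = 0).
    { intros x y z E; apply (H (x, y, z)) in E; simpl in E.
      pose proof (proj1 (H (- x - 2 * v1, y, z))) as E'; simpl in E'.
      rewrite <- (lv_opp (x + 2 * v1)); replace (- (x + 2 * v1)) with (- x - 2 * v1) by ring.
      apply E'; rewrite <- E; f_equal; f_equal; rewrite <- (lv_opp (x + v1)); f_equal; ring. }
    assert (Hy : forall x y z, lv x + lv y + lv z = 0 -> lv x + lv (y + 2 * v2) + lv z = 0).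
    { intros x y z E; apply (H (x, y, z)) in E; simpl in E.
      pose proof (proj1 (H (x, - y - 2 * v2, z))) as E'; simpl in E'.
      rewrite <- (lv_opp (y + 2 * v2)); replace (- (y + 2 * v2)) with (- y - 2 * v2) by ring.
      apply E'; rewrite <- E; f_equal; f_equal; rewrite <- (lv_opp (y + v2)); f_equal; ring. }
    assert (Hz : forall x y z, lv x + lv y + lv z = 0 -> lv x + lv y + lv (z + 2 * v3) = 0).
    { intros x y z E; apply (H (x, y, z)) in E; simpl in E.
      pose proof (proj1 (H (x, y, - z - 2 * v3))) as E'; simpl in E'.
      rewrite <- (lv_opp (z + 2 * v3)); replace (- (z + 2 * v3)) with (- z - 2 * v3) by ring.
      apply E'; rewrite <- E; f_equal; rewrite <- (lv_opp (z + v3)); f_equal; ring. }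
    (* In the first test point the values of [lv] at the two other coordinates cancel; in the second
       they add up to [- lv (1 / 4)]. *)
    destruct (integer_of_lv v1) as [n1 ->].
    { specialize (Hx (1 / 2) 0 1); lra. }
    { specialize (Hx (1 / 4) (3 / 4) (1 / 2)); lra. }
    destruct (integer_of_lv v2) as [n2 ->].
    { specialize (Hy 0 (1 / 2) 1); lra. }
    { specialize (Hy (3 / 4) (1 / 4) (1 / 2)); lra. }
    destruct (integer_of_lv v3) as [n3 ->].
    { specialize (Hz 0 1 (1 / 2)); lra. }
    { specialize (Hz (3 / 4) (1 / 2) (1 / 4)); lra. }
    apply bcc_parity; exists n1, n2, n3; split; [reflexivity|].
    (* A coordinate 1/2 contributes 0 before and after an integer translation, and the two others
       contribute opposite values, which still cancel only if both or neither change sign. *)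
    pose proof (proj2 (H (1 / 4, 3 / 4, 1 / 2))) as E12.
    pose proof (proj2 (H (1 / 2, 1 / 4, 3 / 4))) as E23.
    simpl in E12, E23; rewrite !lv_plus_IZR in E12, E23.
    rewrite !Zmod_even.
    destruct (Z.even n1), (Z.even n2), (Z.even n3); split; try reflexivity; exfalso; lra.
  - intros Hv [[x y] z]; apply bcc_parity in Hv; destruct Hv as (n1 & n2 & n3 & E & H12 & H23).
    injection E as -> -> ->; simpl; rewrite !lv_plus_IZR.
    rewrite !Zmod_even in H12, H23.
    destruct (Z.even n1), (Z.even n2), (Z.even n3); try discriminate; lra.
Qed.

(** The shortest nonzero length fixes the scale of a similarity that preserves the lattice. *)
Lemma bcc_norm v : bcc_lattice v -> v = (0, 0, 0) \/ 3 <= dot v v.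
Proof.
  intros Hv; apply bcc_parity in Hv; destruct Hv as (n1 & n2 & n3 & -> & H12 & H23); simpl.
  rewrite <- !mult_IZR, <- !plus_IZR.
  destruct (Z.eq_dec n1 0) as [-> |N1].
  - destruct (Z.eq_dec n2 0) as [-> |N2].
    + destruct (Z.eq_dec n3 0) as [-> |N3]; [left; reflexivity|right].
      apply IZR_le; assert (n3 <= -2 \/ 2 <= n3)%Z by (Z.div_mod_to_equations; lia); nia.
    + right; apply IZR_le; assert (n2 <= -2 \/ 2 <= n2)%Z by (Z.div_mod_to_equations; lia); nia.
  - right; apply IZR_le; destruct (Z.eq_dec n1 1) as [-> |]; [|destruct (Z.eq_dec n1 (-1)) as [-> |]].
    1, 2: assert (n2 <= -1 \/ 1 <= n2)%Z by (Z.div_mod_to_equations; lia);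
      assert (n3 <= -1 \/ 1 <= n3)%Z by (Z.div_mod_to_equations; lia); nia.
    assert (n1 <= -2 \/ 2 <= n1)%Z by (Z.div_mod_to_equations; lia); nia.
Qed.

(** Lattice vectors of squared length 4 have no odd entries, since three odd squares add up to 3 or
    at least 11; so they are twice the octahedron vertices. An isometry preserving the lattice
    permutes them and is therefore a signed permutation. *)
Lemma bcc_norm4 v : bcc_lattice (smul 2 v) -> dot v v = 1 -> octahedron_vertex v.
Proof.
  destruct v as [[x y] z]; intros Hv Hn; apply bcc_parity in Hv.
  destruct Hv as (n1 & n2 & n3 & E & H12 & H23); simpl in E; injection E as E1 E2 E3.
  simpl in Hn.
  assert (Hs : (n1 * n1 + n2 * n2 + n3 * n3 = 4)%Z).
  { apply eq_IZR; rewrite !plus_IZR, !mult_IZR, <- E1, <- E2, <- E3; lra. }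
  assert (-2 <= n1 <= 2 /\ -2 <= n2 <= 2 /\ -2 <= n3 <= 2)%Z as (B1 & B2 & B3) by nia.
  assert (C1 : (n1 = -2 \/ n1 = -1 \/ n1 = 0 \/ n1 = 1 \/ n1 = 2)%Z) by lia.
  assert (C2 : (n2 = -2 \/ n2 = -1 \/ n2 = 0 \/ n2 = 1 \/ n2 = 2)%Z) by lia.
  assert (C3 : (n3 = -2 \/ n3 = -1 \/ n3 = 0 \/ n3 = 1 \/ n3 = 2)%Z) by lia.
  clear B1 B2 B3.
  assert (G : forall a b c : R, x = a -> y = b -> z = c -> (x, y, z) = (a, b, c))
    by (intros; subst; reflexivity).
  unfold octahedron_vertex.
  destruct C1 as [-> |[-> |[-> |[-> | -> ]]]], C2 as [-> |[-> |[-> |[-> | -> ]]]];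
    try (exfalso; lia);
    destruct C3 as [-> |[-> |[-> |[-> | -> ]]]]; try (exfalso; lia);
    try (exfalso; Z.div_mod_to_equations; lia).
  all: first [ left; apply G; lra | right; left; apply G; lra
    | right; right; left; apply G; lra | right; right; right; left; apply G; lra
    | right; right; right; right; left; apply G; lra
    | right; right; right; right; right; apply G; lra ].
Qed.

Lemma levelset_signed_perm u1 u2 u3 p :
  orthonormal u1 u2 u3 ->
  octahedron_vertex u1 -> octahedron_vertex u2 -> octahedron_vertex u3 ->
  levelset (lin u1 u2 u3 p) <-> levelset p.
Proof.
  intros (_ & _ & _ & H12 & H13 & H23) O1 O2 O3.
  destruct p as [[x y] z].
  assert (G : forall s a b c, (s = a \/ s = - a) -> b = 0 -> c = 0 -> lv (s + b + c) = lv a).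
  { intros s a b c [-> | ->] -> ->; rewrite !Rplus_0_r; [reflexivity|apply lv_opp]. }
  assert (G2 : forall s a b c, (s = a \/ s = - a) -> b = 0 -> c = 0 -> lv (b + s + c) = lv a).
  { intros s a b c H -> ->; rewrite Rplus_0_l, <- (Rplus_0_r (s + 0)); now apply G. }
  assert (G3 : forall s a b c, (s = a \/ s = - a) -> b = 0 -> c = 0 -> lv (b + c + s) = lv a).
  { intros s a b c H -> ->; rewrite Rplus_0_r; apply (G2 s a 0 0) in H; auto.
    now rewrite Rplus_0_r in H. }
  destruct O1 as [-> |[-> |[-> |[-> |[-> | -> ]]]]],
    O2 as [-> |[-> |[-> |[-> |[-> | -> ]]]]]; simpl in H12; try (exfalso; lra);
    destruct O3 as [-> |[-> |[-> |[-> |[-> | -> ]]]]]; simpl in H13, H23;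
    try (exfalso; lra); clear H12 H13 H23; simpl.
  all: repeat match goal with
    | |- context [lv (?b + ?c + ?s)] => first
      [ rewrite (G b x c s) by lra | rewrite (G b y c s) by lra | rewrite (G b z c s) by lra
      | rewrite (G2 c x b s) by lra | rewrite (G2 c y b s) by lra | rewrite (G2 c z b s) by lra
      | rewrite (G3 s x b c) by lra | rewrite (G3 s y b c) by lra | rewrite (G3 s z b c) by lra ]
    end; lra.
Qed.

(** * The octahedral group and its centers *)

Lemma isometry_origin g : isometry g -> g (0, 0, 0) = (0, 0, 0) ->
  exists u1 u2 u3, orthonormal u1 u2 u3 /\ forall p, g p = lin u1 u2 u3 p.
Proof.
  intros Hg H0; destruct (isometry_affine g Hg) as (u1 & u2 & u3 & Hu & H).
  exists u1, u2, u3; split; [exact Hu|]; intros p; rewrite H, H0.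
  destruct (lin u1 u2 u3 p) as [[? ?] ?]; simpl; veq.
Qed.

Lemma sqr_01 a b : (a = 0 \/ a = 1 \/ a = -1) -> b * b = a -> b = 0 \/ b = 1 \/ b = -1.
Proof.
  intros [-> | [-> | ->]] H; [left; nra| |nra].
  assert ((b - 1) * (b + 1) = 0) as E by lra.
  apply Rmult_integral in E; destruct E; [right; left|right; right]; lra.
Qed.

Lemma unit_01_vertex u : dot u u = 1 ->
  let '(x, y, z) := u in
  (x = 0 \/ x = 1 \/ x = -1) -> (y = 0 \/ y = 1 \/ y = -1) -> (z = 0 \/ z = 1 \/ z = -1) ->
  octahedron_vertex u.
Proof.
  destruct u as [[x y] z]; simpl; unfold octahedron_vertex.
  intros H [-> | [-> | ->]] [-> | [-> | ->]] [-> | [-> | ->]]; try (exfalso; lra); tauto.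
Qed.

Lemma vertex_coords x y z : octahedron_vertex (x, y, z) ->
  (x = 0 \/ x = 1 \/ x = -1) /\ (y = 0 \/ y = 1 \/ y = -1) /\ (z = 0 \/ z = 1 \/ z = -1).
Proof.
  unfold octahedron_vertex; intros [E | [E | [E | [E | [E | E]]]]]; injection E; intros; subst;
    repeat split; auto.
Qed.

Lemma octahedral_lin s1 s2 s3 :
  orthonormal s1 s2 s3 ->
  octahedron_vertex s1 -> octahedron_vertex s2 -> octahedron_vertex s3 ->
  octahedral (lin s1 s2 s3).
Proof.
  intros Hs O1 O2 O3; split.
  - apply isometry_dot; intros p q.
    assert (E : vsub (lin s1 s2 s3 p) (lin s1 s2 s3 q) = lin s1 s2 s3 (vsub p q)).
    { clear; vec; simpl; veq. }
    now rewrite E, dot_lin.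
  - intros v.
    assert (F : forall p, octahedron_vertex p -> octahedron_vertex (lin s1 s2 s3 p)).
    { clear v; intros p Hp.
      assert (N : forall s, octahedron_vertex s -> octahedron_vertex (smul (-1) s)).
      { clear; intros s; unfold octahedron_vertex.
        assert (G : forall a b c a' b' c' : R, a = a' -> b = b' -> c = c' -> (a, b, c) = (a', b', c'))
          by (intros; subst; reflexivity).
        intros [-> |[-> |[-> |[-> |[-> | -> ]]]]]; simpl;
          [right; left | left | do 3 right; left | do 2 right; left | do 5 right | do 4 right; left];
          apply G; ring. }
      destruct Hp as [-> |[-> |[-> |[-> |[-> | -> ]]]]]; [ | | | | | ].
      all: match goal with
        | |- octahedron_vertex (lin ?a _ _ (1, 0, 0)) => replace (lin _ _ _ _) with a
        | |- octahedron_vertex (lin ?a _ _ (-1, 0, 0)) => replace (lin _ _ _ _) with (smul (-1) a)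
        | |- octahedron_vertex (lin _ ?a _ (0, 1, 0)) => replace (lin _ _ _ _) with a
        | |- octahedron_vertex (lin _ ?a _ (0, -1, 0)) => replace (lin _ _ _ _) with (smul (-1) a)
        | |- octahedron_vertex (lin _ _ ?a (0, 0, 1)) => replace (lin _ _ _ _) with a
        | |- octahedron_vertex (lin _ _ ?a (0, 0, -1)) => replace (lin _ _ _ _) with (smul (-1) a)
        end; auto; clear; vec; simpl; veq. }
    split; [|apply F]; intros Hv.
    (* The coordinates of [v] are the dot products of the vertex [q] with [s1], [s2], [s3], each of
       them 0, 1 or -1. *)
    rewrite <- (tr_lin s1 s2 s3 v Hs).
    set (q := lin s1 s2 s3 v) in *.
    apply (unit_01_vertex (tr s1 s2 s3 q)).
    + rewrite dot_tr by exact Hs; clear -Hv.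
      destruct Hv as [-> |[-> |[-> |[-> |[-> | -> ]]]]]; simpl; ring.
    + clear - O1 Hv; destruct O1 as [-> |[-> |[-> |[-> |[-> | -> ]]]]];
        destruct Hv as [-> |[-> |[-> |[-> |[-> | -> ]]]]]; simpl; lra.
    + clear - O2 Hv; destruct O2 as [-> |[-> |[-> |[-> |[-> | -> ]]]]];
        destruct Hv as [-> |[-> |[-> |[-> |[-> | -> ]]]]]; simpl; lra.
    + clear - O3 Hv; destruct O3 as [-> |[-> |[-> |[-> |[-> | -> ]]]]];
        destruct Hv as [-> |[-> |[-> |[-> |[-> | -> ]]]]]; simpl; lra.
Qed.

Lemma vadd_vsub p c : vsub (vadd p c) c = p.
Proof. vec; simpl; veq. Qed.

(* [S] is the level set moved by [c]; [w] orients the octahedron at the origin. *)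
Lemma octahedral_conjugate (S : E3 -> Prop) c w1 w2 w3 :
  (forall p, S p <-> levelset (vsub p c)) ->
  (forall v, translation_lattice S v <-> bcc_lattice v) ->
  orthonormal w1 w2 w3 ->
  (forall s, octahedral s ->
     exists h, symmetry S h /\ forall p, h (lin w1 w2 w3 p) = lin w1 w2 w3 (s p)) ->
  forall s1 s2 s3, orthonormal s1 s2 s3 ->
  octahedron_vertex s1 -> octahedron_vertex s2 -> octahedron_vertex s3 ->
  let h p := lin w1 w2 w3 (lin s1 s2 s3 (tr w1 w2 w3 p)) in
  octahedron_vertex (h (1, 0, 0)) /\ octahedron_vertex (h (0, 1, 0)) /\
  octahedron_vertex (h (0, 0, 1)) /\ bcc_lattice (vsub (h c) c).
Proof.
  intros HS HL Hw Hsym s1 s2 s3 Hs O1 O2 O3 h.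
  destruct (Hsym _ (octahedral_lin _ _ _ Hs O1 O2 O3)) as [h' [[_ Hh] Hh']].
  assert (E : forall p, h' p = h p).
  { intros p; unfold h; rewrite <- Hh', lin_tr; auto. }
  assert (HSh : forall p, S (h p) <-> S p) by (intros p; rewrite <- E; apply Hh).
  assert (Hadd : forall p q, h (vadd p q) = vadd (h p) (h q)).
  { intros p q; unfold h; rewrite <- !lin_vadd; f_equal; f_equal; clear; vec; unfold tr; simpl; veq. }
  assert (Hdot : forall p q, dot (h p) (h q) = dot p q).
  { intros p q; unfold h; now rewrite !dot_lin, dot_tr. }
  assert (Hsurj : forall q, exists p, q = h p).
  { intros q; exists (lin w1 w2 w3 (tr s1 s2 s3 (tr w1 w2 w3 q))); unfold h.
    now rewrite tr_lin, lin_tr, lin_tr. }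
  (* Conjugating the translation by [v] with the linear symmetry [h] gives the translation by
     [h v]. *)
  assert (Hb : forall v, bcc_lattice v -> bcc_lattice (h v)).
  { intros v Hv; apply HL, translation_lattice_iff; intros q; destruct (Hsurj q) as [p ->].
    rewrite <- Hadd, !HSh; apply (proj1 (translation_lattice_iff S v)), HL, Hv. }
  assert (Hv : forall v, bcc_lattice (smul 2 v) -> dot v v = 1 -> octahedron_vertex (h v)).
  { intros v H2 H1; apply bcc_norm4; [|rewrite Hdot; exact H1].
    replace (smul 2 (h v)) with (h (smul 2 v)); [auto|].
    unfold h; clear; vec; unfold tr; simpl; veq. }
  assert (V1 : octahedron_vertex (h (1, 0, 0))).
  { apply Hv; simpl; [|ring]; apply bcc_coords; exists 1%Z, 0%Z, 0%Z, 0%Z; repeat split; ring. }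
  assert (V2 : octahedron_vertex (h (0, 1, 0))).
  { apply Hv; simpl; [|ring]; apply bcc_coords; exists 0%Z, 1%Z, 0%Z, 0%Z; repeat split; ring. }
  assert (V3 : octahedron_vertex (h (0, 0, 1))).
  { apply Hv; simpl; [|ring]; apply bcc_coords; exists 0%Z, 0%Z, 1%Z, 0%Z; repeat split; ring. }
  repeat split; auto.
  assert (Hlin : forall p, h p = lin (h (1, 0, 0)) (h (0, 1, 0)) (h (0, 0, 1)) p).
  { intros p; unfold h; clear; vec; unfold tr; simpl; veq. }
  assert (Hlev : forall p, levelset (h p) <-> levelset p).
  { intros p; rewrite Hlin; apply levelset_signed_perm; auto.
    unfold orthonormal; rewrite !Hdot; simpl; repeat split; ring. }
  (* [h] preserves both the level set and its copy moved by [c], so moving by [h c] has the same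
     effect as moving by [c]. *)
  apply levelset_translation; intros q; destruct (Hsurj q) as [p ->].
  rewrite Hlev.
  replace (vadd (h p) (vsub (h c) c)) with (vsub (h (vadd p c)) c).
  - now rewrite <- HS, HSh, HS, vadd_vsub.
  - rewrite Hadd; destruct (h p) as [[? ?] ?], (h c) as [[? ?] ?]; clear; vec; simpl; veq.
Qed.

Lemma bcc_signed_perm u1 u2 u3 v :
  orthonormal u1 u2 u3 ->
  octahedron_vertex u1 -> octahedron_vertex u2 -> octahedron_vertex u3 ->
  bcc_lattice v -> bcc_lattice (lin u1 u2 u3 v).
Proof.
  intros Hu O1 O2 O3 Hv; apply levelset_translation; intros q.
  rewrite <- (lin_tr u1 u2 u3 q Hu), <- lin_vadd.
  rewrite !levelset_signed_perm by auto; now apply levelset_translation.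
Qed.

(** The reflection in the plane orthogonal to the axis [w] moves [c] by this vector, and a lattice
    vector along a coordinate axis has even entries. *)
Lemma bcc_reflection w c : octahedron_vertex w ->
  bcc_lattice (smul (-2 * dot w c) w) -> exists m : Z, dot w c = IZR m.
Proof.
  destruct c as [[x y] z].
  intros [-> |[-> |[-> |[-> |[-> | -> ]]]]] H; simpl in H; apply bcc_coords in H;
    destruct H as (a & b & d & e & E1 & E2 & E3); simpl;
    [exists (b - a)%Z|exists (a - b)%Z|exists (a - b)%Z|exists (b - a)%Z
    |exists (a - d)%Z|exists (d - a)%Z]; rewrite minus_IZR; lra.
Qed.

(** Exchanging the axes [w] and [w'] moves a point with coordinates [m] and [n] along them by this
    vector. It has a zero entry, so as a lattice vector it has only even ones. *)
Lemma bcc_swap w w' (m n : Z) : octahedron_vertex w -> octahedron_vertex w' -> dot w w' = 0 ->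
  bcc_lattice (smul (IZR n - IZR m) (vsub w w')) -> (m mod 2 = n mod 2)%Z.
Proof.
  intros O O' H0 H.
  enough (exists k : Z, (n = m + 2 * k)%Z) as [k ->] by (Z.div_mod_to_equations; lia).
  destruct O as [-> |[-> |[-> |[-> |[-> | -> ]]]]],
    O' as [-> |[-> |[-> |[-> |[-> | -> ]]]]]; simpl in H0; try (exfalso; lra);
    clear H0; simpl in H; apply bcc_coords in H; destruct H as (a & b & d & e & E1 & E2 & E3).
  all: first [exists (a - b)%Z; apply eq_IZR; rewrite plus_IZR, mult_IZR, minus_IZR; lra
    | exists (b - a)%Z; apply eq_IZR; rewrite plus_IZR, mult_IZR, minus_IZR; lra
    | exists (a - d)%Z; apply eq_IZR; rewrite plus_IZR, mult_IZR, minus_IZR; lra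
    | exists (d - a)%Z; apply eq_IZR; rewrite plus_IZR, mult_IZR, minus_IZR; lra
    | exists (b - d)%Z; apply eq_IZR; rewrite plus_IZR, mult_IZR, minus_IZR; lra
    | exists (d - b)%Z; apply eq_IZR; rewrite plus_IZR, mult_IZR, minus_IZR; lra].
Qed.

(** The orientation of the octahedron is arbitrary at first. Quarter turns preserve the lattice,
    which forces its axes to be coordinate axes; reflections then make the coordinates of [c]
    integers, and exchanges of axes give them equal parity. *)
Lemma octahedral_center_bcc (S : E3 -> Prop) c :
  (forall p, S p <-> levelset (vsub p c)) ->
  (forall v, translation_lattice S v <-> bcc_lattice v) ->
  octahedral_center S (0, 0, 0) -> bcc_lattice c.
Proof.
  intros HS HL (k & Hk & Hk0 & Hsym).
  destruct (isometry_origin k Hk Hk0) as (w1 & w2 & w3 & Hw & Ek).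
  assert (Hc : forall s1 s2 s3, orthonormal s1 s2 s3 ->
    octahedron_vertex s1 -> octahedron_vertex s2 -> octahedron_vertex s3 ->
    let h p := lin w1 w2 w3 (lin s1 s2 s3 (tr w1 w2 w3 p)) in
    octahedron_vertex (h (1, 0, 0)) /\ octahedron_vertex (h (0, 1, 0)) /\
    octahedron_vertex (h (0, 0, 1)) /\ bcc_lattice (vsub (h c) c)).
  { apply (octahedral_conjugate S); auto; intros s Hs; destruct (Hsym s Hs) as (h & H & E).
    exists h; split; [exact H|]; intros p; now rewrite <- !Ek. }
  clear k Hk Hk0 Hsym Ek.
  assert (Hc' : forall s1 s2 s3,
    (octahedron_vertex s1 /\ octahedron_vertex s2 /\ octahedron_vertex s3) ->
    orthonormal s1 s2 s3 ->
    let h p := lin w1 w2 w3 (lin s1 s2 s3 (tr w1 w2 w3 p)) in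
    octahedron_vertex (h (1, 0, 0)) /\ octahedron_vertex (h (0, 1, 0)) /\
    octahedron_vertex (h (0, 0, 1)) /\ bcc_lattice (vsub (h c) c)).
  { intros s1 s2 s3 (? & ? & ?) ?; apply Hc; auto. }
  clear Hc HS HL.
  assert (Hw' := Hw); destruct Hw as (N1 & N2 & N3 & Hw).
  (* A quarter turn about [w] has diagonal entries [w_i ^ 2]. *)
  assert (W1 : octahedron_vertex w1).
  { destruct (Hc' (1, 0, 0) (0, 0, 1) (0, -1, 0)) as (V1 & V2 & V3 & _);
      [unfold octahedron_vertex; tauto|unfold orthonormal; simpl; repeat split; ring|].
    destruct w1 as [[x y] z], w2 as [[x2 y2] z2], w3 as [[x3 y3] z3].
    simpl in V1, V2, V3; apply vertex_coords in V1, V2, V3.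
    destruct V1 as [V1 _], V2 as (_ & V2 & _), V3 as (_ & _ & V3).
    apply (unit_01_vertex (x, y, z)); [exact N1| | |].
    - eapply sqr_01; [exact V1|ring].
    - eapply sqr_01; [exact V2|ring].
    - eapply sqr_01; [exact V3|ring]. }
  assert (W2 : octahedron_vertex w2).
  { destruct (Hc' (0, 0, 1) (0, 1, 0) (-1, 0, 0)) as (V1 & V2 & V3 & _);
      [unfold octahedron_vertex; tauto|unfold orthonormal; simpl; repeat split; ring|].
    destruct w1 as [[x y] z], w2 as [[x2 y2] z2], w3 as [[x3 y3] z3].
    simpl in V1, V2, V3; apply vertex_coords in V1, V2, V3.
    destruct V1 as [V1 _], V2 as (_ & V2 & _), V3 as (_ & _ & V3).
    apply (unit_01_vertex (x2, y2, z2)); [exact N2| | |].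
    - eapply sqr_01; [exact V1|ring].
    - eapply sqr_01; [exact V2|ring].
    - eapply sqr_01; [exact V3|ring]. }
  assert (W3 : octahedron_vertex w3).
  { destruct (Hc' (0, 1, 0) (-1, 0, 0) (0, 0, 1)) as (V1 & V2 & V3 & _);
      [unfold octahedron_vertex; tauto|unfold orthonormal; simpl; repeat split; ring|].
    destruct w1 as [[x y] z], w2 as [[x2 y2] z2], w3 as [[x3 y3] z3].
    simpl in V1, V2, V3; apply vertex_coords in V1, V2, V3.
    destruct V1 as [V1 _], V2 as (_ & V2 & _), V3 as (_ & _ & V3).
    apply (unit_01_vertex (x3, y3, z3)); [exact N3| | |].
    - eapply sqr_01; [exact V1|ring].
    - eapply sqr_01; [exact V2|ring].
    - eapply sqr_01; [exact V3|ring]. }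
  destruct (Hc' (-1, 0, 0) (0, 1, 0) (0, 0, 1)) as (_ & _ & _ & R1);
    [unfold octahedron_vertex; tauto|unfold orthonormal; simpl; repeat split; ring|].
  destruct (Hc' (1, 0, 0) (0, -1, 0) (0, 0, 1)) as (_ & _ & _ & R2);
    [unfold octahedron_vertex; tauto|unfold orthonormal; simpl; repeat split; ring|].
  destruct (Hc' (1, 0, 0) (0, 1, 0) (0, 0, -1)) as (_ & _ & _ & R3);
    [unfold octahedron_vertex; tauto|unfold orthonormal; simpl; repeat split; ring|].
  destruct (Hc' (0, 1, 0) (1, 0, 0) (0, 0, 1)) as (_ & _ & _ & S12);
    [unfold octahedron_vertex; tauto|unfold orthonormal; simpl; repeat split; ring|].
  destruct (Hc' (1, 0, 0) (0, 0, 1) (0, 1, 0)) as (_ & _ & _ & S23);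
    [unfold octahedron_vertex; tauto|unfold orthonormal; simpl; repeat split; ring|].
  clear Hc'; cbv zeta in R1, R2, R3, S12, S23.
  pose proof (lin_tr w1 w2 w3 c Hw') as Ec; unfold tr in Ec.
  assert (Hr : forall t1 t2 t3 : R,
    bcc_lattice (vsub (lin w1 w2 w3 (t1, t2, t3)) c) ->
    bcc_lattice (vadd (vadd (smul (t1 - dot w1 c) w1) (smul (t2 - dot w2 c) w2))
                   (smul (t3 - dot w3 c) w3))).
  { intros t1 t2 t3 H; rewrite <- Ec in H at 1; revert H.
    match goal with |- bcc_lattice ?u -> bcc_lattice ?v => replace v with u; [auto|] end.
    clear; generalize (dot w1 c) (dot w2 c) (dot w3 c); intros; vec; simpl; veq. }
  apply Hr in R1, R2, R3, S12, S23.
  destruct (bcc_reflection w1 c W1) as [m1 M1].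
  { revert R1; match goal with |- bcc_lattice ?u -> bcc_lattice ?v => replace v with u; [auto|] end.
    clear; unfold tr; generalize (dot w1 c) (dot w2 c) (dot w3 c); intros; vec; simpl; veq. }
  destruct (bcc_reflection w2 c W2) as [m2 M2].
  { revert R2; match goal with |- bcc_lattice ?u -> bcc_lattice ?v => replace v with u; [auto|] end.
    clear; unfold tr; generalize (dot w1 c) (dot w2 c) (dot w3 c); intros; vec; simpl; veq. }
  destruct (bcc_reflection w3 c W3) as [m3 M3].
  { revert R3; match goal with |- bcc_lattice ?u -> bcc_lattice ?v => replace v with u; [auto|] end.
    clear; unfold tr; generalize (dot w1 c) (dot w2 c) (dot w3 c); intros; vec; simpl; veq. }
  rewrite <- Ec; apply bcc_signed_perm; auto.
  rewrite M1, M2, M3; apply bcc_parity; exists m1, m2, m3; split; [reflexivity|split].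
  - apply (bcc_swap w1 w2); auto; [apply Hw'|].
    revert S12; rewrite <- M1, <- M2.
    match goal with |- bcc_lattice ?u -> bcc_lattice ?v => replace v with u; [auto|] end.
    clear; unfold tr; generalize (dot w1 c) (dot w2 c) (dot w3 c); intros; vec; simpl; veq.
  - apply (bcc_swap w2 w3); auto; [apply Hw'|].
    revert S23; rewrite <- M2, <- M3.
    match goal with |- bcc_lattice ?u -> bcc_lattice ?v => replace v with u; [auto|] end.
    clear; unfold tr; generalize (dot w1 c) (dot w2 c) (dot w3 c); intros; vec; simpl; veq.
Qed.

(** * Scale, orientation and position of the surface *)

Lemma similar_levelset_eq (S : E3 -> Prop) mu u1 u2 u3 c :
  0 < mu -> orthonormal u1 u2 u3 ->
  (forall p, S p <-> exists r, levelset r /\ p = vadd c (smul mu (lin u1 u2 u3 r))) ->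
  (forall v, translation_lattice S v <-> bcc_lattice v) ->
  octahedral_center S (0, 0, 0) ->
  forall p, S p <-> levelset p.
Proof.
  intros Hmu Hu HS HL Hcen.
  set (M := fun r => smul mu (lin u1 u2 u3 r)).
  assert (HM : forall r, S (vadd c (M r)) <-> levelset r).
  { intros r; rewrite HS; split; [|intros H; exists r; auto].
    intros (r' & H & E).
    enough (r = r') by now subst.
    rewrite <- (tr_lin u1 u2 u3 r Hu), <- (tr_lin u1 u2 u3 r' Hu); f_equal.
    revert E; unfold M; generalize (lin u1 u2 u3 r) (lin u1 u2 u3 r'); clear -Hmu; intros.
    vec; simpl in E; injection E as E1 E2 E3.
    repeat f_equal; apply (Rmult_eq_reg_l mu); lra. }
  assert (HMs : forall q, exists r, q = M r).
  { intros q; exists (tr u1 u2 u3 (smul (/ mu) q)); unfold M; rewrite lin_tr by exact Hu.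
    clear - Hmu; vec; simpl; veq; field; lra. }
  assert (HMadd : forall p q, M (vadd p q) = vadd (M p) (M q)).
  { intros p q; unfold M; rewrite lin_vadd.
    generalize (lin u1 u2 u3 p) (lin u1 u2 u3 q); clear; intros; vec; simpl; veq. }
  assert (HMdot : forall p, dot (M p) (M p) = mu * mu * dot p p).
  { intros p; rewrite <- (dot_lin u1 u2 u3 p p Hu); unfold M.
    generalize (lin u1 u2 u3 p); clear; intros; vec; simpl; ring. }
  assert (HMb : forall v, bcc_lattice (M v) <-> bcc_lattice v).
  { intros v; rewrite <- HL, <- levelset_translation, translation_lattice_iff; split; intros H p.
    - rewrite <- HM, HMadd, <- (HM p), <- (H (vadd c (M p))).
      replace (vadd c (vadd (M p) (M v))) with (vadd (vadd c (M p)) (M v)); [reflexivity|].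
      generalize (M p) (M v); clear; intros; vec; simpl; veq.
    - destruct (HMs (vsub p c)) as [r Hr].
      replace p with (vadd c (M r)).
      + replace (vadd (vadd c (M r)) (M v)) with (vadd c (M (vadd r v))).
        * now rewrite !HM.
        * rewrite HMadd; generalize (M r) (M v); clear; intros; vec; simpl; veq.
      + rewrite <- Hr; clear; vec; simpl; veq. }
  assert (H111 : bcc_lattice (1, 1, 1)).
  { apply bcc_coords; exists 0%Z, 0%Z, 0%Z, 1%Z; repeat split; ring. }
  (* [M] and its inverse preserve the lattice, so neither can shorten the shortest vector (1, 1,
     1). *)
  assert (Hmu1 : mu = 1).
  { assert (1 <= mu * mu).
    { destruct (bcc_norm (M (1, 1, 1))) as [E|E]; [now apply HMb| |].
      - assert (D := HMdot (1, 1, 1)); rewrite E in D; simpl in D; nra.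
      - rewrite HMdot in E; simpl in E; lra. }
    assert (mu * mu <= 1).
    { destruct (HMs (1, 1, 1)) as [v Hv]; assert (D := HMdot v); rewrite <- Hv in D; simpl in D.
      destruct (bcc_norm v) as [E|E].
      - apply HMb; now rewrite <- Hv.
      - rewrite E in D; simpl in D; lra.
      - nra. }
    nra. }
  assert (HM1 : forall r, M r = lin u1 u2 u3 r).
  { intros r; unfold M; rewrite Hmu1; generalize (lin u1 u2 u3 r); clear; intros; vec; simpl; veq. }
  assert (HV : forall e, bcc_lattice (smul 2 e) -> dot e e = 1 ->
                octahedron_vertex (lin u1 u2 u3 e)).
  { intros e He1 He2; apply bcc_norm4; [|rewrite dot_lin; auto].
    apply HMb in He1; rewrite HM1 in He1; revert He1.
    match goal with |- bcc_lattice ?u -> bcc_lattice ?v => replace v with u; [auto|] end.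
    clear; vec; simpl; veq. }
  assert (V1 : octahedron_vertex u1).
  { replace u1 with (lin u1 u2 u3 (1, 0, 0)) by (clear; vec; simpl; veq).
    apply HV; simpl; [|ring]; apply bcc_coords; exists 1%Z, 0%Z, 0%Z, 0%Z; repeat split; ring. }
  assert (V2 : octahedron_vertex u2).
  { replace u2 with (lin u1 u2 u3 (0, 1, 0)) by (clear; vec; simpl; veq).
    apply HV; simpl; [|ring]; apply bcc_coords; exists 0%Z, 1%Z, 0%Z, 0%Z; repeat split; ring. }
  assert (V3 : octahedron_vertex u3).
  { replace u3 with (lin u1 u2 u3 (0, 0, 1)) by (clear; vec; simpl; veq).
    apply HV; simpl; [|ring]; apply bcc_coords; exists 0%Z, 0%Z, 1%Z, 0%Z; repeat split; ring. }
  assert (HSc : forall p, S p <-> levelset (vsub p c)).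
  { intros p; destruct (HMs (vsub p c)) as [r Hr].
    replace p with (vadd c (M r)) at 1.
    - rewrite HM, Hr, HM1; symmetry; now apply levelset_signed_perm.
    - rewrite <- Hr; clear; vec; simpl; veq. }
  intros p; rewrite HSc.
  assert (Hc := octahedral_center_bcc S c HSc HL Hcen).
  rewrite <- (proj2 (levelset_translation c) Hc (vsub p c)).
  replace (vadd (vsub p c) c) with p; [reflexivity|clear; vec; simpl; veq].
Qed.

(** * Gronwall uniqueness *)

(** Write w = u + i v, so that w^2 = A + 2 i B. The difference w(y)^2 - w(t)^2 factors as (w(y) -
    w(t)) (w(y) + w(t)), and the second factor, [s + i r] below, tends to 2 w(t), which is nonzero.
    So the slope of w is the slope of w^2 divided by a continuous nonzero function. *)
Lemma complex_sqrt_derive (A B u v : R -> R) (t A' B' : R) :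
  is_derive A t A' -> is_derive B t B' -> continuous u t -> continuous v t ->
  locally t (fun y => u y * u y = v y * v y + A y /\ u y * v y = B y) ->
  0 < u t * u t + v t * v t ->
  is_derive u t ((A' * u t + 2 * B' * v t) / (2 * (u t * u t + v t * v t))) /\
  is_derive v t ((2 * B' * u t - A' * v t) / (2 * (u t * u t + v t * v t))).
Proof.
  intros HA HB Hu Hv Hloc Hp.
  destruct (slope_exists _ _ _ HA) as (kA & HkA & EA & SA).
  destruct (slope_exists _ _ _ HB) as (kB & HkB & EB & SB).
  assert (Ht := locally_singleton _ _ Hloc); destruct Ht as [Ht1 Ht2].
  set (s := fun y => u y + u t); set (r := fun y => v y + v t).
  assert (Hs : continuous s t) by (apply (continuous_plus u); [exact Hu|apply continuous_const]).
  assert (Hr : continuous r t) by (apply (continuous_plus v); [exact Hv|apply continuous_const]).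
  assert (Hq : continuous (fun y => s y * s y + r y * r y) t).
  { apply (continuous_plus (fun y => s y * s y)); now apply (continuous_mult (K := R_AbsRing)). }
  assert (Hne : 0 < s t * s t + r t * r t) by (unfold s, r; nra).
  assert (Hpos : locally t (fun y => 0 < s y * s y + r y * r y)).
  { apply Hq; exact (open_gt 0 _ Hne). }
  assert (Hi : continuous (fun y => / (s y * s y + r y * r y)) t).
  { apply (continuous_comp (fun y => s y * s y + r y * r y) Rinv); [exact Hq|].
    apply continuous_Rinv; lra. }
  assert (H2 : forall f : R -> R, continuous f t -> continuous (fun y => 2 * f y) t).
  { intros f Hf; apply (continuous_mult (fun _ => 2) f); [apply continuous_const|exact Hf]. }
  split.
  - set (k := fun y => (s y * kA y + r y * (2 * kB y)) * / (s y * s y + r y * r y)).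
    apply (is_derive_eq _ _ (k t)).
    + apply slope_derive.
      * apply (continuous_mult (fun y => s y * kA y + r y * (2 * kB y))); [|exact Hi].
        apply (continuous_plus (fun y => s y * kA y));
          apply (continuous_mult (K := R_AbsRing)); auto.
      * generalize (filter_and _ _ Hloc Hpos); apply filter_imp; intros y [[H1 H3] H4].
        unfold k; specialize (SA y); specialize (SB y).
        apply (Rmult_eq_reg_r (s y * s y + r y * r y)); [|lra].
        replace ((s y * kA y + r y * (2 * kB y)) * / (s y * s y + r y * r y) * (y - t)
          * (s y * s y + r y * r y)) with (s y * (kA y * (y - t)) + 2 * r y * (kB y * (y - t)))
          by (field; lra).
        rewrite <- SA, <- SB, <- H3, <- Ht2.
        replace (A y - A t) with ((u y * u y - v y * v y) - (u t * u t - v t * v t)) by lra.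
        unfold s, r; ring.
    + unfold k, s, r; rewrite EA, EB; field; nra.
  - set (k := fun y => (s y * (2 * kB y) - r y * kA y) * / (s y * s y + r y * r y)).
    apply (is_derive_eq _ _ (k t)).
    + apply slope_derive.
      * apply (continuous_mult (fun y => s y * (2 * kB y) - r y * kA y)); [|exact Hi].
        apply (continuous_minus (fun y => s y * (2 * kB y)));
          apply (continuous_mult (K := R_AbsRing)); auto.
      * generalize (filter_and _ _ Hloc Hpos); apply filter_imp; intros y [[H1 H3] H4].
        unfold k; specialize (SA y); specialize (SB y).
        apply (Rmult_eq_reg_r (s y * s y + r y * r y)); [|lra].
        replace ((s y * (2 * kB y) - r y * kA y) * / (s y * s y + r y * r y) * (y - t)
          * (s y * s y + r y * r y)) with (2 * s y * (kB y * (y - t)) - r y * (kA y * (y - t)))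
          by (field; lra).
        rewrite <- SA, <- SB, <- H3, <- Ht2.
        replace (A y - A t) with ((u y * u y - v y * v y) - (u t * u t - v t * v t)) by lra.
        unfold s, r; ring.
    + unfold k, s, r; rewrite EA, EB; field; nra.
Qed.

(* [MVT_gen] only locates [c] in the closed interval. *)
Lemma MVT_nonincr (f df : R -> R) (a b : R) :
  a <= b -> (forall t, a <= t <= b -> continuous f t) ->
  (forall t, a < t < b -> is_derive f t (df t)) ->
  (forall t, a < t < b -> df t <= 0) -> f b <= f a.
Proof.
  intros Hab Hc Hd Hn.
  destruct (MVT_gen f a b (fun t => if Rlt_dec a t then if Rlt_dec t b then df t else 0 else 0))
    as [c [_ Hc2]].
  - rewrite Rmin_left, Rmax_right by lra; intros t Ht.
    destruct (Rlt_dec a t), (Rlt_dec t b); try lra; now apply Hd.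
  - rewrite Rmin_left, Rmax_right by lra; intros t Ht; apply continuity_pt_filterlim, Hc, Ht.
  - assert ((if Rlt_dec a c then if Rlt_dec c b then df c else 0 else 0) <= 0).
    { destruct (Rlt_dec a c), (Rlt_dec c b); try lra; now apply Hn. }
    nra.
Qed.

Lemma gronwall_zero (f df : R -> R) (M T : R) :
  0 <= T -> (forall t, 0 <= t <= T -> continuous f t) ->
  (forall t, 0 < t < T -> is_derive f t (df t)) ->
  (forall t, 0 < t < T -> df t <= M * f t) -> f 0 = 0 -> f T <= 0.
Proof.
  intros HT Hc Hd Hb H0.
  assert (H : f T * exp (- M * T) <= f 0 * exp (- M * 0)).
  { apply (MVT_nonincr (fun t => f t * exp (- M * t)) (fun t => (df t - M * f t) * exp (- M * t)));
      auto.
    - intros t Ht; apply (continuous_mult f (fun t => exp (- M * t))); [now apply Hc|].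
      apply (ex_derive_continuous (V := R_NormedModule)); auto_derive; exact I.
    - intros t Ht; eapply is_derive_eq.
      + apply (is_derive_mult f (fun t => exp (- M * t)) t (df t) (- M * exp (- M * t)));
          [now apply Hd| |apply Rmult_comm].
        auto_derive; [exact I|ring].
      + unfold plus, mult; simpl; ring.
    - intros t Ht; pose proof (exp_pos (- M * t)); specialize (Hb t Ht); nra. }
  rewrite H0 in H; pose proof (exp_pos (- M * T)); nra.
Qed.

Lemma is_derive_zero_on (f : R -> R) (T : R) :
  0 <= T -> (forall t, 0 <= t <= T -> continuous f t) ->
  (forall t, 0 < t < T -> is_derive f t 0) -> f T = f 0.
Proof.
  intros HT Hc Hd; apply Rle_antisym.
  - apply (MVT_nonincr f (fun _ => 0)); auto; intros; lra.
  - apply Ropp_le_cancel.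
    apply (MVT_nonincr (fun t => - f t) (fun _ => 0)); auto; [| |intros; lra].
    + intros t Ht; apply (continuous_opp f); auto.
    + intros t Ht; apply (is_derive_eq _ _ (opp 0)); [apply (is_derive_opp f); auto|apply Ropp_0].
Qed.

(* The system solved by the pair [(tc (x t), nc (x t))], with [rate = K34 * x' / 2];
   it preserves [(1 + T^2) (1 + n^2)]. *)
Definition curve_ode (T n rate : R -> R) (t : R) : Prop :=
  is_derive T t (2 * (1 + T t ^ 2) * n t * rate t) /\
  is_derive n t (- 2 * (1 + n t ^ 2) * T t * rate t).

Lemma curve_ode_curve (T n rate : R -> R) (b : R) :
  0 <= b -> (forall t, 0 <= t <= b -> continuous T t /\ continuous n t) ->
  (forall t, 0 < t < b -> curve_ode T n rate t) ->
  (1 + T b ^ 2) * (1 + n b ^ 2) = (1 + T 0 ^ 2) * (1 + n 0 ^ 2).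
Proof.
  intros Hb Hc Hd.
  assert (Hsq : forall (f : R -> R) t, continuous f t -> continuous (fun t => 1 + f t ^ 2) t).
  { intros f t Hf; apply (continuous_comp f (fun x => 1 + x ^ 2)); [exact Hf|].
    apply (ex_derive_continuous (V := R_NormedModule)); auto_derive; exact I. }
  apply (is_derive_zero_on (fun t => (1 + T t ^ 2) * (1 + n t ^ 2))); [exact Hb| |].
  - intros t Ht; destruct (Hc t Ht).
    apply (continuous_mult (fun t => 1 + T t ^ 2)); now apply Hsq.
  - intros t Ht; destruct (Hd t Ht) as [HT Hn].
    eapply is_derive_eq.
    + apply (is_derive_mult (fun t => 1 + T t ^ 2) (fun t => 1 + n t ^ 2));
        [| |apply Rmult_comm].
      * apply (is_derive_comp (fun x => 1 + x ^ 2) T); [|exact HT].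
        auto_derive; [exact I|reflexivity].
      * apply (is_derive_comp (fun x => 1 + x ^ 2) n); [|exact Hn].
        auto_derive; [exact I|reflexivity].
    + unfold plus, mult, scal; simpl; unfold mult; simpl; ring.
Qed.

Lemma sum_sqr_le_0 x y : x ^ 2 + y ^ 2 <= 0 -> x = 0.
Proof.
  intros H; destruct (Req_dec x 0) as [|Hx]; [assumption|].
  pose proof (pow2_gt_0 x Hx); pose proof (pow2_ge_0 y); lra.
Qed.

Lemma curve_bounds T n : (1 + T ^ 2) * (1 + n ^ 2) = 4 -> Rabs T <= 2 /\ Rabs n <= 2.
Proof. intros H; split; apply Rabs_le; split; nra. Qed.

(** The right-hand sides are cubic and not globally Lipschitz. The conserved product (1 + T^2) (1 +
    n^2) = 4 keeps both solutions in a bounded region, where Gronwall applies to the squared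
    distance. *)
Lemma curve_ode_unique (T1 n1 T2 n2 rate : R -> R) (b M : R) :
  0 <= b ->
  (forall t, 0 <= t <= b -> continuous T1 t /\ continuous n1 t) ->
  (forall t, 0 <= t <= b -> continuous T2 t /\ continuous n2 t) ->
  (forall t, 0 < t < b -> curve_ode T1 n1 rate t) ->
  (forall t, 0 < t < b -> curve_ode T2 n2 rate t) ->
  (forall t, 0 < t < b -> Rabs (rate t) <= M) ->
  (1 + T1 0 ^ 2) * (1 + n1 0 ^ 2) = 4 -> T1 0 = T2 0 -> n1 0 = n2 0 ->
  T1 b = T2 b /\ n1 b = n2 b.
Proof.
  intros Hb Hc1 Hc2 Hd1 Hd2 HM H4 HT0 Hn0.
  assert (B1 : forall t, 0 < t < b -> Rabs (T1 t) <= 2 /\ Rabs (n1 t) <= 2).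
  { intros t Ht; apply curve_bounds; rewrite <- H4; apply (curve_ode_curve T1 n1 rate).
    - lra.
    - intros; apply Hc1; lra.
    - intros; apply Hd1; lra. }
  assert (B2 : forall t, 0 < t < b -> Rabs (T2 t) <= 2 /\ Rabs (n2 t) <= 2).
  { intros t Ht; apply curve_bounds; rewrite <- H4, HT0, Hn0; apply (curve_ode_curve T2 n2 rate).
    - lra.
    - intros; apply Hc2; lra.
    - intros; apply Hd2; lra. }
  assert (Hcont : forall t, 0 <= t <= b -> continuous (fun t => (T1 t - T2 t) ^ 2 + (n1 t - n2 t) ^ 2) t).
  { intros t Ht; destruct (Hc1 t Ht), (Hc2 t Ht).
    assert (Hsq : forall f g : R -> R, continuous f t -> continuous g t ->
              continuous (fun t => (f t - g t) ^ 2) t).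
    { intros f g Hf Hg; apply (continuous_comp (fun t => f t - g t) (fun x => x ^ 2));
        [now apply (continuous_minus f)|].
      apply (ex_derive_continuous (V := R_NormedModule)); auto_derive; exact I. }
    apply (continuous_plus (fun t => (T1 t - T2 t) ^ 2)); auto. }
  enough (E : (T1 b - T2 b) ^ 2 + (n1 b - n2 b) ^ 2 <= 0).
  { split; apply Rminus_diag_uniq; [|rewrite Rplus_comm in E];
      exact (sum_sqr_le_0 _ _ E). }
  set (V := fun (T n : R -> R) t => 2 * (1 + T t ^ 2) * n t * rate t).
  set (W := fun (T n : R -> R) t => - 2 * (1 + n t ^ 2) * T t * rate t).
  (* The factor 100 is crude: the bounds below would allow 40. *)
  apply (gronwall_zero (fun t => (T1 t - T2 t) ^ 2 + (n1 t - n2 t) ^ 2)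
    (fun t => 2 * (T1 t - T2 t) * (V T1 n1 t - V T2 n2 t)
              + 2 * (n1 t - n2 t) * (W T1 n1 t - W T2 n2 t)) (100 * M)); auto.
  - intros t Ht; destruct (Hd1 t Ht) as [HT1 Hn1], (Hd2 t Ht) as [HT2 Hn2].
    eapply is_derive_eq.
    + apply (is_derive_plus (fun t => (T1 t - T2 t) ^ 2)).
      * apply (is_derive_comp (fun x => x ^ 2) (fun t => T1 t - T2 t));
          [auto_derive; [exact I|reflexivity]|apply (is_derive_minus T1); eassumption].
      * apply (is_derive_comp (fun x => x ^ 2) (fun t => n1 t - n2 t));
          [auto_derive; [exact I|reflexivity]|apply (is_derive_minus n1); eassumption].
    + unfold plus, minus, opp, scal; simpl; unfold plus, opp, mult; simpl; unfold V, W; ring.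
  - intros t Ht; unfold V, W.
    destruct (B1 t Ht) as [BT1 Bn1], (B2 t Ht) as [BT2 Bn2]; specialize (HM t Ht).
    apply Rabs_le_between in BT1, Bn1, BT2, Bn2, HM.
    generalize dependent (rate t).
    generalize dependent (T1 t); generalize dependent (n1 t).
    generalize dependent (T2 t); generalize dependent (n2 t); clear.
    intros n2 Hn2 T2 HT2 n1 Hn1 T1 HT1 r Hr.
    replace (2 * (T1 - T2) * (2 * (1 + T1 ^ 2) * n1 * r - 2 * (1 + T2 ^ 2) * n2 * r) +
      2 * (n1 - n2) * (-2 * (1 + n1 ^ 2) * T1 * r - -2 * (1 + n2 ^ 2) * T2 * r))
      with (r * (4 * (n1 * (T1 + T2)) * (T1 - T2) ^ 2 - 4 * (T1 * (n1 + n2)) * (n1 - n2) ^ 2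
        + 4 * (T2 ^ 2 - n2 ^ 2) * ((T1 - T2) * (n1 - n2)))) by ring.
    set (x := T1 - T2); set (y := n1 - n2).
    assert (H1 : Rabs (n1 * (T1 + T2)) <= 8).
    { rewrite Rabs_mult; replace 8 with (2 * 4) by ring.
      apply Rmult_le_compat; try apply Rabs_pos; apply Rabs_le; lra. }
    assert (H2 : Rabs (T1 * (n1 + n2)) <= 8).
    { rewrite Rabs_mult; replace 8 with (2 * 4) by ring.
      apply Rmult_le_compat; try apply Rabs_pos; apply Rabs_le; lra. }
    assert (H3 : -4 <= T2 ^ 2 - n2 ^ 2 <= 4) by (split; nra).
    apply Rabs_le_between in H1, H2.
    assert (H5 : Rabs (4 * (n1 * (T1 + T2)) * x ^ 2 - 4 * (T1 * (n1 + n2)) * y ^ 2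
      + 4 * (T2 ^ 2 - n2 ^ 2) * (x * y)) <= 100 * (x ^ 2 + y ^ 2)).
    { generalize dependent (n1 * (T1 + T2)); generalize dependent (T1 * (n1 + n2)).
      generalize dependent (T2 ^ 2 - n2 ^ 2); clearbody x y; clear.
      intros c Hc b Hb a Ha.
      pose proof (pow2_ge_0 x); pose proof (pow2_ge_0 y).
      pose proof (pow2_ge_0 (x + y)); pose proof (pow2_ge_0 (x - y)).
      assert (a * x ^ 2 <= 8 * x ^ 2 /\ - 8 * x ^ 2 <= a * x ^ 2) by (split; nra).
      assert (b * y ^ 2 <= 8 * y ^ 2 /\ - 8 * y ^ 2 <= b * y ^ 2) by (split; nra).
      assert (Hxy : - (x ^ 2 + y ^ 2) <= 2 * (x * y) <= x ^ 2 + y ^ 2) by (split; nra).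
      assert (Hc2 : Rabs (c * (2 * (x * y))) <= 4 * (x ^ 2 + y ^ 2)).
      { rewrite Rabs_mult; apply Rmult_le_compat; try apply Rabs_pos; apply Rabs_le; lra. }
      apply Rabs_le_between in Hc2; apply Rabs_le; split; nra. }
    assert (H6 := Rmult_le_compat (Rabs r) M _ _ (Rabs_pos _) (Rabs_pos _)
      (proj2 (Rabs_le_between _ _) Hr) H5).
    rewrite <- Rabs_mult in H6; pose proof (Rle_abs (r * (4 * (n1 * (T1 + T2)) * x ^ 2
      - 4 * (T1 * (n1 + n2)) * y ^ 2 + 4 * (T2 ^ 2 - n2 ^ 2) * (x * y)))).
    lra.
  - rewrite HT0, Hn0; ring.
Qed.

(** * The Weierstrass representation in real coordinates *)

Inductive axis := axis1 | axis2 | axis3.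

(* Throughout, [zeta = a + i b], [w = u + i v], and [zeta' / w = p + i q].
   [gaussN] is [(1 + |zeta|^2)] times the Gauss map; with
   [phi = (1 - zeta^2, i (1 + zeta^2), 2 zeta)], [hopf j] is [Re (phi_j^2 conj w)]
   and [wrate j] is [Re (phi_j zeta' / w)]. *)
Definition gaussN (j : axis) (a b : R) : R :=
  match j with axis1 => 2 * a | axis2 => 2 * b | axis3 => a * a + b * b - 1 end.
Definition hopf (j : axis) (a b u v : R) : R :=
  let c := a * a - b * b in let d := 2 * a * b in
  match j with
  | axis1 => ((1 - c) * (1 - c) - d * d) * u - 2 * (1 - c) * d * v
  | axis2 => - (((1 + c) * (1 + c) - d * d) * u + 2 * (1 + c) * d * v)
  | axis3 => 4 * (c * u + d * v)
  end.
Definition wrate (j : axis) (a b p q : R) : R :=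
  let c := a * a - b * b in let d := 2 * a * b in
  match j with
  | axis1 => (1 - c) * p + d * q
  | axis2 => - ((1 + c) * q + d * p)
  | axis3 => 2 * (a * p - b * q)
  end.

(* Real part and half the imaginary part of [1 + 14 zeta^4 + zeta^8], and the real and
   imaginary parts of half its derivative. *)
Definition octRe (a b : R) : R :=
  let c := a * a - b * b in let d := 2 * a * b in
  let c2 := c * c - d * d in let d2 := 2 * c * d in 1 + 14 * c2 + (c2 * c2 - d2 * d2).
Definition octIm (a b : R) : R :=
  let c := a * a - b * b in let d := 2 * a * b in
  let c2 := c * c - d * d in let d2 := 2 * c * d in 7 * d2 + c2 * d2.
Definition doctRe (a b : R) : R :=
  let c := a * a - b * b in let d := 2 * a * b in
  let c2 := c * c - d * d in let d2 := 2 * c * d in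
  28 * (a * c - b * d) + 4 * ((a * c - b * d) * c2 - (a * d + b * c) * d2).
Definition doctIm (a b : R) : R :=
  let c := a * a - b * b in let d := 2 * a * b in
  let c2 := c * c - d * d in let d2 := 2 * c * d in
  28 * (a * d + b * c) + 4 * ((a * c - b * d) * d2 + (a * d + b * c) * c2).

Definition on_curve (a b u v : R) : Prop :=
  u * u = v * v + octRe a b /\ u * v = octIm a b.

(** Equal to |w|^2 + (1/2) sum_k |phi_k|^4. *)
Definition weight (a b u v : R) : R :=
  let rho := a * a + b * b in
  let c := a * a - b * b in let d := 2 * a * b in
  1 + 12 * (rho * rho) + rho * rho * (rho * rho) + 2 * (c * c - d * d) + (u * u + v * v).
Definition hden (j : axis) (a b : R) : R :=
  (1 + (a * a + b * b)) * (1 + (a * a + b * b)) + gaussN j a b * gaussN j a b.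
Definition nnum (j : axis) (a b : R) : R := gaussN j a b * (1 + (a * a + b * b)).

(** The unit normal stretched to length sqrt 6 (1 + |zeta|^2)^2 / sqrt [weight]. At a point of the
    level set this length is 1 / K times that of the gradient of alpha(x) + alpha(y) + alpha(z). *)
Definition nW (j : axis) (a b u v : R) : R :=
  sqrt 6 * nnum j a b / sqrt (weight a b u v).
Definition tW (j : axis) (a b u v : R) : R :=
  sqrt 6 * - (hopf j a b u v / hden j a b) / sqrt (weight a b u v).

Lemma weight_pos a b u v : 0 < weight a b u v.
Proof. unfold weight; nra. Qed.

Lemma hden_pos j a b : 0 < hden j a b.
Proof. unfold hden; nra. Qed.

Lemma is_derive_over_sqrt (X W : R -> R) (t X' h : R) :
  is_derive X t X' -> is_derive W t (2 * h) -> 0 < W t ->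
  is_derive (fun t => sqrt 6 * X t / sqrt (W t)) t
    (sqrt 6 * (X' * W t - X t * h) / (W t * sqrt (W t))).
Proof.
  intros HX HW Hp; pose proof (sqrt_lt_R0 _ Hp); pose proof (sqrt_sqrt (W t) ltac:(lra)) as Hs.
  eapply is_derive_eq.
  - apply (is_derive_mult (fun t => sqrt 6 * X t) (fun t => / sqrt (W t)));
      [apply (is_derive_scal X t (sqrt 6)), HX| |apply Rmult_comm].
    apply (is_derive_comp (fun w => / sqrt w) W); [|exact HW].
    auto_derive; [|reflexivity]. split; [lra|split; [lra|exact I]].
  - unfold plus, mult, scal; simpl; unfold mult; simpl; unfold mult; simpl.
    set (s := sqrt (W t)) in *; rewrite <- Hs; field; lra.
Qed.

Lemma quotient_key (r r' H H' W h X k : R) : H <> 0 ->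
  - (r' * H * W - r * H' * W - r * H * h) = 2 * (H * H * W + 6 * r * r) * X * k ->
  - ((r' * H - r * H') / (H * H)) * W - - (r / H) * h
  = 2 * (W + 6 * (- (r / H) * - (r / H))) * X * k.
Proof.
  intros HH E.
  replace (- ((r' * H - r * H') / (H * H)) * W - - (r / H) * h)
    with (- (r' * H * W - r * H' * W - r * H * h) / (H * H)) by (field; exact HH).
  rewrite E; field; exact HH.
Qed.

Lemma over_sqrt_key (Y Y' W h X k s g : R) : 0 < s -> s * s = W -> g * g = 6 ->
  Y' * W - Y * h = 2 * (W + 6 * (Y * Y)) * X * k ->
  g * (Y' * W - Y * h) / (W * s) = 2 * (1 + (g * Y / s) * (g * Y / s)) * (g * X / s) * k.
Proof.
  intros Hs HW Hg E; rewrite E, <- HW, <- Hg; field; lra.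
Qed.

(* Derivatives along a path with velocity [(a', b', u', v')]. *)
Definition dgaussN (j : axis) (a b a' b' : R) : R :=
  match j with axis1 => 2 * a' | axis2 => 2 * b' | axis3 => 2 * (a * a' + b * b') end.
Definition dhopf (j : axis) (a b u v a' b' u' v' : R) : R :=
  let c := a * a - b * b in let d := 2 * a * b in
  let c' := 2 * (a * a' - b * b') in let d' := 2 * (a * b' + b * a') in
  match j with
  | axis1 => ((1 - c) * (1 - c) - d * d) * u' - 2 * (1 - c) * d * v'
      + (-2 * (1 - c) * c' - 2 * d * d') * u - 2 * ((1 - c) * d' - c' * d) * v
  | axis2 => - (((1 + c) * (1 + c) - d * d) * u' + 2 * (1 + c) * d * v'
      + (2 * (1 + c) * c' - 2 * d * d') * u + 2 * ((1 + c) * d' + c' * d) * v)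
  | axis3 => 4 * (c * u' + d * v' + c' * u + d' * v)
  end.
(** Half the derivative of [weight], the form in which it enters the derivative of the square
    root. *)
Definition dweight2 (a b u v a' b' u' v' : R) : R :=
  let rho := a * a + b * b in let rho' := 2 * (a * a' + b * b') in
  let c := a * a - b * b in let d := 2 * a * b in
  let c' := 2 * (a * a' - b * b') in let d' := 2 * (a * b' + b * a') in
  12 * rho * rho' + 2 * rho * rho * rho * rho' + 2 * (c * c' - d * d') + u * u' + v * v'.

Ltac unfold_data :=
  unfold dhopf, dweight2, hopf, wrate, weight, nnum, hden, dgaussN, gaussN,
    octRe, octIm, doctRe, doctIm in *.

(** The equation for n' in [curve_ode], cleared of denominators. The velocities come from zeta' = w
    (p + i q); differentiating w^2 = 1 + 14 zeta^4 + zeta^8 and cancelling w then gives w' as p + i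
    q times half the derivative of the polynomial. *)
Lemma gauss_identity j a b u v p q : on_curve a b u v ->
  let a' := u * p - v * q in let b' := u * q + v * p in
  let u' := doctRe a b * p - doctIm a b * q in let v' := doctRe a b * q + doctIm a b * p in
  let rho := a * a + b * b in let rho' := 2 * (a * a' + b * b') in
  hden j a b * ((dgaussN j a b a' b' * (1 + rho) + gaussN j a b * rho') * weight a b u v
    - nnum j a b * dweight2 a b u v a' b' u' v')
  = 2 * (weight a b u v + 6 * nnum j a b * nnum j a b) * hopf j a b u v * wrate j a b p q.
Proof.
  intros [H1 H2]; cbv zeta.
  (* The product u u v reduces in two ways by the two equations of the curve. Their difference is
     the missing rule that makes the reduction in [ring] complete. *)
  assert (H3 : v * v * v = u * octIm a b - octRe a b * v).
  { rewrite <- H2; replace (v * v * v) with ((v * v + octRe a b) * v - octRe a b * v) by ring.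
    rewrite <- H1; ring. }
  destruct j; unfold_data; cbv zeta in *; ring [H1 H2 H3].
Qed.

(** The equation for T' in [curve_ode], treated likewise. *)
Lemma hopf_identity j a b u v p q : on_curve a b u v ->
  let a' := u * p - v * q in let b' := u * q + v * p in
  let u' := doctRe a b * p - doctIm a b * q in let v' := doctRe a b * q + doctIm a b * p in
  let rho := a * a + b * b in let rho' := 2 * (a * a' + b * b') in
  let H' := 2 * (1 + rho) * rho' + 2 * gaussN j a b * dgaussN j a b a' b' in
  - (dhopf j a b u v a' b' u' v' * hden j a b * weight a b u v
     - hopf j a b u v * H' * weight a b u v
     - hopf j a b u v * hden j a b * dweight2 a b u v a' b' u' v')
  = 2 * (hden j a b * hden j a b * weight a b u v + 6 * hopf j a b u v * hopf j a b u v)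
    * nnum j a b * wrate j a b p q.
Proof.
  intros [H1 H2]; cbv zeta.
  assert (H3 : v * v * v = u * octIm a b - octRe a b * v).
  { rewrite <- H2; replace (v * v * v) with ((v * v + octRe a b) * v - octRe a b * v) by ring.
    rewrite <- H1; ring. }
  destruct j; unfold_data; cbv zeta in *; ring [H1 H2 H3].
Qed.

Lemma weierstrass_ode j (a b u v rate : R -> R) (t p q : R) :
  is_derive a t (u t * p - v t * q) -> is_derive b t (u t * q + v t * p) ->
  is_derive u t (doctRe (a t) (b t) * p - doctIm (a t) (b t) * q) ->
  is_derive v t (doctRe (a t) (b t) * q + doctIm (a t) (b t) * p) ->
  on_curve (a t) (b t) (u t) (v t) ->
  rate t = wrate j (a t) (b t) p q ->
  curve_ode (fun t => tW j (a t) (b t) (u t) (v t)) (fun t => nW j (a t) (b t) (u t) (v t)) rate t.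
Proof.
  intros Ha Hb Hu Hv Hc Hr.
  set (a' := u t * p - v t * q) in *; set (b' := u t * q + v t * p) in *.
  set (u' := doctRe (a t) (b t) * p - doctIm (a t) (b t) * q) in *.
  set (v' := doctRe (a t) (b t) * q + doctIm (a t) (b t) * p) in *.
  pose proof (weight_pos (a t) (b t) (u t) (v t)) as Hp.
  pose proof (hden_pos j (a t) (b t)) as Hh.
  pose proof (gauss_identity j _ _ _ _ p q Hc) as G; cbv zeta in G.
  pose proof (hopf_identity j _ _ _ _ p q Hc) as F; cbv zeta in F.
  fold a' b' u' v' in G, F.
  assert (Da : Derive (fun x : R => a x) t = a') by exact (is_derive_unique _ _ _ Ha).
  assert (Db : Derive (fun x : R => b x) t = b') by exact (is_derive_unique _ _ _ Hb).
  assert (Du : Derive (fun x : R => u x) t = u') by exact (is_derive_unique _ _ _ Hu).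
  assert (Dv : Derive (fun x : R => v x) t = v') by exact (is_derive_unique _ _ _ Hv).
  assert (HW : is_derive (fun t => weight (a t) (b t) (u t) (v t)) t
                 (2 * dweight2 (a t) (b t) (u t) (v t) a' b' u' v')).
  { unfold weight, dweight2; auto_derive; [repeat split; eexists; eassumption|].
    rewrite Da, Db, Du, Dv; ring. }
  assert (HX : is_derive (fun t => nnum j (a t) (b t)) t
     (dgaussN j (a t) (b t) a' b' * (1 + (a t * a t + b t * b t))
      + gaussN j (a t) (b t) * (2 * (a t * a' + b t * b')))).
  { unfold nnum, gaussN, dgaussN; destruct j; auto_derive;
      try (repeat split; eexists; eassumption); rewrite ?Da, ?Db; ring. }
  assert (HH : is_derive (fun t => hden j (a t) (b t)) t
     (2 * (1 + (a t * a t + b t * b t)) * (2 * (a t * a' + b t * b'))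
      + 2 * gaussN j (a t) (b t) * dgaussN j (a t) (b t) a' b')).
  { unfold hden, gaussN, dgaussN; destruct j; auto_derive;
      try (repeat split; eexists; eassumption); rewrite ?Da, ?Db; ring. }
  assert (Hhopf : is_derive (fun t => hopf j (a t) (b t) (u t) (v t)) t
     (dhopf j (a t) (b t) (u t) (v t) a' b' u' v')).
  { unfold hopf, dhopf; destruct j; auto_derive;
      try (repeat split; eexists; eassumption); rewrite ?Da, ?Db, ?Du, ?Dv; ring. }
  assert (HY := is_derive_opp _ _ _ (is_derive_div _ _ _ _ _ Hhopf HH ltac:(lra))).
  pose proof (sqrt_lt_R0 _ Hp); pose proof (sqrt_sqrt _ (Rlt_le _ _ Hp)) as Hs.
  assert (H6 : sqrt 6 * sqrt 6 = 6) by (apply sqrt_sqrt; lra).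
  apply quotient_key in F; [|lra].
  split.
  - eapply is_derive_eq; [exact (is_derive_over_sqrt _ _ _ _ _ HY HW Hp)|].
    unfold opp; simpl; rewrite Hr; unfold tW, nW; rewrite !Rmult_1_r.
    exact (over_sqrt_key _ _ _ _ _ _ _ _ H Hs H6 F).
  - eapply is_derive_eq; [exact (is_derive_over_sqrt _ _ _ _ _ HX HW Hp)|].
    rewrite Hr; unfold tW, nW; simpl; rewrite Rmult_1_r.
    rewrite (over_sqrt_key _ _ _ _ (- (hopf j (a t) (b t) (u t) (v t) / hden j (a t) (b t)))
      (- wrate j (a t) (b t) p q) _ _ H Hs H6).
    + ring.
    + apply (Rmult_eq_reg_l (hden j (a t) (b t))); [|lra].
      rewrite G; field; lra.
Qed.

Definition quotRe (z w : C) : R :=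
  (fst z * fst w + snd z * snd w) / (fst w * fst w + snd w * snd w).
Definition quotIm (z w : C) : R :=
  (snd z * fst w - fst z * snd w) / (fst w * fst w + snd w * snd w).

Lemma C_norm2_pos (w : C) : w <> RtoC 0 -> 0 < fst w * fst w + snd w * snd w.
Proof.
  destruct w as [u v]; simpl; intros Hw.
  destruct (Req_dec u 0) as [->|Hu]; [|nra].
  destruct (Req_dec v 0) as [->|Hv]; [now contradiction Hw|nra].
Qed.

Lemma Cdiv_quot (z w : C) : (z / w)%C = (quotRe z w, quotIm z w).
Proof.
  destruct z as [x y], w as [u v]; unfold Cdiv, Cinv, Cmult, quotRe, quotIm, Rdiv; simpl.
  rewrite !Rmult_1_r; apply f_equal2; ring.
Qed.

Lemma quot_mul (z w : C) : w <> RtoC 0 ->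
  fst z = fst w * quotRe z w - snd w * quotIm z w /\
  snd z = fst w * quotIm z w + snd w * quotRe z w.
Proof.
  intros Hw; apply C_norm2_pos in Hw; unfold quotRe, quotIm; split; field; lra.
Qed.

Lemma on_curve_iff (z w : C) :
  (w ^ 2)%C = (1 + 14 * z ^ 4 + z ^ 8)%C <-> on_curve (fst z) (snd z) (fst w) (snd w).
Proof.
  destruct z as [a b], w as [u v]; unfold on_curve, octRe, octIm; simpl.
  unfold Cmult, Cplus, RtoC; simpl; split.
  - intros E; injection E as E1 E2; split; lra.
  - intros [E1 E2]; apply f_equal2; lra.
Qed.

Definition wvel (j : axis) (z w dz : C) : R :=
  match j with
  | axis1 => velocity1 z w dz | axis2 => velocity2 z w dz | axis3 => velocity3 z w dz
  end.

Lemma wvel_wrate j (z w dz : C) :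
  wvel j z w dz = wrate j (fst z) (snd z) (quotRe dz w) (quotIm dz w).
Proof.
  unfold wvel, velocity1, velocity2, velocity3; rewrite Cdiv_quot.
  generalize (quotRe dz w) (quotIm dz w); intros p q; destruct z as [a b], j;
    unfold wrate, Ci, RtoC, Cminus, Cmult, Copp, Cplus; simpl;
    unfold Cmult, RtoC, Cplus, Copp; simpl; ring.
Qed.

Lemma continuous_fst_comp (f : R -> C) t : continuous f t -> continuous (fun t => fst (f t)) t.
Proof. intros H; apply (continuous_comp f fst); [exact H|apply continuous_fst]. Qed.

Lemma continuous_snd_comp (f : R -> C) t : continuous f t -> continuous (fun t => snd (f t)) t.
Proof. intros H; apply (continuous_comp f snd); [exact H|apply continuous_snd]. Qed.

Lemma is_derive_pair (f : R -> C) t (l : C) :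
  is_derive (K := R_AbsRing) (V := prod_NormedModule R_AbsRing R_NormedModule R_NormedModule) f t l
  <-> is_derive (fun t => fst (f t)) t (fst l) /\ is_derive (fun t => snd (f t)) t (snd l).
Proof.
  unfold is_derive; split.
  - intros H; split.
    + apply (filterdiff_comp' f fst t (fun y => scal y l) fst H).
      apply filterdiff_linear, is_linear_fst.
    + apply (filterdiff_comp' f snd t (fun y => scal y l) snd H).
      apply filterdiff_linear, is_linear_snd.
  - intros [H1 H2].
    apply (filterdiff_ext (fun t => (fst (f t), snd (f t)))).
    { intros y; symmetry; apply surjective_pairing. }
    apply (filterdiff_comp'_2 (fun t => fst (f t)) (fun t => snd (f t)) (fun x y => (x, y)) t _ _
             (fun x y => (x, y)) H1 H2).
    apply (filterdiff_ext_lin _ (fun t => t)).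
    + apply (filterdiff_ext (fun t => t)); [intros y; apply surjective_pairing|].
      apply filterdiff_id.
    + intros y; apply surjective_pairing.
Qed.

(* The point of the level set where the lift starts, i.e. where [zeta = 0] and [w = 1]. *)
Definition base (j : axis) : R :=
  match j with axis1 => 1 | axis2 => 0 | axis3 => 1 / 2 end.

Lemma continuous_wrate j (a b p q : R -> R) t :
  continuous a t -> continuous b t -> continuous p t -> continuous q t ->
  continuous (fun t => wrate j (a t) (b t) (p t) (q t)) t.
Proof.
  intros Ha Hb Hp Hq.
  destruct j; unfold wrate; cont.
Qed.

Lemma continuous_quot (z w : R -> C) t : continuous z t -> continuous w t -> w t <> RtoC 0 ->
  continuous (fun t => quotRe (z t) (w t)) t /\ continuous (fun t => quotIm (z t) (w t)) t.
Proof.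
  intros Hz Hw H0; apply C_norm2_pos in H0.
  assert (H1 := continuous_fst_comp z t Hz); assert (H2 := continuous_snd_comp z t Hz).
  assert (H3 := continuous_fst_comp w t Hw); assert (H4 := continuous_snd_comp w t Hw).
  assert (I : continuous (fun t => / (fst (w t) * fst (w t) + snd (w t) * snd (w t))) t).
  { apply continuous_inv_pos; [cont|exact H0]. }
  unfold quotRe, quotIm, Rdiv; split; cont.
Qed.

Lemma continuous_W_data j (a b u v : R -> R) t :
  continuous a t -> continuous b t -> continuous u t -> continuous v t ->
  continuous (fun t => tW j (a t) (b t) (u t) (v t)) t /\
  continuous (fun t => nW j (a t) (b t) (u t) (v t)) t.
Proof.
  intros Ha Hb Hu Hv.
  assert (HG : continuous (fun t => gaussN j (a t) (b t)) t) by (destruct j; unfold gaussN; cont).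
  assert (HH : continuous (fun t => hopf j (a t) (b t) (u t) (v t)) t)
    by (destruct j; unfold hopf; cont).
  assert (HD : continuous (fun t => / hden j (a t) (b t)) t).
  { apply continuous_inv_pos; [unfold hden; cont|apply hden_pos]. }
  assert (HW : continuous (fun t => / sqrt (weight (a t) (b t) (u t) (v t))) t).
  { apply continuous_inv_pos; [|apply sqrt_lt_R0, weight_pos].
    apply (continuous_comp (fun t => weight (a t) (b t) (u t) (v t)) sqrt); [unfold weight; cont|].
    apply continuous_sqrt. }
  unfold tW, nW, nnum, Rdiv in *; split; cont.
Qed.

Lemma nW_tW_start j :
  tc (base j) = tW j 0 0 1 0 /\ nc (base j) = nW j 0 0 1 0.
Proof.
  assert (H62 : sqrt 6 / sqrt 2 = sqrt 3).
  { replace 6 with (3 * 2) by ring; rewrite sqrt_mult by lra; field.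
    apply Rgt_not_eq, sqrt_lt_R0; lra. }
  assert (HW : forall j, nW j 0 0 1 0 = sqrt 3 * nnum j 0 0).
  { intros i; unfold nW, weight; rewrite <- H62.
    replace (1 + _ + _ + _ + _) with 2 by ring; unfold Rdiv; ring. }
  assert (HT : forall j, tW j 0 0 1 0 = sqrt 3 * - (hopf j 0 0 1 0 / hden j 0 0)).
  { intros i; unfold tW, weight; rewrite <- H62.
    replace (1 + _ + _ + _ + _) with 2 by ring; unfold Rdiv; ring. }
  rewrite HW, HT; unfold nnum, hopf, hden, gaussN.
  destruct start_values as (T1 & N1 & T0 & N0 & T2 & N2).
  destruct j; simpl.
  - rewrite T1, N1; split; field.
  - rewrite T0, N0; split; field.
  - rewrite T2, N2; split; field.
Qed.

Lemma nW_wrate_orthogonal a b u v p q :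
  nW axis1 a b u v * wrate axis1 a b p q + nW axis2 a b u v * wrate axis2 a b p q
  + nW axis3 a b u v * wrate axis3 a b p q = 0.
Proof. unfold nW, nnum, gaussN, wrate, Rdiv; ring. Qed.

(* Paths are controlled only on [0, 1); clamping at 0 makes the lift differentiable there
   from both sides. *)
Definition clamped_velocity (j : axis) (zeta dzeta w : R -> C) (t : R) : R :=
  wvel j (zeta (Rmax 0 t)) (w (Rmax 0 t)) (dzeta (Rmax 0 t)).
Definition lift_coord (j : axis) (zeta dzeta w : R -> C) (t : R) : R :=
  RInt (clamped_velocity j zeta dzeta w) 0 t.
(** The factor 2 / K34 makes the velocity of the Weierstrass integral equal to the [rate] of
    [curve_ode]. *)
Definition placed_coord (j : axis) (zeta dzeta w : R -> C) (t : R) : R :=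
  base j + 2 / K34 * lift_coord j zeta dzeta w t.

(** * Lifts of continuation paths stay in the level set *)

Lemma lift_coords (zeta dzeta w : R -> C) t : 0 <= t ->
  lift zeta dzeta w t = (lift_coord axis1 zeta dzeta w t, lift_coord axis2 zeta dzeta w t,
                         lift_coord axis3 zeta dzeta w t).
Proof.
  intros Ht; unfold lift, lift_coord; repeat apply f_equal2;
    apply RInt_ext; rewrite Rmin_left, Rmax_right by lra; intros s Hs;
    unfold clamped_velocity, wvel; rewrite Rmax_right by lra; reflexivity.
Qed.

Lemma path_continuous (zeta dzeta w : R -> C) t : continuation_path zeta dzeta w -> 0 <= t < 1 ->
  continuous zeta t /\ continuous dzeta t /\ continuous w t /\ w t <> RtoC 0.
Proof.
  intros (_ & _ & H) Ht; destruct (H t Ht) as (H1 & H2 & H3 & _ & H4).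
  split; [|auto].
  apply (ex_derive_continuous (K := R_AbsRing)
    (V := prod_NormedModule R_AbsRing R_NormedModule R_NormedModule) zeta t).
  eexists; exact H1.
Qed.

Lemma continuous_wvel (zeta dzeta w : R -> C) j t : continuation_path zeta dzeta w -> 0 <= t < 1 ->
  continuous (fun t => wvel j (zeta t) (w t) (dzeta t)) t.
Proof.
  intros H Ht; destruct (path_continuous _ _ _ t H Ht) as (H1 & H2 & H3 & H4).
  destruct (continuous_quot _ _ t H2 H3 H4).
  apply (continuous_ext (fun t => wrate j (fst (zeta t)) (snd (zeta t))
           (quotRe (dzeta t) (w t)) (quotIm (dzeta t) (w t)))).
  { intros s; symmetry; apply wvel_wrate. }
  apply continuous_wrate; auto using continuous_fst_comp, continuous_snd_comp.
Qed.

Lemma continuous_clamped (zeta dzeta w : R -> C) j t : continuation_path zeta dzeta w -> t < 1 ->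
  continuous (clamped_velocity j zeta dzeta w) t.
Proof.
  intros H Ht; unfold clamped_velocity.
  apply (continuous_comp (fun t => Rmax 0 t) (fun t => wvel j (zeta t) (w t) (dzeta t))).
  - apply (continuous_ext (fun t => (t + Rabs t) / 2)).
    { intros s; unfold Rmax, Rabs; destruct (Rle_dec 0 s), (Rcase_abs s); lra. }
    apply (continuous_mult (K := R_AbsRing) (fun t => t + Rabs t)); [|apply continuous_const].
    apply (continuous_plus (fun t : R => t)); [apply continuous_id|apply continuous_Rabs].
  - apply continuous_wvel; [exact H|]; split; [apply Rmax_l|apply Rmax_lub_lt; lra].
Qed.

Lemma is_derive_lift_coord (zeta dzeta w : R -> C) j t : continuation_path zeta dzeta w -> t < 1 ->
  is_derive (lift_coord j zeta dzeta w) t (clamped_velocity j zeta dzeta w t).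
Proof.
  intros H Ht; unfold lift_coord.
  apply (is_derive_RInt (clamped_velocity j zeta dzeta w)
           (fun t => RInt (clamped_velocity j zeta dzeta w) 0 t) 0 t).
  - generalize (open_lt 1 t Ht); apply filter_imp; intros y Hy.
    apply (@RInt_correct R_CompleteNormedModule), (@ex_RInt_continuous R_CompleteNormedModule).
    intros z Hz; apply continuous_clamped; [exact H|].
    pose proof (Rmax_lub_lt 0 y 1 ltac:(lra) Hy); lra.
  - now apply continuous_clamped.
Qed.

Lemma is_derive_placed_coord (zeta dzeta w : R -> C) j t : continuation_path zeta dzeta w -> t < 1 ->
  is_derive (placed_coord j zeta dzeta w) t (2 / K34 * clamped_velocity j zeta dzeta w t).
Proof.
  intros H Ht; unfold placed_coord.
  apply (is_derive_eq _ _ (0 + 2 / K34 * clamped_velocity j zeta dzeta w t)); [|ring].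
  apply (is_derive_plus (fun _ => base j)); [apply (is_derive_const (base j))|].
  apply (is_derive_scal (lift_coord j zeta dzeta w)), is_derive_lift_coord; assumption.
Qed.

(** [continuation_path] asks only for continuity of w; its derivative is recovered from the equation
    of the curve by [complex_sqrt_derive]. *)
Lemma path_w_derive (zeta dzeta w : R -> C) t : continuation_path zeta dzeta w -> 0 < t < 1 ->
  let a t := fst (zeta t) in let b t := snd (zeta t) in
  let u t := fst (w t) in let v t := snd (w t) in
  let p := quotRe (dzeta t) (w t) in let q := quotIm (dzeta t) (w t) in
  is_derive a t (u t * p - v t * q) /\ is_derive b t (u t * q + v t * p) /\
  is_derive u t (doctRe (a t) (b t) * p - doctIm (a t) (b t) * q) /\
  is_derive v t (doctRe (a t) (b t) * q + doctIm (a t) (b t) * p) /\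
  on_curve (a t) (b t) (u t) (v t).
Proof.
  intros H Ht a b u v p q; assert (H' := H); destruct H' as (_ & _ & Hp).
  destruct (Hp t ltac:(lra)) as (Hz & _ & Hw & Hc & Hn).
  apply is_derive_pair in Hz; destruct Hz as [Ha Hb].
  apply on_curve_iff in Hc.
  destruct (quot_mul (dzeta t) (w t) Hn) as [E1 E2]; rewrite E1 in Ha; rewrite E2 in Hb.
  fold p q in Ha, Hb.
  pose proof (C_norm2_pos _ Hn) as Hpos.
  assert (Da : Derive (fun x : R => a x) t = u t * p - v t * q) by exact (is_derive_unique _ _ _ Ha).
  assert (Db : Derive (fun x : R => b x) t = u t * q + v t * p) by exact (is_derive_unique _ _ _ Hb).
  assert (HA : is_derive (fun t => octRe (a t) (b t)) t
    (2 * (doctRe (a t) (b t) * (u t * p - v t * q) - doctIm (a t) (b t) * (u t * q + v t * p)))).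
  { unfold octRe, doctRe, doctIm; auto_derive; [repeat split; eexists; eassumption|].
    rewrite Da, Db; ring. }
  assert (HB : is_derive (fun t => octIm (a t) (b t)) t
    (doctRe (a t) (b t) * (u t * q + v t * p) + doctIm (a t) (b t) * (u t * p - v t * q))).
  { unfold octIm, doctRe, doctIm; auto_derive; [repeat split; eexists; eassumption|].
    rewrite Da, Db; ring. }
  assert (Hloc : locally t (fun y => u y * u y = v y * v y + octRe (a y) (b y) /\
                                     u y * v y = octIm (a y) (b y))).
  { assert (Hopen : locally t (fun y => 0 < y < 1)).
    { apply (open_and (fun y => 0 < y) (fun y => y < 1)); [apply open_gt|apply open_lt|exact Ht]. }
    revert Hopen; apply filter_imp; intros y Hy.
    destruct (Hp y ltac:(lra)) as (_ & _ & _ & Hcy & _); apply on_curve_iff; exact Hcy. }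
  destruct (complex_sqrt_derive _ _ u v t _ _ HA HB (continuous_fst_comp w t Hw)
              (continuous_snd_comp w t Hw) Hloc Hpos) as [Hu Hv].
  split; [exact Ha|split; [exact Hb|split; [|split; [|exact Hc]]]].
  - apply (is_derive_eq _ _ _ _ Hu); fold (u t) (v t) in Hpos; field; lra.
  - apply (is_derive_eq _ _ _ _ Hv); fold (u t) (v t) in Hpos; field; lra.
Qed.

Lemma lift_on_curve (zeta dzeta w : R -> C) j t : continuation_path zeta dzeta w -> 0 <= t < 1 ->
  tc (placed_coord j zeta dzeta w t) = tW j (fst (zeta t)) (snd (zeta t)) (fst (w t)) (snd (w t)) /\
  nc (placed_coord j zeta dzeta w t) = nW j (fst (zeta t)) (snd (zeta t)) (fst (w t)) (snd (w t)).
Proof.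
  intros H Ht; pose proof K34_pos as HK.
  assert (H' := H); destruct H' as (Hz0 & Hw0 & _).
  set (rate := clamped_velocity j zeta dzeta w); set (x := placed_coord j zeta dzeta w).
  assert (Hx : forall s, s < 1 -> is_derive x s (2 / K34 * rate s))
    by (intros; apply is_derive_placed_coord; assumption).
  assert (Htc : forall s, s < 1 -> is_derive (fun s => tc (x s)) s
            (2 * (1 + tc (x s) ^ 2) * nc (x s) * rate s)).
  { intros s Hs; eapply is_derive_eq.
    - apply (is_derive_comp tc x); [apply is_derive_tc|now apply Hx].
    - unfold scal; simpl; unfold mult; simpl; field; lra. }
  assert (Hnc : forall s, s < 1 -> is_derive (fun s => nc (x s)) s
            (- 2 * (1 + nc (x s) ^ 2) * tc (x s) * rate s)).
  { intros s Hs; eapply is_derive_eq.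
    - apply (is_derive_comp nc x); [apply is_derive_nc|now apply Hx].
    - unfold scal; simpl; unfold mult; simpl; field; lra. }
  (* The rate may be unbounded on [0, 1), but it is bounded on [0, t], which is all that uniqueness
     up to time t needs. *)
  destruct (continuity_ab_maj (fun s => Rabs (rate s)) 0 t ltac:(lra)) as [m [HM _]].
  { intros s Hs; apply continuity_pt_filterlim.
    apply (continuous_comp rate Rabs); [apply continuous_clamped; [exact H|lra]|].
    apply continuous_Rabs. }
  assert (Hx0 : x 0 = base j).
  { unfold x, placed_coord, lift_coord; rewrite RInt_point; unfold zero; simpl; ring. }
  destruct (nW_tW_start j) as [S1 S2].
  apply (curve_ode_unique (fun s => tc (x s)) (fun s => nc (x s))
    (fun t => tW j (fst (zeta t)) (snd (zeta t)) (fst (w t)) (snd (w t)))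
    (fun t => nW j (fst (zeta t)) (snd (zeta t)) (fst (w t)) (snd (w t))) rate t (Rabs (rate m))).
  - lra.
  - intros s Hs; split; eapply continuous_is_derive; [apply Htc|apply Hnc]; lra.
  - intros s Hs; destruct (path_continuous _ _ _ s H ltac:(lra)) as (C1 & _ & C2 & _).
    apply continuous_W_data; auto using continuous_fst_comp, continuous_snd_comp.
  - intros s Hs; split; [apply Htc|apply Hnc]; lra.
  - intros s Hs; destruct (path_w_derive _ _ _ s H ltac:(lra)) as (Ha & Hb & Hu & Hv & Hc).
    apply (weierstrass_ode j (fun s => fst (zeta s)) (fun s => snd (zeta s)) (fun s => fst (w s))
      (fun s => snd (w s)) rate s (quotRe (dzeta s) (w s)) (quotIm (dzeta s) (w s))); auto.
    unfold rate, clamped_velocity; rewrite Rmax_right by lra; apply wvel_wrate.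
  - intros s Hs; apply HM; lra.
  - rewrite Hx0; apply tc_nc_curve.
  - rewrite Hx0, Hz0, Hw0; exact S1.
  - rewrite Hx0, Hz0, Hw0; exact S2.
Qed.

(** The sum of the values of [lv] has derivative twice the dot product of n with the Weierstrass
    velocity. This vanishes because n is normal to the surface, and the base point has sum 0. *)
Lemma lift_levelset (zeta dzeta w : R -> C) t : continuation_path zeta dzeta w -> 0 <= t < 1 ->
  levelset (placed_coord axis1 zeta dzeta w t, placed_coord axis2 zeta dzeta w t,
            placed_coord axis3 zeta dzeta w t).
Proof.
  intros H Ht; pose proof K34_pos as HK; simpl.
  set (x := fun j => placed_coord j zeta dzeta w).
  assert (Hlv : forall j s, s < 1 -> is_derive (fun s => lv (x j s)) s
            (2 * nc (x j s) * clamped_velocity j zeta dzeta w s)).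
  { intros j s Hs; eapply is_derive_eq.
    - apply (is_derive_comp lv (x j)); [apply is_derive_lv|].
      apply is_derive_placed_coord; assumption.
    - unfold scal; simpl; unfold mult; simpl; field; lra. }
  assert (E0 : forall j, x j 0 = base j).
  { intros j; unfold x, placed_coord, lift_coord; rewrite RInt_point; unfold zero; simpl; ring. }
  change (lv (x axis1 t) + lv (x axis2 t) + lv (x axis3 t) = 0).
  transitivity (lv (x axis1 0) + lv (x axis2 0) + lv (x axis3 0)).
  - apply (is_derive_zero_on (fun t => lv (x axis1 t) + lv (x axis2 t) + lv (x axis3 t))); [lra| |].
    + intros s Hs.
      apply (continuous_plus (fun t => lv (x axis1 t) + lv (x axis2 t)));
        [apply (continuous_plus (fun t => lv (x axis1 t)))|];
        eapply continuous_is_derive; apply Hlv; lra.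
    + intros s Hs; eapply is_derive_eq.
      * apply (is_derive_plus (fun t => lv (x axis1 t) + lv (x axis2 t)));
          [apply (is_derive_plus (fun t => lv (x axis1 t)))|]; apply Hlv; lra.
      * transitivity (2 * nc (x axis1 s) * clamped_velocity axis1 zeta dzeta w s
          + 2 * nc (x axis2 s) * clamped_velocity axis2 zeta dzeta w s
          + 2 * nc (x axis3 s) * clamped_velocity axis3 zeta dzeta w s); [reflexivity|unfold x].
        rewrite !(proj2 (lift_on_curve zeta dzeta w _ s H ltac:(lra))).
        unfold clamped_velocity; rewrite Rmax_right by lra; rewrite !wvel_wrate.
        pose proof (nW_wrate_orthogonal (fst (zeta s)) (snd (zeta s)) (fst (w s)) (snd (w s))
          (quotRe (dzeta s) (w s)) (quotIm (dzeta s) (w s))); lra.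
  - rewrite !E0; simpl; rewrite lv_1, lv_0, lv_half; ring.
Qed.

(** The similarity that takes the Weierstrass surface to the level set; it sends the starting point
    of all lifts to (1, 0, 1/2). *)
Definition place (q : E3) : E3 :=
  let '(x, y, z) := q in (1 + 2 / K34 * x, 0 + 2 / K34 * y, 1 / 2 + 2 / K34 * z).

Lemma continuous_lv t : continuous lv t.
Proof. eapply continuous_is_derive, is_derive_lv. Qed.

(** A point of the completed surface is a limit of lifted points, and the level set is closed. *)
Lemma weierstrass_levelset q : weierstrass_surface q -> levelset (place q).
Proof.
  intros (zeta & dzeta & w & H & _ & Hlim); destruct q as [[x y] z].
  set (F := fun p : E3 => lv (1 + 2 / K34 * fst (fst p)) + lv (0 + 2 / K34 * snd (fst p))
                 + lv (1 / 2 + 2 / K34 * snd p)).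
  assert (HF : continuous F (x, y, z)).
  { assert (G : forall (c : R) (f : E3 -> R), continuous f (x, y, z) ->
              continuous (fun p => lv (c + 2 / K34 * f p)) (x, y, z)).
    { intros c f Hf; apply (continuous_comp (fun p => c + 2 / K34 * f p) lv); [|apply continuous_lv].
      apply (continuous_comp f (fun r => c + 2 / K34 * r)); [exact Hf|].
      apply (ex_derive_continuous (V := R_NormedModule)); auto_derive; exact I. }
    apply (continuous_plus (fun p : E3 => lv (1 + 2 / K34 * fst (fst p)) + lv (0 + 2 / K34 * snd (fst p)))
       (fun p : E3 => lv (1 / 2 + 2 / K34 * snd p))).
    - apply (continuous_plus (fun p : E3 => lv (1 + 2 / K34 * fst (fst p)))
        (fun p : E3 => lv (0 + 2 / K34 * snd (fst p)))).
      + apply (G 1 (fun p => fst (fst p))), (continuous_comp (fst : E3 -> R * R) fst);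
          apply continuous_fst.
      + apply (G 0 (fun p => snd (fst p))), (continuous_comp (fst : E3 -> R * R) snd);
          [apply continuous_fst|apply continuous_snd].
    - apply (G (1 / 2) (fun p => snd p)), continuous_snd. }
  assert (L1 : filterlim (fun t => F (lift zeta dzeta w t)) (at_left 1) (locally (F (x, y, z))))
    by (eapply filterlim_comp; [exact Hlim|exact HF]).
  assert (L0 : filterlim (fun t => F (lift zeta dzeta w t)) (at_left 1) (locally 0)).
  { apply (filterlim_ext_loc (fun _ => 0)); [|apply filterlim_const].
    assert (Hopen : locally 1 (fun y => 0 < y)) by (apply open_gt; lra).
    revert Hopen; unfold at_left, within; apply filter_imp; intros t Ht0 Ht1.
    rewrite lift_coords by lra; unfold F; simpl; symmetry.
    exact (lift_levelset zeta dzeta w t H ltac:(lra)). }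
  pose proof (filterlim_locally_unique _ _ _ L1 L0) as E; exact E.
Qed.

(** * Inverting the parametrization *)

(** [sqRe] and [sqIm] are the real and imaginary parts of phi_j^2. *)
Definition sqRe (j : axis) (a b : R) : R :=
  let c := a * a - b * b in let d := 2 * a * b in
  match j with
  | axis1 => (1 - c) * (1 - c) - d * d
  | axis2 => - ((1 + c) * (1 + c) - d * d)
  | axis3 => 4 * c
  end.
Definition sqIm (j : axis) (a b : R) : R :=
  let c := a * a - b * b in let d := 2 * a * b in
  match j with
  | axis1 => - (2 * (1 - c) * d)
  | axis2 => - (2 * (1 + c) * d)
  | axis3 => 4 * d
  end.

(** The matrix Re (phi_j^2 conj phi_k^2) in terms of g_i = N_i^2 and s2 = s^2, with N = [gaussN] and
    s = |N| = 1 + |zeta|^2. Here phi_j conj phi_k is s^2 - N_j^2 for j = k, and otherwise -N_j N_k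
    plus or minus i s N_l with l the third axis. *)
Definition gram (j k : axis) (g1 g2 g3 s2 : R) : R :=
  match j, k with
  | axis1, axis1 => (s2 - g1) * (s2 - g1)
  | axis2, axis2 => (s2 - g2) * (s2 - g2)
  | axis3, axis3 => (s2 - g3) * (s2 - g3)
  | axis1, axis2 | axis2, axis1 => g1 * g2 - g3 * s2
  | axis1, axis3 | axis3, axis1 => g1 * g3 - g2 * s2
  | axis2, axis3 | axis3, axis2 => g2 * g3 - g1 * s2
  end.

Lemma hopf_gram j k a b :
  hopf j a b (sqRe k a b) (sqIm k a b) =
  gram j k (gaussN axis1 a b * gaussN axis1 a b) (gaussN axis2 a b * gaussN axis2 a b)
    (gaussN axis3 a b * gaussN axis3 a b) ((1 + (a * a + b * b)) * (1 + (a * a + b * b))).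
Proof. destruct j, k; unfold hopf, sqRe, sqIm, gram, gaussN; ring. Qed.

Lemma hopf_linear j a b u1 v1 u2 v2 u3 v3 x1 x2 x3 :
  hopf j a b (x1 * u1 + x2 * u2 + x3 * u3) (x1 * v1 + x2 * v2 + x3 * v3) =
  x1 * hopf j a b u1 v1 + x2 * hopf j a b u2 v2 + x3 * hopf j a b u3 v3.
Proof. destruct j; unfold hopf; ring. Qed.

(* [sum_k phi_k^2 Re (phi_k^2 conj w) = w D + conj w (1 + 14 zeta^4 + zeta^8)], where
   [D + |w|^2] is [weight]. *)
Lemma hopf_sum a b u v :
  sqRe axis1 a b * hopf axis1 a b u v + sqRe axis2 a b * hopf axis2 a b u v
    + sqRe axis3 a b * hopf axis3 a b u v
  = u * (weight a b u v - (u * u + v * v)) + (u * octRe a b + 2 * v * octIm a b) /\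
  sqIm axis1 a b * hopf axis1 a b u v + sqIm axis2 a b * hopf axis2 a b u v
    + sqIm axis3 a b * hopf axis3 a b u v
  = v * (weight a b u v - (u * u + v * v)) + (2 * u * octIm a b - v * octRe a b).
Proof. unfold hopf, sqRe, sqIm, weight, octRe, octIm; split; ring. Qed.

Lemma weight_gauss a b u v :
  let g1 := gaussN axis1 a b * gaussN axis1 a b in
  let g2 := gaussN axis2 a b * gaussN axis2 a b in
  let g3 := gaussN axis3 a b * gaussN axis3 a b in
  weight a b u v = (1 + (a * a + b * b)) ^ 4 - (g1 * g2 + g1 * g3 + g2 * g3) + (u * u + v * v).
Proof. unfold weight, gaussN; cbv zeta; ring. Qed.

Lemma norm2_hopf a b u v y1 y2 y3 :
  u = y1 * sqRe axis1 a b + y2 * sqRe axis2 a b + y3 * sqRe axis3 a b ->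
  v = y1 * sqIm axis1 a b + y2 * sqIm axis2 a b + y3 * sqIm axis3 a b ->
  u * u + v * v = y1 * hopf axis1 a b u v + y2 * hopf axis2 a b u v + y3 * hopf axis3 a b u v.
Proof.
  intros Hu Hv; rewrite Hu at 1; rewrite Hv at 1; unfold hopf, sqRe, sqIm; ring.
Qed.

(** By [hopf_sum] the two equations reduce to w |w|^2 = conj w (1 + 14 zeta^4 + zeta^8). Multiplying
    by w and cancelling |w|^2 gives the curve. *)
Lemma on_curve_of_hopf_sum a b u v :
  0 < u * u + v * v ->
  u * weight a b u v = sqRe axis1 a b * hopf axis1 a b u v + sqRe axis2 a b * hopf axis2 a b u v
    + sqRe axis3 a b * hopf axis3 a b u v ->
  v * weight a b u v = sqIm axis1 a b * hopf axis1 a b u v + sqIm axis2 a b * hopf axis2 a b u v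
    + sqIm axis3 a b * hopf axis3 a b u v ->
  on_curve a b u v.
Proof.
  intros Hp Hu Hv; destruct (hopf_sum a b u v) as [E1 E2].
  rewrite <- Hu in E1; rewrite <- Hv in E2.
  assert (F1 : u * (u * u + v * v) = u * octRe a b + 2 * v * octIm a b) by lra.
  assert (F2 : v * (u * u + v * v) = 2 * u * octIm a b - v * octRe a b) by lra.
  split; apply (Rmult_eq_reg_r (u * u + v * v)); try lra.
  - replace (u * u * (u * u + v * v)) with (u * (u * (u * u + v * v))) by ring.
    replace ((v * v + octRe a b) * (u * u + v * v))
      with (v * (v * (u * u + v * v)) + octRe a b * (u * u + v * v)) by ring.
    rewrite F1, F2; ring.
  - apply (Rmult_eq_reg_l 2); [|lra].
    replace (2 * (u * v * (u * u + v * v)))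
      with (v * (u * (u * u + v * v)) + u * (v * (u * u + v * v))) by ring.
    rewrite F1, F2; ring.
Qed.

Lemma tan_sum_denominator T1 T2 T3 : T1 + T2 + T3 = T1 * T2 * T3 -> 1 - T1 * T2 <> 0.
Proof.
  intros E H; assert (T1 * T2 = 1) by lra.
  assert (T1 + T2 = 0) by (rewrite H0 in E; lra).
  replace T2 with (- T1) in H0 by lra; nra.
Qed.

Lemma one_plus_sqr_neq0 T : 1 + T ^ 2 <> 0.
Proof. nra. Qed.

(** Makes every quantity on the level set rational in [T1] and [T2], so that the next two identities
    become free of side relations. *)
Lemma tan_sum_solve T1 T2 T3 m1 m2 m3 :
  T1 + T2 + T3 = T1 * T2 * T3 ->
  (1 + T1 ^ 2) * (1 + m1) = 4 -> (1 + T2 ^ 2) * (1 + m2) = 4 -> (1 + T3 ^ 2) * (1 + m3) = 4 ->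
  T3 = - (T1 + T2) / (1 - T1 * T2) /\
  m1 = 4 / (1 + T1 ^ 2) - 1 /\ m2 = 4 / (1 + T2 ^ 2) - 1 /\
  m3 = 4 * (1 - T1 * T2) ^ 2 / ((1 + T1 ^ 2) * (1 + T2 ^ 2)) - 1.
Proof.
  intros E E1 E2 E3; pose proof (tan_sum_denominator _ _ _ E) as Hd.
  pose proof one_plus_sqr_neq0 as P.
  assert (F : forall T m, (1 + T ^ 2) * (1 + m) = 4 -> m = 4 / (1 + T ^ 2) - 1).
  { intros T m <-; field; apply P. }
  assert (FT : T3 = - (T1 + T2) / (1 - T1 * T2)).
  { replace (- (T1 + T2)) with (T3 * (1 - T1 * T2)) by lra; field; exact Hd. }
  repeat split; auto.
  rewrite (F T3 m3 E3), FT; field; repeat split; auto.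
  replace ((1 - T1 * T2) ^ 2 + (- (T1 + T2)) ^ 2) with ((1 + T1 ^ 2) * (1 + T2 ^ 2)) by ring.
  apply Rmult_integral_contrapositive_currified; apply P.
Qed.

(* Here [T_k = tan alpha_k], [m_k = n_k^2] and [q = |n|^2]; the relation between the [T_k]
   is [alpha_1 + alpha_2 + alpha_3 = 0]. *)
Lemma gram_eigen T1 T2 T3 m1 m2 m3 :
  T1 + T2 + T3 = T1 * T2 * T3 ->
  (1 + T1 ^ 2) * (1 + m1) = 4 -> (1 + T2 ^ 2) * (1 + m2) = 4 -> (1 + T3 ^ 2) * (1 + m3) = 4 ->
  let q := m1 + m2 + m3 in
  gram axis1 axis1 m1 m2 m3 q * (T1 * (q + m1)) + gram axis1 axis2 m1 m2 m3 q * (T2 * (q + m2))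
    + gram axis1 axis3 m1 m2 m3 q * (T3 * (q + m3)) = 6 * q * (T1 * (q + m1)).
Proof.
  intros E E1 E2 E3 q; pose proof (tan_sum_denominator _ _ _ E) as Hd.
  pose proof one_plus_sqr_neq0 as P.
  destruct (tan_sum_solve _ _ _ _ _ _ E E1 E2 E3) as (-> & -> & -> & F3).
  unfold q, gram; rewrite F3; field; auto.
Qed.

(** The length of the eigenvector of [gram_eigen] determines |w|^2 and thereby makes [weight] a
    perfect square up to the factor 6. *)
Lemma gram_norm T1 T2 T3 m1 m2 m3 :
  T1 + T2 + T3 = T1 * T2 * T3 ->
  (1 + T1 ^ 2) * (1 + m1) = 4 -> (1 + T2 ^ 2) * (1 + m2) = 4 -> (1 + T3 ^ 2) * (1 + m3) = 4 ->
  let q := m1 + m2 + m3 in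
  (T1 * (q + m1)) ^ 2 + (T2 * (q + m2)) ^ 2 + (T3 * (q + m3)) ^ 2
  = 6 * (6 * q - q ^ 2 + (m1 * m2 + m1 * m3 + m2 * m3)).
Proof.
  intros E E1 E2 E3 q; pose proof (tan_sum_denominator _ _ _ E) as Hd.
  pose proof one_plus_sqr_neq0 as P.
  destruct (tan_sum_solve _ _ _ _ _ _ E E1 E2 E3) as (-> & -> & -> & F3).
  unfold q; rewrite F3; field; auto.
Qed.

(* The inverse of [(zeta, w) |-> (tW, nW)]. *)
Definition vlen (n1 n2 n3 : R) : R := sqrt (n1 ^ 2 + n2 ^ 2 + n3 ^ 2).
Definition invRe (n1 n2 n3 : R) : R := n1 / (vlen n1 n2 n3 - n3).
Definition invIm (n1 n2 n3 : R) : R := n2 / (vlen n1 n2 n3 - n3).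
(** From w = sum_k phi_k^2 Re (phi_k^2 conj w) / [weight]: the definition of [tW] expresses Re
    (phi_k^2 conj w) by T_k, and with s = 1 + |zeta|^2 one has [hden] = s^2 (1 + n_k^2 / l^2) and
    sqrt [weight] = sqrt 6 s^2 / l. All powers of s cancel. *)
Definition inv_coef (T n l : R) : R := - (l / 6) * (T * (1 + n ^ 2 / l ^ 2)).
Definition inv_w (part : axis -> R -> R -> R) (T1 T2 T3 n1 n2 n3 : R) : R :=
  let l := vlen n1 n2 n3 in let a := invRe n1 n2 n3 in let b := invIm n1 n2 n3 in
  inv_coef T1 n1 l * part axis1 a b + inv_coef T2 n2 l * part axis2 a b
  + inv_coef T3 n3 l * part axis3 a b.

(** The hypothesis excludes n = 0 and the direction (0, 0, 1), which stereographic projection sends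
    to infinity. *)
Lemma vlen_gt n1 n2 n3 : (n1 = 0 -> n2 = 0 -> n3 < 0) ->
  0 < vlen n1 n2 n3 /\ 0 < vlen n1 n2 n3 - n3.
Proof.
  intros H; unfold vlen.
  assert (Hp : 0 < n1 ^ 2 + n2 ^ 2 + n3 ^ 2).
  { destruct (Req_dec n1 0) as [ -> |]; [|nra]; destruct (Req_dec n2 0) as [ -> |]; [|nra].
    specialize (H eq_refl eq_refl); nra. }
  pose proof (sqrt_lt_R0 _ Hp) as Hs; split; [exact Hs|].
  pose proof (sqrt_sqrt _ (Rlt_le _ _ Hp)) as Hq.
  destruct (Rlt_le_dec n3 (sqrt (n1 ^ 2 + n2 ^ 2 + n3 ^ 2))) as [L|L]; [lra|exfalso].
  assert (n1 ^ 2 + n2 ^ 2 <= 0) by nra.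
  assert (n1 = 0) by nra. assert (n2 = 0) by nra. specialize (H H1 H2); lra.
Qed.

(** The Gram matrix of the phi_k^2 depends on n alone, and by [gram_eigen] the coefficients of w
    form an eigenvector of it. So each Re (phi_j^2 conj w) is proportional to its own coefficient,
    which yields T_j; [gram_norm] supplies [weight], and the eigenvector relation itself is the
    hypothesis of [on_curve_of_hopf_sum]. If all T_j vanish then w = 0: these are the flat
    points. *)
Lemma inverse_correct T1 T2 T3 n1 n2 n3 :
  T1 + T2 + T3 = T1 * T2 * T3 ->
  (1 + T1 ^ 2) * (1 + n1 ^ 2) = 4 -> (1 + T2 ^ 2) * (1 + n2 ^ 2) = 4 ->
  (1 + T3 ^ 2) * (1 + n3 ^ 2) = 4 ->
  (n1 = 0 -> n2 = 0 -> n3 < 0) ->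
  let a := invRe n1 n2 n3 in let b := invIm n1 n2 n3 in
  let u := inv_w sqRe T1 T2 T3 n1 n2 n3 in let v := inv_w sqIm T1 T2 T3 n1 n2 n3 in
  (nW axis1 a b u v = n1 /\ nW axis2 a b u v = n2 /\ nW axis3 a b u v = n3) /\
  (tW axis1 a b u v = T1 /\ tW axis2 a b u v = T2 /\ tW axis3 a b u v = T3) /\
  (T1 <> 0 \/ T2 <> 0 \/ T3 <> 0 -> 0 < u * u + v * v /\ on_curve a b u v).
Proof.
  intros E E1 E2 E3 Hn.
  destruct (vlen_gt _ _ _ Hn) as [Hl Hln]; set (l := vlen n1 n2 n3) in *.
  intros a b u v.
  assert (Hq : l ^ 2 = n1 ^ 2 + n2 ^ 2 + n3 ^ 2).
  { unfold l, vlen; rewrite pow2_sqrt; [reflexivity|nra]. }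
  set (s := 1 + (a * a + b * b)).
  assert (Hs : s = 2 * l / (l - n3)).
  { unfold s, a, b, invRe, invIm; fold l.
    replace (1 + (n1 / (l - n3) * (n1 / (l - n3)) + n2 / (l - n3) * (n2 / (l - n3))))
      with (((l - n3) ^ 2 + (n1 ^ 2 + n2 ^ 2)) / (l - n3) ^ 2) by (field; lra).
    replace (n1 ^ 2 + n2 ^ 2) with (l ^ 2 - n3 ^ 2) by lra; field; lra. }
  assert (Hsp : 0 < s) by (rewrite Hs; apply Rdiv_lt_0_compat; lra).
  assert (G1 : gaussN axis1 a b = n1 * (s / l))
    by (rewrite Hs; unfold gaussN, a, invRe; fold l; field; lra).
  assert (G2 : gaussN axis2 a b = n2 * (s / l))
    by (rewrite Hs; unfold gaussN, b, invIm; fold l; field; lra).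
  assert (G3 : gaussN axis3 a b = n3 * (s / l)).
  { unfold gaussN; replace (a * a + b * b - 1) with (s - 2) by (unfold s; ring).
    rewrite Hs; field; lra. }
  set (q := n1 ^ 2 + n2 ^ 2 + n3 ^ 2) in *.
  assert (Gg : forall j k, hopf j a b (sqRe k a b) (sqIm k a b)
            = (s / l) ^ 4 * gram j k (n1 ^ 2) (n2 ^ 2) (n3 ^ 2) q).
  { intros j k; rewrite hopf_gram, G1, G2, G3; fold s; rewrite <- Hq.
    destruct j, k; unfold gram; field; lra. }
  assert (Hc : forall T n, inv_coef T n l = - / (6 * l) * (T * (q + n ^ 2))).
  { intros T n; unfold inv_coef; rewrite <- Hq; field; lra. }
  set (y1 := inv_coef T1 n1 l) in *; set (y2 := inv_coef T2 n2 l) in *.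
  set (y3 := inv_coef T3 n3 l) in *.
  assert (Eu : u = y1 * sqRe axis1 a b + y2 * sqRe axis2 a b + y3 * sqRe axis3 a b) by reflexivity.
  assert (Ev : v = y1 * sqIm axis1 a b + y2 * sqIm axis2 a b + y3 * sqIm axis3 a b) by reflexivity.
  assert (K : forall T n j, hopf j a b u v = - (s / l) ^ 4 * (T * (q + n ^ 2)) * (q / l) ->
     hopf j a b u v = 6 * (s / l) ^ 4 * q * inv_coef T n l).
  { intros T n j ->; rewrite Hc; field; lra. }
  assert (H1 : hopf axis1 a b u v = 6 * (s / l) ^ 4 * q * y1).
  { pose proof (gram_eigen _ _ _ _ _ _ E E1 E2 E3) as P; cbv zeta in P; fold q in P.
    apply K; rewrite Eu, Ev, hopf_linear, !Gg.
    unfold y1, y2, y3; rewrite !Hc.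
    transitivity (- / (6 * l) * (s / l) ^ 4 * (6 * q * (T1 * (q + n1 ^ 2))));
      [rewrite <- P; ring|field; lra]. }
  assert (H2 : hopf axis2 a b u v = 6 * (s / l) ^ 4 * q * y2).
  (* [gram_eigen] is stated for the first row; renaming the axes gives the two others. *)
  { assert (E' : T2 + T1 + T3 = T2 * T1 * T3) by lra.
    pose proof (gram_eigen _ _ _ _ _ _ E' E2 E1 E3) as P; cbv zeta in P.
    replace (n2 ^ 2 + n1 ^ 2 + n3 ^ 2) with q in P by (unfold q; ring).
    apply K; rewrite Eu, Ev, hopf_linear, !Gg.
    unfold y1, y2, y3; rewrite !Hc.
    transitivity (- / (6 * l) * (s / l) ^ 4 * (6 * q * (T2 * (q + n2 ^ 2))));
      [rewrite <- P; unfold gram; ring|field; lra]. }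
  assert (H3 : hopf axis3 a b u v = 6 * (s / l) ^ 4 * q * y3).
  { assert (E' : T3 + T2 + T1 = T3 * T2 * T1) by lra.
    pose proof (gram_eigen _ _ _ _ _ _ E' E3 E2 E1) as P; cbv zeta in P.
    replace (n3 ^ 2 + n2 ^ 2 + n1 ^ 2) with q in P by (unfold q; ring).
    apply K; rewrite Eu, Ev, hopf_linear, !Gg.
    unfold y1, y2, y3; rewrite !Hc.
    transitivity (- / (6 * l) * (s / l) ^ 4 * (6 * q * (T3 * (q + n3 ^ 2))));
      [rewrite <- P; unfold gram; ring|field; lra]. }
  assert (Huv : u * u + v * v = 6 * (s / l) ^ 4 * q * (y1 ^ 2 + y2 ^ 2 + y3 ^ 2)).
  { rewrite (norm2_hopf _ _ _ _ _ _ _ Eu Ev), H1, H2, H3; ring. }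
  assert (HW : weight a b u v = 6 * (s ^ 2 / l) ^ 2).
  { pose proof (gram_norm _ _ _ _ _ _ E E1 E2 E3) as P; cbv zeta in P; fold q in P.
    rewrite weight_gauss, Huv, G1, G2, G3; fold s.
    unfold y1, y2, y3; rewrite !Hc.
    match goal with |- ?x = _ => replace x with (s ^ 4
      - (s / l) ^ 4 * (n1 ^ 2 * n2 ^ 2 + n1 ^ 2 * n3 ^ 2 + n2 ^ 2 * n3 ^ 2)
      + (s / l) ^ 4 * q / (6 * l ^ 2) * ((T1 * (q + n1 ^ 2)) ^ 2 + (T2 * (q + n2 ^ 2)) ^ 2
        + (T3 * (q + n3 ^ 2)) ^ 2)) by (field; lra) end.
    rewrite P, <- Hq; field; lra. }
  assert (HsW : sqrt (weight a b u v) = sqrt 6 * (s ^ 2 / l)).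
  { assert (0 <= s ^ 2 / l) by (apply Rdiv_le_0_compat; nra).
    rewrite HW, sqrt_mult by nra; rewrite sqrt_pow2 by assumption; reflexivity. }
  assert (S6 : 0 < sqrt 6) by (apply sqrt_lt_R0; lra).
  assert (HnW : forall j n, gaussN j a b = n * (s / l) -> nW j a b u v = n).
  { intros j n Hg; unfold nW, nnum; rewrite HsW, Hg; fold s; field; repeat split; lra. }
  assert (HtW : forall j T n, gaussN j a b = n * (s / l) ->
    hopf j a b u v = 6 * (s / l) ^ 4 * q * inv_coef T n l -> tW j a b u v = T).
  { intros j T n Hg Hh; unfold tW, hden; rewrite HsW, Hh, Hg, Hc, <- Hq; fold s.
    assert (0 < (s * l) * (s * l)) by (apply Rmult_lt_0_compat; apply Rmult_lt_0_compat; lra).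
    pose proof (Rle_0_sqr (n * s)); unfold Rsqr in *.
    field; repeat split; lra. }
  split; [auto|split].
  { split; [exact (HtW _ _ _ G1 H1)|split; [exact (HtW _ _ _ G2 H2)|exact (HtW _ _ _ G3 H3)]]. }
  intros HT.
  assert (Hq0 : 0 < q) by (rewrite <- Hq; nra).
  assert (Hpos : 0 < u * u + v * v).
  { rewrite Huv; apply Rmult_lt_0_compat.
    - apply Rmult_lt_0_compat; [|exact Hq0].
      apply Rmult_lt_0_compat; [lra|apply pow_lt, Rdiv_lt_0_compat; lra].
    - assert (Z : forall T n, T <> 0 -> 0 < inv_coef T n l ^ 2).
      { intros T n HT0; apply pow2_gt_0; rewrite Hc.
        apply Rmult_integral_contrapositive_currified.
        - apply Ropp_neq_0_compat, Rinv_neq_0_compat; lra.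
        - apply Rmult_integral_contrapositive_currified; [exact HT0|nra]. }
      pose proof (pow2_ge_0 y1); pose proof (pow2_ge_0 y2); pose proof (pow2_ge_0 y3).
      destruct HT as [HT|[HT|HT]];
        [assert (0 < y1 ^ 2) by exact (Z T1 n1 HT)|assert (0 < y2 ^ 2) by exact (Z T2 n2 HT)
        |assert (0 < y3 ^ 2) by exact (Z T3 n3 HT)]; lra. }
  split; [exact Hpos|].
  apply on_curve_of_hopf_sum; [exact Hpos| |]; rewrite HW, H1, H2, H3.
  - rewrite Eu, <- Hq; field; lra.
  - rewrite Ev, <- Hq; field; lra.
Qed.

Lemma levelset_tan x y z : levelset (x, y, z) -> tc x + tc y + tc z = tc x * tc y * tc z.
Proof.
  intros H; pose proof (proj2 (calP_zero (x, y, z)) (or_introl H)) as E; simpl in E.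
  unfold tc; replace (sqrt 3 * calC x * (sqrt 3 * calC y) * (sqrt 3 * calC z))
    with (sqrt 3 * sqrt 3 * sqrt 3 * (calC x * calC y * calC z)) by ring.
  rewrite sqrt3_sqr; replace (3 * sqrt 3 * (calC x * calC y * calC z))
    with (sqrt 3 * (3 * (calC x * calC y * calC z))) by ring.
  replace (3 * (calC x * calC y * calC z)) with (calC x + calC y + calC z) by lra; ring.
Qed.

(* The points over which [zeta] is finite and [sqrt (1 + 14 zeta^4 + zeta^8)] is nonzero. *)
Definition regular_point (x y z : R) : Prop :=
  (nc x = 0 -> nc y = 0 -> nc z < 0) /\ (tc x <> 0 \/ tc y <> 0 \/ tc z <> 0).

(** If d b were nonzero, d^2 would pass through 1 on its way from 0 to at least 4, but 1 and -1 are
    not even. Working with d^2 covers both signs of d b. *)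
Lemma even_valued_zero (d : R -> R) (b : R) :
  0 <= b -> (forall t, 0 <= t <= b -> continuous d t) ->
  (forall t, 0 <= t <= b -> exists k : Z, d t = 2 * IZR k) -> d 0 = 0 -> d b = 0.
Proof.
  intros Hb Hc Hk H0; destruct (Req_dec (d b) 0) as [|Hne]; [assumption|exfalso].
  destruct (Req_dec b 0) as [ -> |Hb0]; [contradiction|].
  destruct (Ranalysis5.IVT_interv (fun t => d t * d t - 1) 0 b) as [c [Hcb Ec]].
  - intros a Ha; apply continuity_pt_filterlim.
    pose proof (Hc a Ha); change (continuous (fun t => d t * d t - 1) a); cont.
  - destruct Hb as [Hb|Hb]; [exact Hb|now contradiction Hb0].
  - rewrite H0; lra.
  - destruct (Hk b ltac:(lra)) as [k Ek]; rewrite Ek in *.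
    assert (1 <= k * k)%Z.
    { assert (k <> 0)%Z by (intros ->; apply Hne; ring). nia. }
    apply IZR_le in H; rewrite mult_IZR in H; lra.
  - destruct (Hk c Hcb) as [k Ek]; rewrite Ek in Ec.
    assert (4 * (k * k) = 1)%Z by (apply eq_IZR; rewrite !mult_IZR; lra). lia.
Qed.

Lemma levelset_inverse x y z : levelset (x, y, z) -> regular_point x y z ->
  let a := invRe (nc x) (nc y) (nc z) in let b := invIm (nc x) (nc y) (nc z) in
  let u := inv_w sqRe (tc x) (tc y) (tc z) (nc x) (nc y) (nc z) in
  let v := inv_w sqIm (tc x) (tc y) (tc z) (nc x) (nc y) (nc z) in
  (nW axis1 a b u v = nc x /\ nW axis2 a b u v = nc y /\ nW axis3 a b u v = nc z) /\
  (tW axis1 a b u v = tc x /\ tW axis2 a b u v = tc y /\ tW axis3 a b u v = tc z) /\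
  0 < u * u + v * v /\ on_curve a b u v.
Proof.
  intros Hl [Hr1 Hr2].
  destruct (inverse_correct _ _ _ _ _ _ (levelset_tan _ _ _ Hl) (tc_nc_curve x) (tc_nc_curve y)
    (tc_nc_curve z) Hr1) as (H1 & H2 & H3); auto.
Qed.

Lemma inv_w_start :
  invRe (nc 1) (nc 0) (nc (1 / 2)) = 0 /\ invIm (nc 1) (nc 0) (nc (1 / 2)) = 0 /\
  inv_w sqRe (tc 1) (tc 0) (tc (1 / 2)) (nc 1) (nc 0) (nc (1 / 2)) = 1 /\
  inv_w sqIm (tc 1) (tc 0) (tc (1 / 2)) (nc 1) (nc 0) (nc (1 / 2)) = 0.
Proof.
  destruct start_values as (-> & -> & -> & -> & -> & ->).
  pose proof sqrt3_pos as S; pose proof sqrt3_sqr as S2.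
  assert (L : vlen 0 0 (- sqrt 3) = sqrt 3).
  { unfold vlen; replace (0 ^ 2 + 0 ^ 2 + (- sqrt 3) ^ 2) with (sqrt 3 * sqrt 3) by ring.
    apply sqrt_square; lra. }
  assert (Ia : invRe 0 0 (- sqrt 3) = 0) by (unfold invRe; unfold Rdiv; ring).
  assert (Ib : invIm 0 0 (- sqrt 3) = 0) by (unfold invIm; unfold Rdiv; ring).
  unfold inv_w; rewrite Ia, Ib, L; unfold inv_coef, sqRe, sqIm.
  repeat split; try (field; lra).
  transitivity (sqrt 3 * sqrt 3 / 3); [field; lra|rewrite S2; field].
Qed.

(** * Paths in the level set as lifts *)

Definition is_C1 (x dx : R -> R) : Prop := forall t, is_derive x t (dx t) /\ continuous dx t.

Lemma C1_continuous x dx t : is_C1 x dx -> continuous x t.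
Proof. intros H; eapply continuous_is_derive, H. Qed.

Lemma Derive_eq (f : R -> R) t l : is_derive f t l -> Derive (fun x : R => f x) t = l.
Proof. intros H; exact (is_derive_unique _ _ _ H). Qed.

(** Continuity of the derivatives is asked for, so [da] and [db] must be chosen once for all t; the
    quotient rule defines them everywhere, and they are the derivatives wherever zeta is finite. *)
Lemma C1_inverse (n1 n2 n3 d1 d2 d3 : R -> R) :
  is_C1 n1 d1 -> is_C1 n2 d2 -> is_C1 n3 d3 ->
  exists da db : R -> R, forall t, (n1 t = 0 -> n2 t = 0 -> n3 t < 0) ->
    is_derive (fun t => invRe (n1 t) (n2 t) (n3 t)) t (da t) /\ continuous da t /\
    is_derive (fun t => invIm (n1 t) (n2 t) (n3 t)) t (db t) /\ continuous db t.
Proof.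
  intros H1 H2 H3.
  set (l := fun t => vlen (n1 t) (n2 t) (n3 t)).
  set (dl := fun t => (n1 t * d1 t + n2 t * d2 t + n3 t * d3 t) * / l t).
  exists (fun t => (d1 t * (l t - n3 t) - n1 t * (dl t - d3 t)) * / ((l t - n3 t) * (l t - n3 t))),
    (fun t => (d2 t * (l t - n3 t) - n2 t * (dl t - d3 t)) * / ((l t - n3 t) * (l t - n3 t))).
  intros t Ht; destruct (vlen_gt _ _ _ Ht) as [L1 L2]; fold (l t) in L1, L2.
  destruct (H1 t) as [D1 K1], (H2 t) as [D2 K2], (H3 t) as [D3 K3].
  assert (X1 : continuous n1 t) by (eapply C1_continuous; eauto).
  assert (X2 : continuous n2 t) by (eapply C1_continuous; eauto).
  assert (X3 : continuous n3 t) by (eapply C1_continuous; eauto).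
  assert (Hl2 : 0 < n1 t ^ 2 + n2 t ^ 2 + n3 t ^ 2).
  { destruct (Rlt_le_dec 0 (n1 t ^ 2 + n2 t ^ 2 + n3 t ^ 2)) as [|L]; [assumption|].
    unfold l, vlen in L1; rewrite sqrt_neg_0 in L1 by exact L; lra. }
  assert (Dl : is_derive l t (dl t)).
  { unfold l, vlen, dl; eapply is_derive_eq.
    - apply (is_derive_comp sqrt (fun t => n1 t ^ 2 + n2 t ^ 2 + n3 t ^ 2)).
      + apply is_derive_Reals, derivable_pt_lim_sqrt; exact Hl2.
      + auto_derive; [repeat split; eexists; eassumption|].
        rewrite (Derive_eq _ _ _ D1), (Derive_eq _ _ _ D2), (Derive_eq _ _ _ D3); reflexivity.
    - unfold scal; simpl; unfold mult; simpl; unfold l, vlen in *; simpl in *; field; lra. }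
  assert (Xl : continuous l t) by (eapply continuous_is_derive; exact Dl).
  assert (Xi : continuous (fun t => / l t) t).
  { now apply continuous_inv_pos. }
  assert (Xdl : continuous dl t) by (unfold dl; cont).
  assert (Xq : continuous (fun t => / ((l t - n3 t) * (l t - n3 t))) t).
  { apply continuous_inv_pos; [cont|nra]. }
  assert (D : forall n d : R -> R, is_derive n t (d t) ->
    is_derive (fun t => n t / (l t - n3 t)) t
      ((d t * (l t - n3 t) - n t * (dl t - d3 t)) * / ((l t - n3 t) * (l t - n3 t)))).
  { intros n d Hn; eapply is_derive_eq.
    - apply (is_derive_div n (fun t => l t - n3 t)); [exact Hn| |lra].
      apply (is_derive_minus l n3); [exact Dl|exact D3].
    - unfold minus, plus, opp; simpl; field; lra. }
  split; [exact (D n1 d1 D1)|split; [cont|split; [exact (D n2 d2 D2)|cont]]].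
Qed.

Lemma continuous_inv_w part (T1 T2 T3 n1 n2 n3 : R -> R) t :
  (part = sqRe \/ part = sqIm) ->
  continuous T1 t -> continuous T2 t -> continuous T3 t ->
  continuous n1 t -> continuous n2 t -> continuous n3 t ->
  (n1 t = 0 -> n2 t = 0 -> n3 t < 0) ->
  continuous (fun t => inv_w part (T1 t) (T2 t) (T3 t) (n1 t) (n2 t) (n3 t)) t.
Proof.
  intros Hpart C1 C2 C3 C4 C5 C6 Hr; destruct (vlen_gt _ _ _ Hr) as [L1 L2].
  assert (Cl : continuous (fun t => vlen (n1 t) (n2 t) (n3 t)) t).
  { unfold vlen; apply (continuous_comp (fun t => n1 t ^ 2 + n2 t ^ 2 + n3 t ^ 2) sqrt);
      [cont|apply continuous_sqrt]. }
  assert (Cq : continuous (fun t => / (vlen (n1 t) (n2 t) (n3 t) - n3 t)) t).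
  { apply continuous_inv_pos; [cont|exact L2]. }
  assert (Cm : continuous (fun t => / (vlen (n1 t) (n2 t) (n3 t)) ^ 2) t).
  { apply continuous_inv_pos; [cont|now apply pow_lt]. }
  assert (Ca : continuous (fun t => invRe (n1 t) (n2 t) (n3 t)) t) by (unfold invRe, Rdiv; cont).
  assert (Cb : continuous (fun t => invIm (n1 t) (n2 t) (n3 t)) t) by (unfold invIm, Rdiv; cont).
  unfold inv_w, inv_coef, Rdiv; cbv zeta.
  destruct Hpart as [-> | ->]; unfold sqRe, sqIm; cont.
Qed.

(* A [C^1] path in the level set, regular on [0, 1), is the lift of its own Gauss map. *)
Lemma levelset_path_weierstrass (x y z dx dy dz : R -> R) :
  is_C1 x dx -> is_C1 y dy -> is_C1 z dz ->
  x 0 = 1 -> y 0 = 0 -> z 0 = 1 / 2 ->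
  (forall t, levelset (x t, y t, z t)) ->
  (forall t, 0 <= t < 1 -> regular_point (x t) (y t) (z t)) ->
  exists q, weierstrass_surface q /\ place q = (x 1, y 1, z 1).
Proof.
  intros Hx Hy Hz x0 y0 z0 Hlev Hreg; pose proof K34_pos as HK.
  set (X := fun j : axis => match j with axis1 => x | axis2 => y | axis3 => z end).
  set (dX := fun j : axis => match j with axis1 => dx | axis2 => dy | axis3 => dz end).
  assert (HX : forall j, is_C1 (X j) (dX j)) by (intros []; assumption).
  assert (Hn : forall j, is_C1 (fun t => nc (X j t))
            (fun t => (- K34 * (1 + nc (X j t) * nc (X j t)) * tc (X j t)) * dX j t)).
  { intros j t; destruct (HX j t) as [D1 D2].
    assert (Cx : continuous (X j) t) by (eapply C1_continuous; apply HX).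
    assert (Cn : continuous (fun t => nc (X j t)) t).
    { apply (continuous_comp (X j) nc); [exact Cx|eapply continuous_is_derive, is_derive_nc]. }
    assert (Ct : continuous (fun t => tc (X j t)) t).
    { apply (continuous_comp (X j) tc); [exact Cx|eapply continuous_is_derive, is_derive_tc]. }
    split; [|cont].
    eapply is_derive_eq; [apply (is_derive_comp nc (X j)); [apply is_derive_nc|exact D1]|].
    unfold scal; simpl; unfold mult; simpl; ring. }
  destruct (C1_inverse _ _ _ _ _ _ (Hn axis1) (Hn axis2) (Hn axis3)) as (da & db & Hab).
  simpl in Hab.
  set (zeta := fun t => (invRe (nc (x t)) (nc (y t)) (nc (z t)),
                         invIm (nc (x t)) (nc (y t)) (nc (z t))) : C).
  set (dzeta := fun t => (da t, db t) : C).
  set (w := fun t =>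
    (inv_w sqRe (tc (x t)) (tc (y t)) (tc (z t)) (nc (x t)) (nc (y t)) (nc (z t)),
     inv_w sqIm (tc (x t)) (tc (y t)) (tc (z t)) (nc (x t)) (nc (y t)) (nc (z t))) : C).
  assert (Hpair : forall (f g : R -> R) t, continuous f t -> continuous g t ->
            continuous (fun t => (f t, g t) : C) t).
  { intros f g t Hf Hg; apply (continuous_comp_2 f g (fun a b => (a, b) : C) t Hf Hg).
    apply (continuous_ext (fun z : C => z)); [intros s; apply surjective_pairing|].
    apply continuous_id. }
  assert (Hpath : continuation_path zeta dzeta w).
  { destruct inv_w_start as (S1 & S2 & S3 & S4).
    split; [|split].
    - unfold zeta; rewrite x0, y0, z0, S1, S2; reflexivity.
    - unfold w; rewrite x0, y0, z0, S3, S4; reflexivity.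
    - intros t Ht; destruct (Hreg t Ht) as [R1 R2].
      destruct (Hab t R1) as (A1 & A2 & A3 & A4).
      destruct (levelset_inverse _ _ _ (Hlev t) (Hreg t Ht)) as (_ & _ & Hpos & Hcur).
      split; [apply is_derive_pair; split; [exact A1|exact A3]|].
      split; [now apply Hpair|].
      split.
      + assert (Ct : forall j, continuous (fun t => tc (X j t)) t).
        { intros j; apply (continuous_comp (X j) tc); [eapply C1_continuous; apply HX|].
          eapply continuous_is_derive, is_derive_tc. }
        assert (Cn : forall j, continuous (fun t => nc (X j t)) t)
          by (intros j; eapply C1_continuous; apply Hn).
        pose proof (Ct axis1); pose proof (Ct axis2); pose proof (Ct axis3).
        pose proof (Cn axis1); pose proof (Cn axis2); pose proof (Cn axis3).
        apply Hpair; apply continuous_inv_w; auto.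
      + split; [apply on_curve_iff; exact Hcur|].
        intros E; unfold w in E; injection E as E1 E2; rewrite E1, E2 in Hpos; lra. }
  (* Both sides have the same [tc] and [nc], so they differ by an even integer; the difference is
     continuous and starts at 0. *)
  assert (Hlift : forall j t, 0 <= t < 1 -> placed_coord j zeta dzeta w t = X j t).
  { intros j t Ht; apply Rminus_diag_uniq.
    apply (even_valued_zero (fun t => placed_coord j zeta dzeta w t - X j t)); [lra| | |].
    - intros s Hs; apply (continuous_minus (placed_coord j zeta dzeta w)).
      + eapply continuous_is_derive, is_derive_placed_coord; [exact Hpath|lra].
      + eapply C1_continuous; apply HX.
    - intros s Hs; apply tc_nc_inj.
      + rewrite (proj1 (lift_on_curve _ _ _ j s Hpath ltac:(lra))).
        destruct (levelset_inverse _ _ _ (Hlev s) (Hreg s ltac:(lra))) as (_ & (E1 & E2 & E3) & _).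
        destruct j; assumption.
      + rewrite (proj2 (lift_on_curve _ _ _ j s Hpath ltac:(lra))).
        destruct (levelset_inverse _ _ _ (Hlev s) (Hreg s ltac:(lra))) as ((E1 & E2 & E3) & _).
        destruct j; assumption.
    - unfold placed_coord, lift_coord; rewrite RInt_point; unfold zero; simpl.
      destruct j; simpl; lra. }
  assert (Hcoord : forall j t, 0 <= t < 1 ->
            lift_coord j zeta dzeta w t = K34 / 2 * (X j t - base j)).
  { intros j t Ht; rewrite <- (Hlift j t Ht); unfold placed_coord; field; lra. }
  exists (K34 / 2 * (x 1 - 1), K34 / 2 * (y 1 - 0), K34 / 2 * (z 1 - 1 / 2)).
  split; [|simpl; repeat apply f_equal2; field; lra].
  exists zeta, dzeta, w; split; [exact Hpath|split].
  (* The lift moves with K34 / 2 times the velocity of the given path, which is continuous on the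
     whole of [0, 1]. So its length is bounded even if zeta or w degenerates at the end. *)
  - assert (Hvel : forall j t, 0 < t < 1 -> wvel j (zeta t) (w t) (dzeta t) = K34 / 2 * dX j t).
    { intros j t Ht.
      pose proof (is_derive_lift_coord _ _ _ j t Hpath ltac:(lra)) as D1.
      unfold clamped_velocity in D1; rewrite Rmax_right in D1 by lra.
      rewrite <- (is_derive_unique _ _ _ D1).
      apply is_derive_unique, (is_derive_ext_loc (fun t => K34 / 2 * (X j t - base j))).
      - assert (Hopen : locally t (fun y => 0 < y < 1)).
        { apply (open_and (fun y => 0 < y) (fun y => y < 1)); [apply open_gt|apply open_lt|exact Ht]. }
        revert Hopen; apply filter_imp; intros s Hs; symmetry; apply Hcoord; lra.
      - apply (is_derive_scal (fun t => X j t - base j)).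
        apply (is_derive_eq _ _ (dX j t - 0)); [|ring].
        apply (is_derive_minus (X j) (fun _ => base j)); [apply HX|apply (is_derive_const (base j))]. }
    set (g := fun t => sqrt ((K34 / 2 * dx t) ^ 2 + (K34 / 2 * dy t) ^ 2 + (K34 / 2 * dz t) ^ 2)).
    assert (Cg : forall t, continuous g t).
    { intros t; unfold g.
      apply (continuous_comp (fun t => (K34 / 2 * dx t) ^ 2 + (K34 / 2 * dy t) ^ 2 + (K34 / 2 * dz t) ^ 2) sqrt);
        [|apply continuous_sqrt].
      pose proof (proj2 (Hx t)); pose proof (proj2 (Hy t)); pose proof (proj2 (Hz t)).
      cont. }
    destruct (continuity_ab_maj g 0 1 ltac:(lra)) as [m [Hm _]].
    { intros s _; apply continuity_pt_filterlim, Cg. }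
    exists (g m); intros t Ht.
    rewrite (RInt_ext _ g).
    + apply Rle_trans with (RInt (fun _ => g m) 0 t).
      * apply RInt_le; [lra| | |].
        -- apply (@ex_RInt_continuous R_CompleteNormedModule); intros; apply Cg.
        -- apply (@ex_RInt_const R_CompleteNormedModule).
        -- intros s Hs; apply Hm; lra.
      * rewrite RInt_const; unfold scal; simpl; unfold mult; simpl.
        pose proof (sqrt_pos ((K34 / 2 * dx m) ^ 2 + (K34 / 2 * dy m) ^ 2 + (K34 / 2 * dz m) ^ 2)).
        fold (g m) in H; nra.
    + rewrite Rmin_left, Rmax_right by lra; intros s Hs; assert (Hs' : 0 < s < 1) by lra.
      unfold velocity; rewrite norm_E3; unfold g.
      assert (V1 : velocity1 (zeta s) (w s) (dzeta s) = K34 / 2 * dx s)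
        by (apply (Hvel axis1); exact Hs').
      assert (V2 : velocity2 (zeta s) (w s) (dzeta s) = K34 / 2 * dy s)
        by (apply (Hvel axis2); exact Hs').
      assert (V3 : velocity3 (zeta s) (w s) (dzeta s) = K34 / 2 * dz s)
        by (apply (Hvel axis3); exact Hs').
      now rewrite V1, V2, V3.
  - apply (filterlim_ext_loc (fun t => (K34 / 2 * (x t - 1), K34 / 2 * (y t - 0), K34 / 2 * (z t - 1 / 2)))).
    + assert (Hopen : locally 1 (fun y => 0 < y)) by (apply open_gt; lra).
      revert Hopen; unfold at_left, within; apply filter_imp; intros t Ht0 Ht1.
      rewrite lift_coords, !Hcoord by lra; reflexivity.
    + apply (filterlim_filter_le_1 (F := locally (1 : R)));
        [intros Q; apply filter_le_within; apply locally_filter|].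
      assert (Cx := C1_continuous _ _ 1 Hx); assert (Cy := C1_continuous _ _ 1 Hy).
      assert (Cz := C1_continuous _ _ 1 Hz).
      apply (continuous_comp_2 (fun t => (K34 / 2 * (x t - 1), K34 / 2 * (y t - 0)))
        (fun t => K34 / 2 * (z t - 1 / 2)) (fun a b => (a, b) : E3)).
      * apply (Hpair (fun t => K34 / 2 * (x t - 1)) (fun t => K34 / 2 * (y t - 0))); cont.
      * cont.
      * apply (continuous_ext (fun z : E3 => z)); [intros s; apply surjective_pairing|].
        apply continuous_id.
Qed.

(** * Regular paths in the level set *)

Lemma continuous_Rmax0 t : continuous (fun t => Rmax 0 t) t.
Proof.
  apply (continuous_ext (fun t => (t + Rabs t) * / 2)).
  { intros s; unfold Rmax, Rabs; destruct (Rle_dec 0 s), (Rcase_abs s); lra. }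
  assert (continuous (fun t : R => t) t) by apply continuous_id.
  assert (continuous (fun t : R => Rabs t) t) by apply continuous_Rabs.
  cont.
Qed.

Lemma is_derive_pos_part_sqr t : is_derive (fun t => Rmax 0 t ^ 2) t (2 * Rmax 0 t).
Proof.
  destruct (Rtotal_order t 0) as [H|[ -> |H]].
  - rewrite Rmax_left by lra; apply (is_derive_ext_loc (fun _ => 0)).
    + generalize (open_lt 0 t H); apply filter_imp; intros y Hy.
      change (0 = Rmax 0 y ^ 2); rewrite Rmax_left by lra; ring.
    + apply (is_derive_eq _ _ 0); [apply (is_derive_const (V := R_NormedModule) 0)|ring].
  - rewrite Rmax_left by lra; apply (is_derive_eq _ _ (Rmax 0 0)); [|rewrite Rmax_left; lra].
    apply (slope_derive (fun t => Rmax 0 t ^ 2) (fun y => Rmax 0 y)); [apply continuous_Rmax0|].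
    apply filter_forall; intros y; rewrite (Rmax_left 0 0) by lra.
    unfold Rmax; destruct (Rle_dec 0 y); ring.
  - rewrite Rmax_right by lra; apply (is_derive_ext_loc (fun y => y ^ 2)).
    + generalize (open_gt 0 t H); apply filter_imp; intros y Hy.
      change (y ^ 2 = Rmax 0 y ^ 2); rewrite Rmax_right by lra; ring.
    + auto_derive; [exact I|ring].
Qed.

(** A C^1 transition from 0 to 1, constant outside [0, 1], so that arcs run through it can be
    concatenated without corners. The squares of positive parts are just smooth enough. *)
Definition step (t : R) : R := Rmax 0 t ^ 2 / (Rmax 0 t ^ 2 + Rmax 0 (1 - t) ^ 2).
Definition dstep (t : R) : R :=
  (2 * Rmax 0 t * Rmax 0 (1 - t) ^ 2 + Rmax 0 t ^ 2 * (2 * Rmax 0 (1 - t)))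
  * / ((Rmax 0 t ^ 2 + Rmax 0 (1 - t) ^ 2) ^ 2).

Lemma step_den t : 0 < Rmax 0 t ^ 2 + Rmax 0 (1 - t) ^ 2.
Proof.
  destruct (Rle_lt_dec t 0).
  - rewrite (Rmax_left 0 t), (Rmax_right 0 (1 - t)) by lra; nra.
  - rewrite (Rmax_right 0 t) by lra; pose proof (pow2_ge_0 (Rmax 0 (1 - t))); nra.
Qed.

Lemma C1_step : is_C1 step dstep.
Proof.
  intros t; pose proof (step_den t) as Hd; split.
  - assert (H1 : is_derive (fun t => Rmax 0 (1 - t) ^ 2) t (- (2 * Rmax 0 (1 - t)))).
    { eapply is_derive_eq.
      - apply (is_derive_comp (fun t => Rmax 0 t ^ 2) (fun t => 1 - t));
          [apply is_derive_pos_part_sqr|auto_derive; [exact I|reflexivity]].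
      - unfold scal; simpl; unfold mult; simpl; ring. }
    pose proof (is_derive_pos_part_sqr t) as H0.
    eapply is_derive_eq.
    + apply (is_derive_div (fun t => Rmax 0 t ^ 2) (fun t => Rmax 0 t ^ 2 + Rmax 0 (1 - t) ^ 2));
        [exact H0| |lra].
      apply (is_derive_plus (fun t => Rmax 0 t ^ 2)); [exact H0|exact H1].
    + unfold dstep, plus; simpl in *; field; lra.
  - unfold dstep.
    assert (C0 : continuous (fun t => Rmax 0 t) t) by apply continuous_Rmax0.
    assert (C1 : continuous (fun t => Rmax 0 (1 - t)) t).
    { apply (continuous_comp (fun t => 1 - t) (fun t => Rmax 0 t)); [|apply continuous_Rmax0].
      assert (continuous (fun t : R => t) t) by apply continuous_id; cont. }
    assert (C2 : continuous (fun t => / ((Rmax 0 t ^ 2 + Rmax 0 (1 - t) ^ 2) ^ 2)) t).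
    { apply continuous_inv_pos; [cont|now apply pow_lt]. }
    cont.
Qed.

Lemma step_left t : t <= 0 -> step t = 0.
Proof. intros H; unfold step; rewrite (Rmax_left 0 t) by lra; unfold Rdiv; ring. Qed.

Lemma step_right t : 1 <= t -> step t = 1.
Proof.
  intros H; unfold step; rewrite (Rmax_left 0 (1 - t)), Rmax_right by lra; field; lra.
Qed.

Lemma step_mid t : 0 < t < 1 -> 0 < step t < 1.
Proof.
  intros H; unfold step; rewrite !Rmax_right by lra.
  assert (0 < t ^ 2) by nra; assert (0 < (1 - t) ^ 2) by nra; split.
  - apply Rdiv_lt_0_compat; lra.
  - apply Rmult_lt_reg_r with (t ^ 2 + (1 - t) ^ 2); [lra|].
    unfold Rdiv; rewrite Rmult_assoc, Rinv_l; lra.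
Qed.

Lemma step_range t : 0 <= step t <= 1.
Proof.
  destruct (Rle_lt_dec t 0); [rewrite step_left; lra|].
  destruct (Rle_lt_dec 1 t); [rewrite step_right; lra|].
  pose proof (step_mid t); lra.
Qed.

Lemma C1_comp (f df x dx : R -> R) :
  (forall t, is_derive f (x t) (df (x t)) /\ continuous df (x t)) -> is_C1 x dx ->
  is_C1 (fun t => f (x t)) (fun t => df (x t) * dx t).
Proof.
  intros Hf Hx t; destruct (Hf t) as [F1 F2], (Hx t) as [X1 X2]; split.
  - eapply is_derive_eq; [apply (is_derive_comp f x); eassumption|].
    unfold scal; simpl; unfold mult; simpl; ring.
  - assert (continuous (fun t => df (x t)) t).
    { apply (continuous_comp x df); [eapply C1_continuous; exact Hx|exact F2]. }
    cont.
Qed.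

Lemma C1_affine (a b : R) x dx : is_C1 x dx -> is_C1 (fun t => a * x t + b) (fun t => a * dx t).
Proof.
  intros Hx; apply (C1_comp (fun s => a * s + b) (fun _ => a)); [|exact Hx].
  intros t; split; [auto_derive; [exact I|ring]|apply continuous_Rconst].
Qed.

Lemma C1_reparam (a b : R) x dx : is_C1 x dx -> is_C1 (fun t => x (a * t + b)) (fun t => dx (a * t + b) * a).
Proof.
  intros Hx; apply (C1_comp x dx (fun t => a * t + b) (fun _ => a)); [intros t; apply Hx|].
  intros t; split; [auto_derive; [exact I|ring]|apply continuous_Rconst].
Qed.

Lemma C1_add x dx y dy : is_C1 x dx -> is_C1 y dy -> is_C1 (fun t => x t + y t) (fun t => dx t + dy t).
Proof.
  intros Hx Hy t; destruct (Hx t) as [X1 X2], (Hy t) as [Y1 Y2]; split; [|cont].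
  apply (is_derive_plus x y); assumption.
Qed.

(** The first condition excludes the half-odd numbers, the second the integers. [good] is stronger
    than regular on the level set but, unlike [regular_point], invariant under permutations and
    reflections of the coordinates. *)
Definition generic (t : R) : Prop := tc t <> 0 /\ nc t <> 0.
Definition good (p : E3) : Prop :=
  let '(x, y, z) := p in generic x \/ generic y \/ generic z.

Definition C1_curve (g : R -> E3) : Prop :=
  exists x y z dx dy dz : R -> R,
    is_C1 x dx /\ is_C1 y dy /\ is_C1 z dz /\ forall t, g t = (x t, y t, z t).

(** The endpoints need not be good, so flat points and points over zeta = infinity can be joined.
    Only a point where two paths are concatenated has to be good. *)
Definition joined (p q : E3) : Prop :=
  exists g, C1_curve g /\ (forall t, levelset (g t)) /\
    (forall t, t <= 0 -> g t = p) /\ (forall t, 1 <= t -> g t = q) /\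
    (forall t, 0 < t < 1 -> good (g t)).

Lemma joined_sym p q : joined p q -> joined q p.
Proof.
  intros (g & (x & y & z & dx & dy & dz & Hx & Hy & Hz & Hg) & Hl & H0 & H1 & Hgood).
  exists (fun t => g (-1 * t + 1)); split; [|split; [|split; [|split]]].
  - do 6 eexists; split; [|split; [|split]].
    4: intros t; apply Hg.
    1: exact (C1_reparam (-1) 1 _ _ Hx).
    1: exact (C1_reparam (-1) 1 _ _ Hy).
    exact (C1_reparam (-1) 1 _ _ Hz).
  - intros t; apply Hl.
  - intros t Ht; apply H1; lra.
  - intros t Ht; apply H0; lra.
  - intros t Ht; apply Hgood; lra.
Qed.

Lemma joined_trans p q r : good q -> joined p q -> joined q r -> joined p r.
Proof.
  intros Hq (g & (x & y & z & dx & dy & dz & Hx & Hy & Hz & Hg) & Hl & H0 & H1 & Hgood)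
    (g' & (x' & y' & z' & dx' & dy' & dz' & Hx' & Hy' & Hz' & Hg') & Hl' & H0' & H1' & Hgood').
  destruct q as [[q1 q2] q3].
  (* The first half is constantly [q] after time 1/2 and the second half before it. *)
  set (h := fun t => (x (2 * t + 0) + (1 * x' (2 * t + -1) + - q1),
                      y (2 * t + 0) + (1 * y' (2 * t + -1) + - q2),
                      z (2 * t + 0) + (1 * z' (2 * t + -1) + - q3)) : E3).
  assert (L : forall t, t <= 1 / 2 -> h t = g (2 * t)).
  { intros t Ht; pose proof (H0' (2 * t + -1) ltac:(lra)) as E; rewrite Hg' in E.
    injection E as E1 E2 E3; unfold h; rewrite E1, E2, E3, Hg.
    replace (2 * t + 0) with (2 * t) by ring; repeat apply f_equal2; ring. }
  assert (R : forall t, 1 / 2 <= t -> h t = g' (2 * t + -1)).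
  { intros t Ht; pose proof (H1 (2 * t + 0) ltac:(lra)) as E; rewrite Hg in E.
    injection E as E1 E2 E3; unfold h; rewrite E1, E2, E3, Hg'.
    repeat apply f_equal2; ring. }
  exists h; split; [|split; [|split; [|split]]].
  - do 6 eexists; split; [|split; [|split]].
    4: reflexivity.
    1: exact (C1_add _ _ _ _ (C1_reparam 2 0 _ _ Hx) (C1_affine 1 (- q1) _ _ (C1_reparam 2 (-1) _ _ Hx'))).
    1: exact (C1_add _ _ _ _ (C1_reparam 2 0 _ _ Hy) (C1_affine 1 (- q2) _ _ (C1_reparam 2 (-1) _ _ Hy'))).
    exact (C1_add _ _ _ _ (C1_reparam 2 0 _ _ Hz) (C1_affine 1 (- q3) _ _ (C1_reparam 2 (-1) _ _ Hz'))).
  - intros t; destruct (Rle_lt_dec t (1 / 2)); [rewrite L by assumption; apply Hl|].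
    rewrite R by lra; apply Hl'.
  - intros t Ht; rewrite L by lra; apply H0; lra.
  - intros t Ht; rewrite R by lra; apply H1'; lra.
  - intros t Ht; destruct (Rtotal_order t (1 / 2)) as [C|[ -> |C]].
    + rewrite L by lra; apply Hgood; lra.
    + rewrite L by lra; rewrite H1 by lra; exact Hq.
    + rewrite R by lra; apply Hgood'; lra.
Qed.

Lemma joined_swap12 x y z x' y' z' : joined (x, y, z) (x', y', z') -> joined (y, x, z) (y', x', z').
Proof.
  intros (g & (f1 & f2 & f3 & d1 & d2 & d3 & X1 & X2 & X3 & Hg) & Hl & H0 & H1 & Hgood).
  exists (fun t => (f2 t, f1 t, f3 t)); split; [|split; [|split; [|split]]].
  - exists f2, f1, f3, d2, d1, d3; auto.
  - intros t; specialize (Hl t); rewrite Hg in Hl; simpl in *; lra.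
  - intros t Ht; specialize (H0 t Ht); rewrite Hg in H0; congruence.
  - intros t Ht; specialize (H1 t Ht); rewrite Hg in H1; congruence.
  - intros t Ht; specialize (Hgood t Ht); rewrite Hg in Hgood; simpl in *; tauto.
Qed.

Lemma joined_swap23 x y z x' y' z' : joined (x, y, z) (x', y', z') -> joined (x, z, y) (x', z', y').
Proof.
  intros (g & (f1 & f2 & f3 & d1 & d2 & d3 & X1 & X2 & X3 & Hg) & Hl & H0 & H1 & Hgood).
  exists (fun t => (f1 t, f3 t, f2 t)); split; [|split; [|split; [|split]]].
  - exists f1, f3, f2, d1, d3, d2; auto.
  - intros t; specialize (Hl t); rewrite Hg in Hl; simpl in *; lra.
  - intros t Ht; specialize (H0 t Ht); rewrite Hg in H0; congruence.
  - intros t Ht; specialize (H1 t Ht); rewrite Hg in H1; congruence.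
  - intros t Ht; specialize (Hgood t Ht); rewrite Hg in Hgood; simpl in *; tauto.
Qed.

(* The reflections in the integer coordinate planes generate the maps [x |-> e x + 2 k]. *)
Definition refl (e : R) (k : Z) (x : R) : R := e * x + 2 * IZR k.
Definition is_sign (e : R) : Prop := e = 1 \/ e = -1.

Lemma lv_refl e k x : is_sign e -> lv (refl e k x) = lv x.
Proof.
  unfold refl; intros [-> | ->]; rewrite lv_period; [f_equal; ring|].
  rewrite <- lv_opp; f_equal; ring.
Qed.

Lemma generic_refl e k x : is_sign e -> generic x -> generic (refl e k x).
Proof.
  intros He [H1 H2]; split.
  - rewrite tc_lv, lv_refl, <- tc_lv; assumption.
  - unfold refl; rewrite nc_period; destruct He as [-> | ->].
    + now rewrite Rmult_1_l.
    + replace (-1 * x) with (- x) by ring; rewrite nc_opp; lra.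
Qed.

Lemma joined_refl e1 k1 e2 k2 e3 k3 x y z x' y' z' :
  is_sign e1 -> is_sign e2 -> is_sign e3 -> joined (x, y, z) (x', y', z') ->
  joined (refl e1 k1 x, refl e2 k2 y, refl e3 k3 z) (refl e1 k1 x', refl e2 k2 y', refl e3 k3 z').
Proof.
  intros S1 S2 S3 (g & (f1 & f2 & f3 & d1 & d2 & d3 & X1 & X2 & X3 & Hg) & Hl & H0 & H1 & Hgood).
  exists (fun t => (refl e1 k1 (f1 t), refl e2 k2 (f2 t), refl e3 k3 (f3 t)));
    split; [|split; [|split; [|split]]].
  - do 6 eexists; split; [|split; [|split]].
    4: reflexivity.
    1: exact (C1_affine e1 (2 * IZR k1) _ _ X1).
    1: exact (C1_affine e2 (2 * IZR k2) _ _ X2).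
    exact (C1_affine e3 (2 * IZR k3) _ _ X3).
  - intros t; specialize (Hl t); rewrite Hg in Hl; simpl in *; rewrite !lv_refl; auto.
  - intros t Ht; specialize (H0 t Ht); rewrite Hg in H0; congruence.
  - intros t Ht; specialize (H1 t Ht); rewrite Hg in H1; congruence.
  - intros t Ht; specialize (Hgood t Ht); rewrite Hg in Hgood; simpl in *.
    destruct Hgood as [G|[G|G]]; [left|right; left|right; right]; now apply generic_refl.
Qed.

(** In the slice with second coordinate [c] the third coordinate is solved for as
    [linv (- lv s - lv c)]; the first hypothesis keeps it off the ends, where [linv] is not smooth.
    The good coordinate is either [c] or the moving one. *)
Lemma joined_arc s0 s1 c z0 z1 :
  (forall s, Rmin s0 s1 <= s <= Rmax s0 s1 -> - (PI / 3) < - lv s - lv c < PI / 3) ->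
  generic c \/ (forall s, Rmin s0 s1 < s < Rmax s0 s1 -> generic s) /\ s0 <> s1 ->
  0 < z0 < 1 -> 0 < z1 < 1 -> levelset (s0, c, z0) -> levelset (s1, c, z1) ->
  joined (s0, c, z0) (s1, c, z1).
Proof.
  intros Hr Hg Hz0 Hz1 L0 L1; pose proof K34_pos as HK.
  set (s := fun t => (s1 - s0) * step t + s0).
  assert (Hs : is_C1 s (fun t => (s1 - s0) * dstep t)) by apply C1_affine, C1_step.
  assert (Hsr : forall t, Rmin s0 s1 <= s t <= Rmax s0 s1).
  { intros t; unfold s; pose proof (step_range t).
    unfold Rmin, Rmax; destruct (Rle_dec s0 s1); split; nra. }
  set (th := fun t => - lv (s t) - lv c).
  assert (Hth : forall t, - (PI / 3) < th t < PI / 3) by (intros t; apply Hr, Hsr).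
  assert (Cth : is_C1 th (fun t => (- (K34 * nc (s t))) * ((s1 - s0) * dstep t))).
  { apply (C1_comp (fun x => - lv x - lv c) (fun x => - (K34 * nc x)) s); [|exact Hs].
    intros t; split.
    - apply (is_derive_eq _ _ (- (K34 * nc (s t)) - 0)); [|ring].
      apply (is_derive_minus (fun x => - lv x) (fun _ => lv c)); [|apply (is_derive_const (lv c))].
      apply (is_derive_opp lv), is_derive_lv.
    - assert (continuous nc (s t)) by (eapply continuous_is_derive, is_derive_nc).
      apply continuous_Ropp, continuous_Rmult; [apply continuous_Rconst|assumption]. }
  assert (Cz : is_C1 (fun t => linv (th t))
            (fun t => / (K34 * nc (linv (th t))) * (- (K34 * nc (s t)) * ((s1 - s0) * dstep t)))).
  { apply (C1_comp linv (fun a => / (K34 * nc (linv a))) th); [|exact Cth].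
    intros t; split; [now apply is_derive_linv|].
    pose proof (nc_neg _ (linv_range _ (Hth t))) as Hn.
    apply (continuous_ext (fun a => - / - (K34 * nc (linv a)))).
    { intros a; change (- / - (K34 * nc (linv a)) = / (K34 * nc (linv a))).
      rewrite Rinv_opp; ring. }
    apply continuous_Ropp, continuous_inv_pos; [|nra].
    apply continuous_Ropp, continuous_Rmult; [apply continuous_Rconst|].
    apply (continuous_comp linv nc).
    - eapply continuous_is_derive; now apply is_derive_linv.
    - eapply continuous_is_derive, is_derive_nc. }
  exists (fun t => (s t, c, linv (th t))); split; [|split; [|split; [|split]]].
  - exists s, (fun _ => c), (fun t => linv (th t)), (fun t => (s1 - s0) * dstep t), (fun _ => 0),
      (fun t => / (K34 * nc (linv (th t))) * (- (K34 * nc (s t)) * ((s1 - s0) * dstep t))).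
    split; [exact Hs|split; [|split; [exact Cz|reflexivity]]].
    intros t; split; [apply (is_derive_const (V := R_NormedModule) c)|apply continuous_Rconst].
  - intros t; simpl; rewrite lv_linv by apply Hth; unfold th; ring.
  - intros t Ht; unfold th, s; rewrite step_left by exact Ht.
    replace ((s1 - s0) * 0 + s0) with s0 by ring.
    replace (- lv s0 - lv c) with (lv z0) by (simpl in L0; lra); now rewrite linv_lv.
  - intros t Ht; unfold th, s; rewrite step_right by exact Ht.
    replace ((s1 - s0) * 1 + s0) with s1 by ring.
    replace (- lv s1 - lv c) with (lv z1) by (simpl in L1; lra); now rewrite linv_lv.
  - intros t Ht; simpl; destruct Hg as [Hg|[Hg Hne]]; [tauto|left].
    apply Hg; unfold s; pose proof (step_mid t Ht).
    unfold Rmin, Rmax; destruct (Rle_dec s0 s1); split; nra.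
Qed.

(** * Connections inside the unit cube *)

Lemma generic_lv t : lv t <> 0 -> lv t <> PI / 3 -> lv t <> - (PI / 3) -> generic t.
Proof.
  intros H0 H1 H2; split.
  - rewrite tc_zero; exact H0.
  - intros H; destruct (nc_zero_lv t H); contradiction.
Qed.

Lemma not_generic_lv t : ~ generic t -> lv t = 0 \/ lv t = PI / 3 \/ lv t = - (PI / 3).
Proof.
  intros H; destruct (Req_dec (lv t) 0); [tauto|].
  destruct (Req_dec (lv t) (PI / 3)); [tauto|].
  destruct (Req_dec (lv t) (- (PI / 3))); [tauto|].
  contradiction H; now apply generic_lv.
Qed.

Lemma generic_lv_neq0 t : generic t -> lv t <> 0.
Proof. intros [H _] E; apply H, tc_zero, E. Qed.

Lemma lv_antitone s t : 0 <= s -> s <= t -> t <= 1 -> lv t <= lv s.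
Proof.
  intros H0 [H| -> ] H1; [left; now apply lv_decr|lra].
Qed.

Lemma lv_interior t : 0 < t < 1 -> - (PI / 3) < lv t < PI / 3.
Proof. intros H; rewrite <- lv_1, <- lv_0; split; apply lv_decr; lra. Qed.

Lemma lv_end t : 0 <= t <= 1 -> t = 0 \/ t = 1 \/ 0 < t < 1.
Proof. lra. Qed.

Lemma joined_swap13 x y z x' y' z' : joined (x, y, z) (x', y', z') -> joined (z, y, x) (z', y', x').
Proof. intros H; apply joined_swap12, joined_swap23, joined_swap12, H. Qed.

(** [lv] is monotone on [0, 1], so the value prescribed for the third coordinate stays between its
    values at the two ends. *)
Lemma monotone_arc s0 s1 c z0 z1 :
  generic c \/ (forall s, Rmin s0 s1 < s < Rmax s0 s1 -> generic s) /\ s0 <> s1 ->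
  0 <= s0 <= 1 -> 0 <= s1 <= 1 -> 0 < z0 < 1 -> 0 < z1 < 1 ->
  levelset (s0, c, z0) -> levelset (s1, c, z1) -> joined (s0, c, z0) (s1, c, z1).
Proof.
  intros Hg Hs0 Hs1 Hz0 Hz1 L0 L1; apply joined_arc; auto.
  pose proof (lv_interior _ Hz0); pose proof (lv_interior _ Hz1); simpl in L0, L1.
  intros s Hs; unfold Rmin, Rmax in Hs; destruct (Rle_dec s0 s1).
  - pose proof (lv_antitone s0 s); pose proof (lv_antitone s s1); lra.
  - pose proof (lv_antitone s1 s); pose proof (lv_antitone s s0); lra.
Qed.

(** If the third coordinate starts on a face, the first one cannot: both values of [lv] would be PI
    / 3 up to sign, leaving 0 or a value out of range for [lv c]. The slice is then parametrized by
    the third coordinate instead. *)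
Lemma cell_slice x0 x1 c z0 z1 :
  generic c -> 0 <= x0 <= 1 -> 0 <= z0 <= 1 -> 0 < x1 < 1 -> 0 < z1 < 1 ->
  levelset (x0, c, z0) -> levelset (x1, c, z1) -> joined (x0, c, z0) (x1, c, z1).
Proof.
  intros Hc Hx0 Hz0 Hx1 Hz1 L0 L1.
  destruct (lv_end z0 Hz0) as [E|[E|Hz]]; [| |apply monotone_arc; auto; lra].
  all: assert (Hx : 0 < x0 < 1);
    [|apply joined_swap13, monotone_arc; auto; try lra; simpl in *; lra].
  all: pose proof (generic_lv_neq0 c Hc); pose proof (lv_bound c); pose proof PI_RGT_0.
  all: destruct (lv_end x0 Hx0) as [E'|[E'|Hx]]; [exfalso|exfalso|exact Hx]; subst;
    simpl in L0; rewrite ?lv_0, ?lv_1 in L0; lra.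
Qed.

(** A hub for all connections: good points around the flat point (1/2, 1/2, 1/2), closed under
    permutation of the coordinates. Neighbours in the list share a coordinate 1/4 or 3/4, which is
    generic, so a slice connects them. *)
Definition hexagon (p : E3) : Prop :=
  p = (1 / 4, 3 / 4, 1 / 2) \/ p = (1 / 4, 1 / 2, 3 / 4) \/ p = (1 / 2, 1 / 4, 3 / 4) \/
  p = (3 / 4, 1 / 4, 1 / 2) \/ p = (3 / 4, 1 / 2, 1 / 4) \/ p = (1 / 2, 3 / 4, 1 / 4).

Lemma generic_quarters : generic (1 / 4) /\ generic (3 / 4).
Proof. pose proof lv_quarter; pose proof lv_34; split; apply generic_lv; lra. Qed.

Lemma hexagon_good p : hexagon p -> good p.
Proof.
  destruct generic_quarters; intros [-> |[-> |[-> |[-> |[-> | -> ]]]]]; simpl; tauto.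
Qed.

Lemma hexagon_joined_first p : hexagon p ->
  joined (1 / 4, 3 / 4, 1 / 2) p /\ joined p (1 / 4, 3 / 4, 1 / 2).
Proof.
  destruct generic_quarters as [G1 G3]; pose proof lv_34 as E3; pose proof lv_half as E2.
  assert (n1 : joined (1 / 4, 3 / 4, 1 / 2) (1 / 4, 1 / 2, 3 / 4)).
  { apply joined_swap12, cell_slice; auto; try lra; simpl; lra. }
  assert (n2 : joined (1 / 4, 1 / 2, 3 / 4) (1 / 2, 1 / 4, 3 / 4)).
  { apply joined_swap23, cell_slice; auto; try lra; simpl; lra. }
  assert (n3 : joined (1 / 2, 1 / 4, 3 / 4) (3 / 4, 1 / 4, 1 / 2)).
  { apply cell_slice; auto; try lra; simpl; lra. }
  assert (n4 : joined (3 / 4, 1 / 4, 1 / 2) (3 / 4, 1 / 2, 1 / 4)).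
  { apply joined_swap12, cell_slice; auto; try lra; simpl; lra. }
  assert (n5 : joined (3 / 4, 1 / 2, 1 / 4) (1 / 2, 3 / 4, 1 / 4)).
  { apply joined_swap23, cell_slice; auto; try lra; simpl; lra. }
  assert (T : forall q r, hexagon q -> joined (1 / 4, 3 / 4, 1 / 2) q -> joined q r ->
            joined (1 / 4, 3 / 4, 1 / 2) r).
  { intros q r Hq; apply joined_trans, hexagon_good, Hq. }
  assert (R1 : hexagon (1 / 4, 1 / 2, 3 / 4)) by (unfold hexagon; tauto).
  assert (R2 : hexagon (1 / 2, 1 / 4, 3 / 4)) by (unfold hexagon; tauto).
  assert (R3 : hexagon (3 / 4, 1 / 4, 1 / 2)) by (unfold hexagon; tauto).
  assert (R4 : hexagon (3 / 4, 1 / 2, 1 / 4)) by (unfold hexagon; tauto).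
  assert (m2 := T _ _ R1 n1 n2); assert (m3 := T _ _ R2 m2 n3).
  assert (m4 := T _ _ R3 m3 n4); assert (m5 := T _ _ R4 m4 n5).
  assert (m0 := T _ _ R1 n1 (joined_sym _ _ n1)).
  intros [-> |[-> |[-> |[-> |[-> | -> ]]]]]; auto using joined_sym.
Qed.

Lemma hexagon_joined p q : hexagon p -> hexagon q -> joined p q.
Proof.
  intros Hp Hq; apply (joined_trans _ (1 / 4, 3 / 4, 1 / 2)).
  - apply hexagon_good; unfold hexagon; tauto.
  - now apply hexagon_joined_first.
  - now apply hexagon_joined_first.
Qed.

Definition in_cell (x y z : R) : Prop := 0 <= x <= 1 /\ 0 <= y <= 1 /\ 0 <= z <= 1.
Definition hexagon_reaches (p : E3) : Prop := forall r, hexagon r -> joined r p.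

Lemma hexagon_reaches_from r p : hexagon r -> joined r p -> hexagon_reaches p.
Proof.
  intros Hr Hp r' Hr'; apply (joined_trans _ r); auto using hexagon_good, hexagon_joined.
Qed.

Lemma hexagon_reaches_swap12 x y z : hexagon_reaches (x, y, z) -> hexagon_reaches (y, x, z).
Proof.
  intros H; apply (hexagon_reaches_from (1 / 4, 3 / 4, 1 / 2)); [unfold hexagon; tauto|].
  apply joined_swap12, H; unfold hexagon; tauto.
Qed.

Lemma hexagon_reaches_swap23 x y z : hexagon_reaches (x, y, z) -> hexagon_reaches (x, z, y).
Proof.
  intros H; apply (hexagon_reaches_from (1 / 4, 3 / 4, 1 / 2)); [unfold hexagon; tauto|].
  apply joined_swap23, H; unfold hexagon; tauto.
Qed.

Lemma cell_generic_reached x y z : in_cell x y z -> levelset (x, y, z) -> generic y ->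
  hexagon_reaches (x, y, z).
Proof.
  intros (Hx & Hy & Hz) L Gy; destruct generic_quarters as [G1 G3].
  pose proof lv_34 as E3; pose proof lv_half as E2; pose proof lv_quarter as Hd.
  pose proof (generic_lv_neq0 _ Gy) as Hy0; pose proof PI_RGT_0 as Hpi.
  assert (Hyi : - (PI / 3) < lv y < PI / 3).
  { apply lv_interior; destruct (lv_end y Hy) as [E|[E|E]]; [| |exact E]; subst; exfalso;
      destruct Gy as [_ Gy]; apply Gy; pose proof start_values; tauto. }
  (* The intermediate point keeps [y] and has third coordinate 3/4 or 1/4. The sign of [lv y]
     decides which, so that the value left for the first coordinate lies in the domain of [linv]. *)
  destruct (Rlt_le_dec 0 (lv y)) as [P|P].
  - pose proof (linv_range (lv (1 / 4) - lv y) ltac:(lra)) as Hr.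
    pose proof (lv_linv (lv (1 / 4) - lv y) ltac:(lra)) as Hl.
    apply (hexagon_reaches_from (1 / 4, 1 / 2, 3 / 4)); [unfold hexagon; tauto|].
    apply joined_sym, (joined_trans _ (linv (lv (1 / 4) - lv y), y, 3 / 4)); [simpl; tauto| |].
    + apply cell_slice; auto; try lra; simpl; lra.
    + apply joined_swap23, cell_slice; auto; try lra; simpl; lra.
  - pose proof (linv_range (- lv (1 / 4) - lv y) ltac:(lra)) as Hr.
    pose proof (lv_linv (- lv (1 / 4) - lv y) ltac:(lra)) as Hl.
    apply (hexagon_reaches_from (3 / 4, 1 / 2, 1 / 4)); [unfold hexagon; tauto|].
    apply joined_sym, (joined_trans _ (linv (- lv (1 / 4) - lv y), y, 1 / 4)); [simpl; tauto| |].
    + apply cell_slice; auto; try lra; simpl; lra.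
    + apply joined_swap23, cell_slice; auto; try lra; simpl; lra.
Qed.

Lemma cell_good_reached x y z : in_cell x y z -> levelset (x, y, z) -> good (x, y, z) ->
  hexagon_reaches (x, y, z).
Proof.
  intros (Hx & Hy & Hz) L [G|[G|G]].
  - apply hexagon_reaches_swap12, cell_generic_reached; [repeat split; tauto|simpl in *; lra|exact G].
  - apply cell_generic_reached; [repeat split; tauto|exact L|exact G].
  - apply hexagon_reaches_swap23, cell_generic_reached; [repeat split; tauto|simpl in *; lra|exact G].
Qed.

Lemma generic_between s a b : 0 <= a -> b <= 1 / 2 -> a < s < b -> generic s.
Proof.
  intros Ha Hb Hs; pose proof lv_half; pose proof lv_0.
  pose proof (lv_decr 0 s); pose proof (lv_decr s (1 / 2)); pose proof PI_RGT_0.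
  apply generic_lv; lra.
Qed.

(** No coordinate of this point is generic, nor is the fixed coordinate 1/2 of the arc; the moving
    coordinate keeps the interior of the arc good. The next lemma does the same within the face y =
    1. *)
Lemma flat_reached : hexagon_reaches (1 / 2, 1 / 2, 1 / 2).
Proof.
  pose proof lv_34; pose proof lv_half.
  apply (hexagon_reaches_from (1 / 4, 1 / 2, 3 / 4)); [unfold hexagon; tauto|].
  apply monotone_arc; try lra; try (simpl; lra).
  right; split; [|lra]; rewrite Rmin_left, Rmax_right by lra; intros s Hs.
  apply (generic_between s (1 / 4) (1 / 2)); lra.
Qed.

Lemma vertex_reached : hexagon_reaches (0, 1, 1 / 2).
Proof.
  pose proof lv_34; pose proof lv_half; pose proof lv_quarter; pose proof lv_0; pose proof lv_1.
  destruct generic_quarters as [G1 _].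
  pose proof (linv_range (PI / 3 - lv (1 / 4)) ltac:(lra)) as Hr.
  pose proof (lv_linv (PI / 3 - lv (1 / 4)) ltac:(lra)) as Hl.
  set (z := linv (PI / 3 - lv (1 / 4))) in *.
  assert (L : levelset (1 / 4, 1, z)) by (simpl; lra).
  assert (G : good (1 / 4, 1, z)) by (simpl; tauto).
  intros r Hr'; apply (joined_trans _ (1 / 4, 1, z)); [exact G| |].
  - apply cell_good_reached; auto; unfold in_cell; lra.
  - apply monotone_arc; try lra; try (simpl; lra).
    right; split; [|lra]; rewrite Rmin_right, Rmax_left by lra; intros s Hs.
    apply (generic_between s 0 (1 / 4)); lra.
Qed.

Lemma cell_reached x y z : in_cell x y z -> levelset (x, y, z) -> hexagon_reaches (x, y, z).
Proof.
  intros HC L; destruct (Classical_Prop.classic (good (x, y, z))) as [G|G];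
    [now apply cell_good_reached|].
  assert (D : forall t, 0 <= t <= 1 -> ~ generic t -> t = 0 \/ t = 1 \/ t = 1 / 2).
  { intros t Ht Gt; destruct (not_generic_lv t Gt) as [E|[E|E]].
    - right; right; apply lv_inj; try lra; rewrite lv_half; exact E.
    - left; apply lv_inj; try lra; rewrite lv_0; exact E.
    - right; left; apply lv_inj; try lra; rewrite lv_1; exact E. }
  destruct HC as (Hx & Hy & Hz); simpl in G, L.
  assert (Gx : ~ generic x) by tauto; assert (Gy : ~ generic y) by tauto.
  assert (Gz : ~ generic z) by tauto.
  pose proof lv_half; pose proof lv_0; pose proof lv_1; pose proof PI_RGT_0.
  pose proof vertex_reached as V.
  assert (V' := hexagon_reaches_swap12 _ _ _ V).
  (* Of the 27 points with coordinates in {0, 1/2, 1} only the centre and the six permutations of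
     (0, 1, 1/2) lie on the level set. *)
  destruct (D x Hx Gx) as [-> |[-> | -> ]], (D y Hy Gy) as [-> |[-> | -> ]],
    (D z Hz Gz) as [-> |[-> | -> ]]; try (exfalso; lra).
  - exact V.
  - apply hexagon_reaches_swap23, V.
  - exact V'.
  - apply hexagon_reaches_swap23, V'.
  - apply hexagon_reaches_swap12, hexagon_reaches_swap23, V.
  - apply hexagon_reaches_swap12, hexagon_reaches_swap23, V'.
  - apply flat_reached.
Qed.

(** * Passage between neighbouring cubes *)

Definition refl3 (e1 : R) (k1 : Z) (e2 : R) (k2 : Z) (e3 : R) (k3 : Z) (p : E3) : E3 :=
  let '(x, y, z) := p in (refl e1 k1 x, refl e2 k2 y, refl e3 k3 z).

Lemma refl3_good e1 k1 e2 k2 e3 k3 p : is_sign e1 -> is_sign e2 -> is_sign e3 ->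
  good p -> good (refl3 e1 k1 e2 k2 e3 k3 p).
Proof.
  destruct p as [[x y] z]; intros S1 S2 S3 [G|[G|G]]; simpl;
    [left|right; left|right; right]; now apply generic_refl.
Qed.

Lemma refl3_joined e1 k1 e2 k2 e3 k3 p q : is_sign e1 -> is_sign e2 -> is_sign e3 -> joined p q ->
  joined (refl3 e1 k1 e2 k2 e3 k3 p) (refl3 e1 k1 e2 k2 e3 k3 q).
Proof.
  destruct p as [[x y] z], q as [[x' y'] z']; intros; now apply joined_refl.
Qed.

(** The signs and integers label the cube obtained from the unit cube by [refl3]; its hub is the
    image of the hexagon. *)
Definition cell_reaches (e1 : R) (k1 : Z) (e2 : R) (k2 : Z) (e3 : R) (k3 : Z) : Prop :=
  forall r r', hexagon r -> hexagon r' -> joined r (refl3 e1 k1 e2 k2 e3 k3 r').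

Lemma cell_reaches_swap12 e1 k1 e2 k2 e3 k3 :
  cell_reaches e1 k1 e2 k2 e3 k3 -> cell_reaches e2 k2 e1 k1 e3 k3.
Proof.
  intros H [[x y] z] [[x' y'] z'] Hr Hr'; apply joined_swap12, (H (y, x, z) (y', x', z')).
  - destruct Hr as [E|[E|[E|[E|[E|E]]]]]; injection E as -> -> ->; unfold hexagon; tauto.
  - destruct Hr' as [E|[E|[E|[E|[E|E]]]]]; injection E as -> -> ->; unfold hexagon; tauto.
Qed.

Lemma cell_reaches_swap23 e1 k1 e2 k2 e3 k3 :
  cell_reaches e1 k1 e2 k2 e3 k3 -> cell_reaches e1 k1 e3 k3 e2 k2.
Proof.
  intros H [[x y] z] [[x' y'] z'] Hr Hr'; apply joined_swap23, (H (x, z, y) (x', z', y')).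
  - destruct Hr as [E|[E|[E|[E|[E|E]]]]]; injection E as -> -> ->; unfold hexagon; tauto.
  - destruct Hr' as [E|[E|[E|[E|[E|E]]]]]; injection E as -> -> ->; unfold hexagon; tauto.
Qed.

(** In the slice z = 3/4 the path crosses the plane x = 0. There [lv] is not monotone, but between
    -1/4 and 1/4 it stays between [lv (1 / 4)] and PI / 3, which keeps the solved coordinate inside
    (0, 1). *)
Lemma crossing_left : joined (1 / 4, 1 / 2, 3 / 4) (- (1 / 4), 1 / 2, 3 / 4).
Proof.
  destruct generic_quarters as [_ G3]; pose proof lv_34; pose proof lv_half.
  pose proof lv_quarter; pose proof lv_0.
  apply joined_swap23, joined_arc; auto; try lra; simpl; rewrite ?lv_opp; try lra.
  rewrite Rmin_right, Rmax_left by lra; intros s Hs.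
  rewrite <- (lv_opp s) in *.
  destruct (Rle_lt_dec 0 s).
  - pose proof (lv_antitone s (1 / 4)); pose proof (lv_antitone 0 s); rewrite lv_opp; lra.
  - pose proof (lv_antitone (- s) (1 / 4)); pose proof (lv_antitone 0 (- s)); lra.
Qed.

Lemma crossing_right : joined (3 / 4, 1 / 2, 1 / 4) (2 - 3 / 4, 1 / 2, 1 / 4).
Proof.
  destruct generic_quarters as [G1 _]; pose proof lv_34; pose proof lv_half.
  pose proof lv_quarter; pose proof lv_1.
  assert (E2 : forall s, lv (2 - s) = lv s).
  { intros s; replace (2 - s) with (- s + 2 * IZR 1) by ring; now rewrite lv_period, lv_opp. }
  apply joined_swap23, joined_arc; auto; try lra; simpl; rewrite ?E2; try lra.
  rewrite Rmin_left, Rmax_right by lra; intros s Hs.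
  destruct (Rle_lt_dec s 1).
  - pose proof (lv_antitone (3 / 4) s); pose proof (lv_antitone s 1); lra.
  - rewrite <- (E2 s).
    pose proof (lv_antitone (3 / 4) (2 - s)); pose proof (lv_antitone (2 - s) 1); lra.
Qed.

Lemma cell_reaches_step e1 k1 e1' k1' e2 k2 e3 k3 x x' y z :
  is_sign e1 -> is_sign e1' -> is_sign e2 -> is_sign e3 ->
  hexagon (x, y, z) -> joined (x, y, z) (x', y, z) -> refl e1 k1 x' = refl e1' k1' x ->
  cell_reaches e1 k1 e2 k2 e3 k3 -> cell_reaches e1' k1' e2 k2 e3 k3.
Proof.
  intros S1 S1' S2 S3 Hh Hj E H r r' Hr Hr'.
  apply (refl3_joined e1 k1 e2 k2 e3 k3) in Hj; auto; simpl in Hj; rewrite E in Hj.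
  change (refl e1' k1' x, refl e2 k2 y, refl e3 k3 z)
    with (refl3 e1' k1' e2 k2 e3 k3 (x, y, z)) in Hj.
  change (refl e1 k1 x, refl e2 k2 y, refl e3 k3 z)
    with (refl3 e1 k1 e2 k2 e3 k3 (x, y, z)) in Hj.
  pose proof (hexagon_good _ Hh).
  apply (joined_trans _ (refl3 e1' k1' e2 k2 e3 k3 (x, y, z))); [now apply refl3_good| |].
  - apply (joined_trans _ (refl3 e1 k1 e2 k2 e3 k3 (x, y, z))); [now apply refl3_good| |exact Hj].
    now apply H.
  - apply refl3_joined; auto using hexagon_joined.
Qed.

(** Crossing the image of the face x = 0 flips the sign and keeps [k]; crossing that of x = 1 flips
    the sign and shifts [k]. The two crossings in turn move by a full period, and induction in both
    directions reaches every cube of the row. *)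
Lemma cell_reaches_axis e k e2 k2 e3 k3 : is_sign e -> is_sign e2 -> is_sign e3 ->
  cell_reaches 1 0 e2 k2 e3 k3 -> cell_reaches e k e2 k2 e3 k3.
Proof.
  intros He S2 S3 H0; assert (P : is_sign 1) by (now left); assert (N : is_sign (-1)) by (now right).
  assert (HL : hexagon (1 / 4, 1 / 2, 3 / 4)) by (unfold hexagon; tauto).
  assert (HR : hexagon (3 / 4, 1 / 2, 1 / 4)) by (unfold hexagon; tauto).
  assert (La : forall k, cell_reaches 1 k e2 k2 e3 k3 -> cell_reaches (-1) k e2 k2 e3 k3).
  { intros m; apply (cell_reaches_step 1 m (-1) m _ _ _ _ _ _ _ _ P N S2 S3 HL crossing_left).
    unfold refl; ring. }
  assert (Lb : forall k, cell_reaches (-1) k e2 k2 e3 k3 -> cell_reaches 1 k e2 k2 e3 k3).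
  { intros m; apply (cell_reaches_step (-1) m 1 m _ _ _ _ _ _ _ _ N P S2 S3 HL crossing_left).
    unfold refl; ring. }
  assert (Ra : forall k, cell_reaches 1 k e2 k2 e3 k3 -> cell_reaches (-1) (k + 1) e2 k2 e3 k3).
  { intros m; apply (cell_reaches_step 1 m (-1) (m + 1) _ _ _ _ _ _ _ _ P N S2 S3 HR crossing_right).
    unfold refl; rewrite plus_IZR; ring. }
  assert (Rb : forall k, cell_reaches (-1) k e2 k2 e3 k3 -> cell_reaches 1 (k - 1) e2 k2 e3 k3).
  { intros m; apply (cell_reaches_step (-1) m 1 (m - 1) _ _ _ _ _ _ _ _ N P S2 S3 HR crossing_right).
    unfold refl; rewrite minus_IZR; ring. }
  assert (H1 : forall k, cell_reaches 1 k e2 k2 e3 k3).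
  { apply Z.bi_induction; [intros ? ? ->; reflexivity|exact H0|].
    intros m; split; intros H.
    - apply Lb; replace (Z.succ m) with (m + 1)%Z by lia; auto.
    - replace m with (Z.succ m - 1)%Z by lia; auto. }
  destruct He as [-> | ->]; auto.
Qed.

Lemma cell_reaches_all e1 k1 e2 k2 e3 k3 : is_sign e1 -> is_sign e2 -> is_sign e3 ->
  cell_reaches e1 k1 e2 k2 e3 k3.
Proof.
  intros S1 S2 S3; assert (P : is_sign 1) by (now left).
  apply cell_reaches_axis; auto; apply cell_reaches_swap12.
  apply cell_reaches_axis; auto; apply cell_reaches_swap12, cell_reaches_swap23, cell_reaches_swap12.
  apply cell_reaches_axis; auto.
  intros r [[x y] z] Hr Hr'; unfold refl3, refl; rewrite !Rmult_1_l, !Rmult_0_r, !Rplus_0_r.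
  now apply hexagon_joined.
Qed.

Lemma levelset_reached p : levelset p -> hexagon_reaches p.
Proof.
  destruct p as [[x y] z]; intros L; assert (P : is_sign 1) by (now left).
  assert (F : forall t, exists e k s, is_sign e /\ 0 <= s <= 1 /\ t = refl e k s).
  { intros t; destruct (fold_unit t) as (k & s & Hs & [E|E]).
    - exists 1, k, s; repeat split; try lra; [now left|unfold refl; lra].
    - exists (-1), k, s; repeat split; try lra; [now right|unfold refl; lra]. }
  destruct (F x) as (e1 & k1 & x' & S1 & Hx & ->), (F y) as (e2 & k2 & y' & S2 & Hy & ->).
  destruct (F z) as (e3 & k3 & z' & S3 & Hz & ->).
  assert (L' : levelset (x', y', z')) by (simpl in *; rewrite !lv_refl in L by auto; exact L).
  assert (Hc : in_cell x' y' z') by (unfold in_cell; tauto).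
  pose proof (cell_reached _ _ _ Hc L') as H; intros r Hr.
  apply (joined_trans _ (refl3 e1 k1 e2 k2 e3 k3 r)).
  - apply refl3_good; auto using hexagon_good.
  - now apply cell_reaches_all.
  - apply (refl3_joined e1 k1 e2 k2 e3 k3 r (x', y', z')); auto.
Qed.

(** If [nc] vanished at [x] and [y], their values of [lv] would be PI / 3 up to sign and [z] would
    be the generic coordinate. But then [lv z] would be 0 or out of range. *)
Lemma good_regular x y z : levelset (x, y, z) -> good (x, y, z) -> regular_point x y z.
Proof.
  intros L G; pose proof PI_RGT_0; split.
  - intros Hx Hy; exfalso; simpl in L, G.
    assert (Hz : generic z) by (unfold generic in *; tauto).
    pose proof (generic_lv_neq0 z Hz); pose proof (lv_bound z).
    destruct (nc_zero_lv x Hx), (nc_zero_lv y Hy); lra.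
  - unfold good, generic in G; tauto.
Qed.

(** * The surface is the level set up to similarity *)

Lemma levelset_weierstrass p : levelset p -> exists q, weierstrass_surface q /\ place q = p.
Proof.
  intros L.
  assert (L0 : levelset (1, 0, 1 / 2)) by (simpl; rewrite lv_0, lv_1, lv_half; ring).
  assert (H0 : hexagon (1 / 4, 3 / 4, 1 / 2)) by (unfold hexagon; tauto).
  assert (J : joined (1, 0, 1 / 2) p).
  { apply (joined_trans _ (1 / 4, 3 / 4, 1 / 2)); [now apply hexagon_good| |].
    - apply joined_sym, levelset_reached; assumption.
    - apply levelset_reached; assumption. }
  destruct J as (g & (x & y & z & dx & dy & dz & Hx & Hy & Hz & Hg) & Hl & Hs & He & Hgood).
  pose proof (Hs 0 ltac:(lra)) as E0; rewrite Hg in E0; injection E0 as x0 y0 z0.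
  rewrite <- (He 1 ltac:(lra)), Hg.
  apply (levelset_path_weierstrass x y z dx dy dz Hx Hy Hz x0 y0 z0).
  - intros t; rewrite <- Hg; apply Hl.
  - intros t Ht; destruct (Req_dec t 0) as [-> |Ht0].
    (* The starting point is not good, but it is regular: zeta = 0 and w = 1 there. *)
    + rewrite x0, y0, z0; destruct start_values as (T1 & N1 & T0 & N0 & T2 & N2).
      pose proof sqrt3_pos; split; [intros; lra|left; lra].
    + apply good_regular; rewrite <- Hg; [apply Hl|apply Hgood; lra].
Qed.

Lemma place_inj p q : place p = place q -> p = q.
Proof.
  pose proof K34_pos; vec; simpl; intros E; injection E as E1 E2 E3.
  assert (0 < 2 / K34) by (apply Rdiv_lt_0_compat; lra).
  repeat apply f_equal2; apply (Rmult_eq_reg_l (2 / K34)); lra.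
Qed.

Lemma weierstrass_iff q : weierstrass_surface q <-> levelset (place q).
Proof.
  split; [apply weierstrass_levelset|]; intros H.
  destruct (levelset_weierstrass _ H) as (q' & Hq & E); apply place_inj in E; now subst.
Qed.

(** [place] is itself a similarity, so its inverse followed by the given placement is one too, with
    ratio lambda K34 / 2. *)
Lemma schwarz_similar P : schwarz_P_surface P ->
  exists mu u1 u2 u3 c, 0 < mu /\ orthonormal u1 u2 u3 /\
    forall p, P p <-> exists r, levelset r /\ p = vadd c (smul mu (lin u1 u2 u3 r)).
Proof.
  intros (lambda & g & Hl & Hg & HP); pose proof K34_pos as HK.
  destruct (isometry_affine g Hg) as (u1 & u2 & u3 & Hu & Hgu).
  set (o := g (0, 0, 0)) in *; set (mu := lambda * (K34 / 2)).
  exists mu, u1, u2, u3, (vsub o (smul mu (lin u1 u2 u3 (1, 0, 1 / 2)))).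
  split; [apply Rmult_lt_0_compat; lra|split; [exact Hu|]].
  assert (E : forall q : E3, vadd o (lin u1 u2 u3 (scal lambda q)) =
    vadd (vsub o (smul mu (lin u1 u2 u3 (1, 0, 1 / 2)))) (smul mu (lin u1 u2 u3 (place q)))).
  { intros q; rewrite scal_smul; clearbody o; unfold mu; clear - HK; vec; simpl; veq; field; lra. }
  intros p; rewrite HP; split.
  - intros (q & Hq & ->); exists (place q); split; [now apply weierstrass_iff|].
    rewrite Hgu; apply E.
  - intros (r & Hr & ->); destruct (levelset_weierstrass r Hr) as (q & Hq & <-).
    exists q; split; [exact Hq|]; rewrite Hgu; symmetry; apply E.
Qed.

Theorem theorem1p2 :
  forall P : R * R * R -> Prop,
    schwarz_P_surface P ->
    (forall v : R * R * R, translation_lattice P v <-> bcc_lattice v) ->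
    labyrinth_center P (0, 0, 0) ->
    (forall p : R * R * R, calP p = 0 <-> P p \/ bcc_lattice p) /\
    (forall p : R * R * R, ~ (P p /\ bcc_lattice p)) /\
    (forall p : R * R * R,
       bcc_lattice p <->
       exists n1 n2 n3 : Z,
         p = (IZR n1, IZR n2, IZR n3) /\
         (n1 mod 2 = n2 mod 2)%Z /\ (n2 mod 2 = n3 mod 2)%Z) /\
    discrete_set bcc_lattice /\
    (forall p : R * R * R, bcc_lattice p -> ~ closure P p).
Proof.
  intros P HP HL (_ & _ & _ & Hcen).
  destruct (schwarz_similar P HP) as (mu & u1 & u2 & u3 & c & Hmu & Hu & HS).
  pose proof (similar_levelset_eq P mu u1 u2 u3 c Hmu Hu HS HL Hcen) as HPl.
  split; [|split; [|split; [|split]]].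
  - intros p; rewrite HPl; apply calP_zero.
  - intros p [H1 H2]; apply HPl in H1; exact (levelset_not_bcc p H1 H2).
  - exact bcc_parity.
  - exact bcc_discrete.
  - intros p Hp Hc; apply (bcc_not_closure p Hp); intros e.
    destruct (Hc e) as (q & Hq & Hb); exists q; split; [now apply HPl|exact Hb].
Qed.
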